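(* Let $n$ be large and let $\delta,\kappa,\sigma,\beta,\beta'>0$ be constants with $\beta=\beta'$, $\kappa>\delta^{-1}$, $\delta^{-1}<\frac{\sigma\delta+\kappa}{2}$, and $$2\sigma>\max(\beta,\beta')+\tfrac{\delta^{-1}}{3\beta}(1+\mathbf{o}(1))+\tfrac{\sigma\delta+\kappa}{3\beta'}(1+\mathbf{o}(1)).$$ Let $d=\delta\left(\frac{\log n}{\log\log n}\right)^{1/3}$ be odd, $B=L_n(\frac13,\beta)$, $B'=L_n(\frac13,\beta')$. Let $m$ be uniformly random among the integers in $\left[2^{-1/d}L_n(\frac23,\delta^{-1}),L_n(\frac23,\delta^{-1})\right]$, and let $f(x,y)=\hat f_{m,n}(x,y)+\sum_{i=0}^{d-1}c_i(x-ym)x^{d-i-1}y^i$, where $\hat f_{m,n}(x,y)=\sum_{i=0}^de_ix^iy^{d-i}$ with $n=\sum_i e_im^i$ the base-$m$ expansion of $n$, and $c_i$ independent uniform in $\mathbb{I}\!\left(2L_n(\frac23,\kappa-\delta^{-1})\right)$. Let $\mathcal{X}_{f,m,n}$ be the set of integer pairs $(a,b)$ with $0\le a<|b|\le\frac12L_n(\frac13,\sigma)$, $a-bm$ $B$-smooth and $f(a,b)$ $B'$-smooth. Then $$\mathbb{E}_{m,f}\big(|\mathcal{X}_{f,m,n}|\big)\ge L_n\!\left(\tfrac13,\tau\right),\qquad \tau=2\sigma-\tfrac{\delta^{-1}}{3\beta}(1+\mathbf{o}(1))-\tfrac{\sigma\delta+\kappa}{3\beta'}(1+\mathbf{o}(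1)).$$
   Context: $L_x(\alpha,c)=\exp\!\big(c(\log x)^{\alpha}(\log\log x)^{1-\alpha}\big)$. $\mathbb{I}(L)=\left[-\frac12L,\frac12L\right)\cap\mathbb{Z}$. An integer is $y$-smooth if all its prime factors are $\le y$. $\mathbf{o}(1)$ denotes a quantity tending to $0$ as $n\to\infty$. *)

(* Defs.v *)
From Stdlib Require Import Reals ZArith List Znumtheory ClassicalEpsilon.
Open Scope R_scope.

Definition Lfun (x alpha c : R) : R :=
  exp (c * Rpower (ln x) alpha * Rpower (ln (ln x)) (1 - alpha)).

Definition zfloor (x : R) : Z := (up x - 1)%Z.
Definition zceil (x : R) : Z := (- zfloor (- x))%Z.

Definition zrange (lo hi : Z) : list Z :=
  map (fun k => (lo + Z.of_nat k)%Z) (seq 0 (Z.to_nat (hi - lo + 1))).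

(* I(L) = [-L/2, L/2) ∩ Z *)
Definition Icent (L : R) : list Z := zrange (zceil (- (L / 2))) (zceil (L / 2) - 1).

Fixpoint tuples (s : list Z) (k : nat) : list (list Z) :=
  match k with
  | O => nil :: nil
  | S k' => flat_map (fun x => map (cons x) (tuples s k')) s
  end.

(* z is y-smooth: every prime factor of z is <= y  (0 is divisible by every
   prime, hence never smooth) *)
Definition smooth (y : R) (z : Z) : Prop :=
  z <> 0%Z /\ forall p : Z, prime p -> (p | z)%Z -> IZR p <= y.

(* base-m digits of n with d+1 digits: e_i = (n / m^i) mod m for i < d,
   and the top digit e_d = n / m^d (the usual base-m expansion when
   m^d <= n < m^(d+1)); so sum_i e_i m^i = n. *)
Definition digit (n m : Z) (d i : nat) : Z :=
  if Nat.ltb i d then Z.modulo (Z.div n (m ^ Z.of_nat i)) m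
  else Z.div n (m ^ Z.of_nat d).

Definition zsum (l : list Z) : Z := fold_right Z.add 0%Z l.

Definition fhat (n m : Z) (d : nat) (x y : Z) : Z :=
  zsum (map (fun i => digit n m d i * x ^ Z.of_nat i * y ^ Z.of_nat (d - i))%Z
            (seq 0 (S d))).

Definition fpoly (n m : Z) (d : nat) (c : list Z) (x y : Z) : Z :=
  (fhat n m d x y +
   zsum (map (fun i => nth i c 0%Z * (x - y * m) * x ^ Z.of_nat (d - i - 1)
                          * y ^ Z.of_nat i)%Z (seq 0 d)))%Z.

Definition decideP (P : Prop) : bool :=
  if excluded_middle_informative P then true else false.

Definition cardX (n : nat) (m : Z) (d : nat) (c : list Z)
  (sigma beta beta' : R) : nat :=
  let K := zfloor (Lfun (INR n) (1/3) sigma / 2) in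
  let B := Lfun (INR n) (1/3) beta in
  let B' := Lfun (INR n) (1/3) beta' in
  length (filter
    (fun ab : Z * Z => let (a, b) := ab in
       decideP ((0 <= a)%Z /\ (a < Z.abs b)%Z
                /\ IZR (Z.abs b) <= Lfun (INR n) (1/3) sigma / 2
                /\ smooth B (a - b * m)%Z
                /\ smooth B' (fpoly (Z.of_nat n) m d c a b)))
    (list_prod (zrange 0 K) (zrange (- K) K))).

Definition avg {A : Type} (l : list A) (g : A -> R) : R :=
  fold_right Rplus 0 (map g l) / INR (length l).

Definition Mset (n : nat) (d : nat) (delta : R) : list Z :=
  let L := Lfun (INR n) (2/3) (/ delta) in
  zrange (zceil (Rpower 2 (- (1 / INR d)) * L)) (zfloor L).

Definition ExpX (n d : nat) (delta kappa sigma beta beta' : R) : R :=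
  avg (Mset n d delta) (fun m =>
    avg (tuples (Icent (2 * Lfun (INR n) (2/3) (kappa - / delta))) d)
        (fun c => INR (cardX n m d c sigma beta beta'))).

Definition tends_to_zero (e : nat -> R) : Prop :=
  forall eps, 0 < eps -> exists N, forall n, (N <= n)%nat -> Rabs (e n) < eps.

(* Main.v *)
Require Import Defs.
From Stdlib Require Import Reals ZArith Lia Lra List Znumtheory Zpow_facts Permutation ClassicalEpsilon.
From mathcomp Require ssreflect ssrbool eqtype ssrnat seq fintype div bigop prime binomial zify.

(* Write f(a,b) = fhat(a,b) + (a - b m) R(c).  If gcd(a,b) = 1 and 2a <= |b|, then R(c) takes
   every value t with |t| <= (C/2) |b|^(d-1) for a proportion e^(-O(d)) / (C |b|^(d-1)) of the
   coefficient vectors c, so that f(a,b) is spread evenly over a long segment of the class of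
   n b^d modulo q = |a - b m|.  It remains to produce many smooth q and, in a prescribed reduced
   class modulo q, many smooth integers.

   Both are products of primes, one from each of a family of disjoint bins (z/16, z] lying just
   below the smoothness bound.  By Chebyshev a bin of primes has density >> 1/ln z, with
   ln ln z ~ (1/3) ln ln n, so u bins give the expected proportion u^(-u(1+o(1))).

   Let S be such a set of products.  Its collisions modulo q are sums of |sum_s e(a s/r)|^2 over
   the divisors r of q.  On average over q the large sieve makes the terms r > 1 smaller than
   |S|^2 by a power of the smoothness bound, because |S| exceeds q (this is
   1/delta < (sigma delta + kappa)/2).  For all but few q, Cauchy-Schwarz shows that every reduced class modulo q contains at least
   |S|^2 / (2q) products s s', and each integer is such a product in at most 2^u ways.

   Finally every pair (q, b) with gcd(q, b) = 1 and q/b in the range of m comes from a pair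
   (a, +-b) and an m with |a - b m| = q, which counts the smooth values of a - b m. *)

(** The obstacle is the size of q: it is near L_n(2/3, 1/delta), while the primes in play are at
    most L_n(1/3, beta), and the smooth values must be found in one prescribed class modulo q. This
    is shown only for most q.

    A bound on the collisions of S modulo q does not show that S itself meets a given class r. It
    does show that the residues of S and those of r/S are each too spread out to avoid one another;
    this is why the smooth values are built as s s'.

    Taking exactly one prime from each bin gives squarefree products with unique factorization, and
    separating the bins of q from those of S makes every s coprime to every q. Compared with the
    expected proportion this costs only factors exponential in the number of bins, which the o(1)
    absorbs.

    S must match the size of the values of f, so q and b have to be known up to constants before S
    is chosen: q is confined to one interval [e^w, e^(w+1)), found by pigeonhole.

    The o(1) comes from an estimate with a fixed loss eta, valid for all large n, followed by a
    diagonal choice of eta. *)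

Module Chebyshev.
Import ssreflect ssrbool eqtype ssrnat seq fintype div bigop prime binomial zify.
Local Open Scope nat_scope.

(** * Chebyshev's lower bound for the primes just below z *)

Definition primorial (n : nat) : nat := \prod_(0 <= p < n.+1 | prime p) p.

Lemma dvdn_prod_primes (l : seq nat) (N : nat) :
  uniq l -> all prime l -> (forall p, p \in l -> p %| N) -> \prod_(p <- l) p %| N.
Proof.
elim: l => [|p l IH] /=; first by rewrite big_nil dvd1n.
move=> /andP[pl ul] /andP[pp al] H; rewrite big_cons Gauss_dvd; last first.
  rewrite coprime_sym; rewrite big_seq; elim/big_rec: _ => [|q x ql cx]; first exact: coprime1n.
  rewrite coprimeMl cx andbT coprime_sym prime_coprime // dvdn_prime2 //; last exact: (allP al).
  by apply/negP => /eqP epq; move: pl; rewrite epq ql.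
rewrite H ?mem_head //=; apply: IH => // q ql; apply: H; by rewrite in_cons ql orbT.
Qed.

Lemma prime_ndvd_fact (p k : nat) : prime p -> k < p -> ~~ (p %| k`!).
Proof.
move=> pp kp; apply/negP; rewrite fact_prod big_seq; elim/big_rec: _ => [|i x]; first by rewrite Euclid_dvd1.
rewrite mem_index_iota => hi hx; rewrite Euclid_dvdM // => /orP[/dvdn_leq|//]; lia.
Qed.

(** Erdős's induction: an even n > 2 is not prime and adds no factor, and for n = 2m + 1 the primes
    in (m + 1, 2m + 1] all divide C(2m + 1, m), which is at most 4^m as one of two equal terms in
    the expansion of 2^(2m + 1). *)
Lemma primorial_le (n : nat) : primorial n <= 4 ^ n.
Proof.
elim/ltn_ind: n => n IH.
case: n IH => [|[|[|n]]] IH; rewrite ?/primorial; try by rewrite unlock.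
have [od|ev] := boolP (odd n.+3); last first.
  rewrite big_mkcond big_nat_recr //= ifN; last first.
    by apply: contra ev => /even_prime [].
  by rewrite muln1 -big_mkcond; apply: leq_trans (IH n.+2 _) _; rewrite ?leq_exp2l.
have [m e] : exists m, n.+3 = m.*2.+1 by exists n.+3./2; rewrite -[LHS]odd_double_half od.
have m0 : 0 < m by case: m e.
rewrite e (@big_cat_nat _ _ _ m.+2) //=; last by rewrite -addnn; lia.
have h1 : primorial m.+1 <= 4 ^ m.+1 by apply: IH; rewrite e -addnn; lia.
have h2 : \prod_(m.+2 <= p < m.*2.+2 | prime p) p <= 'C(m.*2.+1, m).
  rewrite -big_filter; apply: dvdn_leq; first by rewrite bin_gt0 -addnn; lia.
  apply: dvdn_prod_primes; first by rewrite filter_uniq // iota_uniq.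
    by apply/allP => p; rewrite mem_filter => /andP[].
  move=> p; rewrite mem_filter mem_index_iota => /andP[pp /andP[p1 p2]].
  have := bin_fact (n := m.*2.+1) (m := m) ltac:(rewrite -addnn; lia) => eq.
  have : p %| 'C(m.*2.+1, m) * (m`! * (m.*2.+1 - m)`!).
    rewrite eq; apply: dvdn_fact; lia.
  rewrite !Euclid_dvdM // => /orP[//|/orP[]]; rewrite (negbTE (prime_ndvd_fact _ _ pp _)) //; clear -p1 p2; rewrite -addnn in p2 *; lia.
have h3 : 'C(m.*2.+1, m) <= 4 ^ m.
  have := Pascal 1 1 m.*2.+1; rewrite addn1 => hP.
  have hs : 'C(m.*2.+1, m) + 'C(m.*2.+1, m.+1) <= 2 ^ m.*2.+1.
    rewrite hP (bigD1 (inord m)) //= (bigD1 (inord m.+1)) /=; last first.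
      by rewrite -val_eqE /= !inordK -?addnn; lia.
    rewrite !inordK -?addnn ?exp1n; try lia.
  have es : 'C(m.*2.+1, m.+1) = 'C(m.*2.+1, m).
    rewrite -(@bin_sub m.*2.+1 m); last by rewrite -addnn; lia.
    by have -> : m.*2.+1 - m = m.+1 by clear; rewrite -addnn; lia.
  have e4 : 4 ^ m = 2 ^ m.*2 by rewrite -mul2n (expnM 2 2).
  by move: hs; rewrite es e4 expnS; clear; lia.
have -> : 4 ^ m.*2.+1 = 4 ^ m.+1 * 4 ^ m by rewrite -expnD; congr expn; rewrite -addnn; lia.
apply: leq_mul => //; exact: leq_trans h2 h3.
Qed.

Lemma central_bin_lb (m : nat) : 4 ^ m <= m.*2.+1 * 'C(m.*2, m).
Proof.
elim: m => [|m IH]; first by rewrite bin0.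
have e1 : m.+1 * 'C(m.+1.*2, m.+1) = (4 * m + 2) * 'C(m.*2, m).
  have h1 := mul_bin_diag m.*2.+2 m; have h2 := mul_bin_down m.*2.+1 m.
  have e0: m.*2.+1 - m = m.+1 by rewrite -addnn; lia.
  have h3 : m.+1 * 'C(m.*2.+1, m) = m.*2.+1 * 'C(m.*2, m) by rewrite -{1}e0 -h2.
  rewrite doubleS -h1 /=.
  have : m.*2.+2 * 'C(m.*2.+1, m) = 2 * (m.+1 * 'C(m.*2.+1, m)) by rewrite mulnA; congr muln; rewrite -addnn; lia.
  move=> ->; rewrite h3 mulnA; congr muln; rewrite -addnn; lia.
rewrite expnS; nia.
Qed.

(** By Legendre's formula the exponent is the sum over k of floor(2m / p^k) - 2 floor(m / p^k); each
    term is at most 1 and vanishes once p^k > 2m. *)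
Lemma logn_central (p m : nat) : prime p -> 0 < m ->
  logn p 'C(m.*2, m) <= trunc_log p m.*2.
Proof.
move=> pp m0.
have p1 := prime_gt1 pp.
have hm : m <= m.*2 by rewrite -addnn; lia.
have eq := bin_fact hm.
have e2 : m.*2 - m = m by rewrite -addnn; lia.
rewrite e2 in eq.
have hl : logn p 'C(m.*2, m) + 2 * logn p m`! = logn p (m.*2)`!.
  rewrite -eq !lognM ?muln_gt0 ?fact_gt0 ?bin_gt0 //; lia.
move: hl; rewrite !logn_fact //.
have t1 : (trunc_log p m.*2) <= m.*2.
  have := trunc_logP p1 (n := m.*2) ltac:(rewrite -addnn; lia).
  move=> h; apply: leq_trans h; exact: ltnW (ltn_expl _ p1).
rewrite (@big_cat_nat _ _ _ (trunc_log p m.*2).+1 _ m.*2.+1) //=.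
have -> : \sum_((trunc_log p m.*2).+1 <= i < m.*2.+1) m.*2 %/ p ^ i = 0.
  rewrite big_nat_cond big1 // => i; rewrite andbT => /andP[hi _].
  rewrite divn_small //; apply: leq_trans (trunc_log_ltn _ p1) _; rewrite leq_exp2l //.
rewrite addn0.
have h1 : \sum_(1 <= k < (trunc_log p m.*2).+1) m.*2 %/ p ^ k
   <= 2 * (\sum_(1 <= k < (trunc_log p m.*2).+1) m %/ p ^ k) + trunc_log p m.*2.
  have hT : \sum_(1 <= k < (trunc_log p m.*2).+1) 1 = trunc_log p m.*2 by rewrite sum_nat_const_nat muln1 subn1.
  set T := trunc_log p m.*2 in hT *.
  apply: (@leq_trans (2 * \sum_(1 <= k < T.+1) m %/ p ^ k + \sum_(1 <= k < T.+1) 1)); last by rewrite hT.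
  rewrite big_distrr /=.
  rewrite -big_split /=; apply: leq_sum => i _.
  have pi0 : 0 < p ^ i by rewrite expn_gt0; lia.
  have := ltn_ceil m pi0; have := leq_trunc_div m.*2 (p ^ i).
  rewrite -addnn; move: (p ^ i) pi0 => P; clear.
  set x := m %/ P; set z := (m + m) %/ P; clearbody x z; nia.
have h2 : \sum_(1 <= k < (trunc_log p m.*2).+1) m %/ p ^ k <= \sum_(1 <= k < m.+1) m %/ p ^ k.
  have [le|lt] := leqP (trunc_log p m.*2) m.
    by rewrite [X in _ <= X](@big_cat_nat _ _ _ (trunc_log p m.*2).+1) //=; apply: leq_addr.
  rewrite (@big_cat_nat _ _ _ m.+1) //=; last lia.
  rewrite [X in _ + X <= _]big_nat_cond [X in _ + X <= _]big1 ?addn0 // => i; rewrite andbT => /andP[hi _].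
  rewrite divn_small //; apply: leq_trans hi _; exact: ltnW (ltn_expl _ p1).
lia.
Qed.

(** Primes up to s contribute at most 2m each. Those in (s, m/4] have exponent at most 1, as p^2 >
    2m, so together they divide the primorial of m/4. The remaining ones again give at most 2m each.
    Cutting at m/4 keeps the middle factor 4^(m/4) far below 4^m, so the last group must be
    large. *)
Lemma central_bin_ub (m s : nat) : 0 < m -> m.*2 < s.+1 ^ 2 ->
  'C(m.*2, m) <= m.*2 ^ s * 4 ^ (m %/ 4) *
     m.*2 ^ size [seq p <- index_iota (m %/ 4).+1 m.*2.+1 | prime p].
Proof.
move=> m0 hs.
set C := 'C(_, _); set k := m %/ 4.
have C0 : 0 < C by rewrite /C bin_gt0 -addnn; lia.
have hd p : prime p -> p ^ logn p C <= m.*2.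
  move=> pp; have := logn_central p m pp m0; have := trunc_logP (prime_gt1 pp) (n := m.*2) ltac:(rewrite -addnn; lia).
  move=> h1 h2; apply: leq_trans h1; rewrite leq_exp2l //; exact: prime_gt1.
have hbig p : prime p -> s < p -> logn p C <= 1.
  move=> pp sp; rewrite leqNgt; apply/negP => h.
  have : p ^ 2 <= m.*2 by apply: leq_trans (hd _ pp); rewrite leq_exp2l //; exact: prime_gt1.
  rewrite leqNgt => /negP; apply; apply: leq_trans hs _; by rewrite leq_exp2r.
have eC : C = \prod_(0 <= p < m.*2.+1 | prime p) p ^ logn p C.
  rewrite -{1}(partnT C0) /partn.
  have hC: forall p, prime p -> m.*2 < p -> logn p C = 0.
    move=> p pp hp; have := hd _ pp; case: (logn p C) => // e h.
    have: p <= p ^ e.+1 by rewrite expnS leq_pmulr // expn_gt0 prime_gt0.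
    lia.
  have h : \prod_(0 <= p < C.+1 | p \in predT) p ^ logn p C = \prod_(0 <= p < C.+1 | prime p) p ^ logn p C.
    rewrite [RHS]big_mkcond; apply: eq_big_nat => p _; case: ifP => // hp; by rewrite lognE hp.
  rewrite h; clear h.
  have [le|lt] := leqP C m.*2.
    rewrite [RHS](@big_cat_nat _ _ _ C.+1) //=.
    rewrite [X in _ = _ * X]big_nat_cond [X in _ = _ * X]big1 ?muln1 // => p /andP[/andP[hp _] pp].
    rewrite lognE pp C0 /=; case: ifP => // /dvdn_leq; lia.
  rewrite (@big_cat_nat _ _ _ m.*2.+1) //=; last lia.
  rewrite [X in _ * X = _]big_nat_cond [X in _ * X = _]big1 ?muln1 // => p /andP[/andP[hp _] pp].
  by rewrite hC.
rewrite eC (@big_cat_nat _ _ _ k.+1) //=; last by rewrite /k -addnn; lia.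
have m20 : 0 < m.*2 by rewrite -addnn; lia.
apply: leq_mul; last first.
  rewrite -big_filter big_seq.
  have: \prod_(i <- [seq p <- index_iota k.+1 m.*2.+1 | prime p] | i \in [seq p <- index_iota k.+1 m.*2.+1 | prime p]) i ^ logn i C <= \prod_(i <- [seq p <- index_iota k.+1 m.*2.+1 | prime p] | i \in [seq p <- index_iota k.+1 m.*2.+1 | prime p]) m.*2.
    apply: leq_prod => p; rewrite mem_filter => /andP[pp _]; exact: hd.
  by rewrite -[X in _ <= X]big_seq big_const_seq count_predT iter_muln_1.
apply: (@leq_trans (\prod_(0 <= p < k.+1 | prime p) ((if p <= s then m.*2 else 1) * p))).
  apply: leq_prod => p pp; have p0 := prime_gt0 pp.
  case: ifP => hp; first by apply: leq_trans (hd _ pp) _; rewrite leq_pmulr.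
  rewrite mul1n -[X in _ <= X]expn1 leq_exp2l ?prime_gt1 //; apply: hbig => //; lia.
rewrite big_split /=; apply: leq_mul; last exact: primorial_le.
rewrite -big_mkcondr -big_filter big_const_seq count_predT iter_muln_1.
apply: leq_pexp2l => //.
rewrite -[X in _ <= X](size_iota 1); apply: uniq_leq_size.
  by rewrite filter_uniq // iota_uniq.
move=> p; rewrite mem_filter mem_iota => /andP[/andP[pp hp] _]; have := prime_gt0 pp; lia.
Qed.

Lemma in_List (T : eqType) (x : T) (l : seq T) : List.In x l <-> x \in l.
Proof.
elim: l => [|y l IH] //=; rewrite in_cons; split.
  by case=> [->|/IH ->]; rewrite ?eqxx ?orbT.
by case/orP => [/eqP ->|/IH]; [left|right].
Qed.

Lemma NoDup_uniq (T : eqType) (l : seq T) : uniq l -> List.NoDup l.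
Proof.
elim: l => [|y l IH] /=; first by constructor.
by case/andP => /negP yl ul; constructor; [move/in_List|exact: IH].
Qed.

Lemma prime_Z (p : nat) : prime p -> Znumtheory.prime (Z.of_nat p).
Proof.
move=> pp; have p1 := prime_gt1 pp.
apply: Znumtheory.prime_intro; first lia.
move=> n hn; apply/Znumtheory.Zgcd_1_rel_prime.
set g := Z.gcd n (Z.of_nat p).
have g0 := Z.gcd_nonneg n (Z.of_nat p).
have [k hk] : Z.divide g (Z.of_nat p) by apply: Z.gcd_divide_r.
have [k' hk'] : Z.divide g n by apply: Z.gcd_divide_l.
rewrite -/g in g0.
have hk0 : (0 <= k)%Z by nia.
have : Z.to_nat g %| p by apply/dvdnP; exists (Z.to_nat k); rewrite -multE; apply: Nat2Z.inj; rewrite Nat2Z.inj_mul !Z2Nat.id.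
case/primeP: pp => _ H /H /orP [] /eqP h; first by lia.
have hg : g = Z.of_nat p by rewrite -h Z2Nat.id.
rewrite hg in hk'; clear -hk' hn.
by case: (Z.le_gt_cases k' 0) => h; exfalso; nia.
Qed.

Lemma expn_pow (a b : nat) : expn a b = Nat.pow a b.
Proof. by elim: b => [|b IH] //=; rewrite expnS IH. Qed.

(** The two bounds for C(2m, m) put together and carried over to the integers and lists used in the
    rest of the proof. The count of primes sits in the last exponent. *)
Lemma chebyshev_nat (m s : nat) : (0 < m)%coq_nat -> (2 * m < S s * S s)%coq_nat ->
  exists l : list nat, List.NoDup l /\
    (forall p, List.In p l -> Znumtheory.prime (Z.of_nat p) /\ (m < 4 * p)%coq_nat /\ (p <= 2 * m)%coq_nat) /\
    (Nat.pow 4 m <= (2 * m + 1) * (Nat.pow (2 * m) s * Nat.pow 4 (Nat.div m 4) * Nat.pow (2 * m) (length l)))%coq_nat.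
Proof.
move=> m0 hs.
have em : m.*2 = (2 * m)%coq_nat by rewrite -mul2n.
have ed : m %/ 4 = Nat.div m 4 by apply/eqP; rewrite eqn_leq; apply/andP; split; have := Nat.div_mod_eq m 4; have := Nat.mod_upper_bound m 4; have := divn_eq m 4; have := @ltn_mod m 4; lia.
have h1 := central_bin_lb m.
have h2 := @central_bin_ub m s ltac:(lia) ltac:(rewrite expn_pow /= -addnn; lia).
exists [seq p <- index_iota (m %/ 4).+1 m.*2.+1 | prime p]; split; [|split].
- by apply: NoDup_uniq; rewrite filter_uniq // iota_uniq.
- move=> p /in_List; rewrite mem_filter mem_index_iota => /andP[pp hp]; split; first exact: prime_Z.
  have := divn_eq m 4; have := @ltn_mod m 4; lia.
- move: h1 h2; rewrite -!expn_pow -ed -!mul2n.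
  set l := filter _ _; rewrite -/(size l); set a := 4 ^ m; set b := 'C(_, _).
  set x := _ * _ * _ => h1 h2.
  have h : a <= (2 * m).+1 * x by apply: leq_trans h1 _; rewrite leq_mul2l h2 orbT.
  by apply/leP; rewrite addn1.
Qed.
End Chebyshev.

Import ListNotations.
Open Scope R_scope.
Set Bullet Behavior "Strict Subproofs".


Lemma zfloor_spec (x : R) : IZR (zfloor x) <= x < IZR (zfloor x) + 1.
Proof. unfold zfloor. rewrite minus_IZR. destruct (archimed x). lra. Qed.

Lemma zceil_spec (x : R) : x <= IZR (zceil x) < x + 1.
Proof. unfold zceil. rewrite opp_IZR. destruct (zfloor_spec (- x)). lra. Qed.

Lemma ln_lt_self (x : R) : 0 < x -> ln x < x.
Proof.
  intros H. rewrite <- (ln_exp x) at 2. apply ln_increasing; auto.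
  pose proof (exp_ineq1 x); lra.
Qed.

Lemma ln_le_mono (x y : R) : 0 < x -> x <= y -> ln x <= ln y.
Proof. intros H [H1| ->]; [left; apply ln_increasing; auto|lra]. Qed.

Lemma exp_le_mono (x y : R) : x <= y -> exp x <= exp y.
Proof. intros [H1| ->]; [left; apply exp_increasing; auto|lra]. Qed.

Lemma INR_nat_pow (a b : nat) : INR (Nat.pow a b) = INR a ^ b.
Proof. apply pow_INR. Qed.

Lemma ln_4_gt_1 : 1 < ln 4.
Proof.
  rewrite <- (ln_exp 1) at 1. apply ln_increasing; [apply exp_pos|]. pose proof exp_le_3; lra.
Qed.

(** With m = floor(z/2) the primes p with m/4 < p <= 2m even lie in (z/8, z]. *)
Lemma chebyshev_window (z : R) : 10 ^ 8 <= z ->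
  exists l : list Z, NoDup l /\
    (forall p, In p l -> prime p /\ z / 16 < IZR p <= z) /\
    z / (8 * ln z) <= INR (length l).
Proof.
  intros Hz.
  assert (Hz0 : 0 < z) by (simpl in Hz; lra).
  (* t is z^(1/4): then ln z <= 4 t, and every error term is a power of t. The threshold 10^8 means
     t >= 100. *)
  set (t := sqrt (sqrt z)).
  assert (Hs : sqrt z = t * t) by (unfold t; rewrite sqrt_sqrt; [auto|apply sqrt_pos]).
  assert (Ht0 : 0 <= t) by apply sqrt_pos.
  assert (Htz : z = (t * t) * (t * t)) by (rewrite <- Hs, sqrt_sqrt; lra).
  assert (Ht : 100 <= t).
  { destruct (Rle_lt_dec 100 t) as [h|h]; auto. exfalso.
    assert (t * t < 10000) by nra. assert (0 <= t * t) by nra. simpl in Hz; nra. }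
  assert (Hlnz : ln z <= 4 * t).
  { rewrite Htz, !ln_mult by nra. pose proof (ln_lt_self t ltac:(lra)). lra. }
  set (m := Z.to_nat (zfloor (z / 2))).
  assert (Hm : z / 2 - 1 < INR m <= z / 2).
  { destruct (zfloor_spec (z / 2)). unfold m. rewrite INR_IZR_INZ, Z2Nat.id.
    lra. apply le_IZR; simpl in Hz. assert (-1 < zfloor (z/2))%Z; [|apply IZR_le; lia]. apply lt_IZR; lra. }
  assert (Hm1 : (1 <= m)%nat). { apply INR_le; simpl in *; lra. }
  destruct (Chebyshev.chebyshev_nat m (Nat.sqrt (2 * m))) as (l & Hnd & Hp & Hcard); [lia|apply Nat.sqrt_spec; lia|].
  exists (map Z.of_nat l). split; [|split].
  - apply FinFun.Injective_map_NoDup; auto. intros x y; lia.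
  - intros p Hin. apply in_map_iff in Hin. destruct Hin as (q & <- & Hin).
    destruct (Hp q Hin) as (H1 & H2 & H3). split; auto.
    rewrite <- INR_IZR_INZ. apply le_INR in H3.
    assert (H2' : (m + 1 <= 4 * q)%nat) by lia. apply le_INR in H2'.
    rewrite plus_INR, mult_INR in H2'. rewrite mult_INR in H3. simpl in *; lra.
  - rewrite length_map. apply le_INR in Hcard.
    rewrite !mult_INR, !INR_nat_pow, plus_INR, !mult_INR in Hcard.
    set (M := INR m) in *. replace (INR 2) with 2 in Hcard by (simpl; lra).
    replace (INR 4) with 4 in Hcard by (simpl; lra). replace (INR 1) with 1 in Hcard by reflexivity.
    assert (HM : 1 <= M) by (simpl in Hz; lra).
    apply ln_le_mono in Hcard; [|apply pow_lt; lra].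
    assert (HP : forall k, 0 < (2 * M) ^ k) by (intros; apply pow_lt; lra).
    assert (HP4 : forall k, 0 < 4 ^ k) by (intros; apply pow_lt; lra).
    rewrite !ln_mult in Hcard by (repeat apply Rmult_lt_0_compat; auto; lra).
    rewrite !ln_pow in Hcard by lra.
    assert (Hd : INR (Nat.div m 4) <= M / 4).
    { pose proof (Nat.Div0.mul_div_le m 4) as h. apply le_INR in h. rewrite mult_INR in h.
      replace (INR 4) with 4 in h by (simpl; lra). unfold M; lra. }
    assert (Hsq : INR (Nat.sqrt (2 * m)) <= t * t).
    { destruct (Nat.sqrt_spec (2 * m) ltac:(lia)) as [h _]. apply le_INR in h.
      rewrite !mult_INR in h. replace (INR 2) with 2 in h by (simpl; lra). fold M in h.
      pose proof (pos_INR (Nat.sqrt (2 * m))).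
      destruct (Rle_lt_dec (INR (Nat.sqrt (2 * m))) (t * t)) as [g|g]; auto. exfalso.
      assert (0 <= t * t) by nra. nra. }
    assert (L0 : 0 < ln (2 * M)) by (rewrite <- ln_1; apply ln_increasing; lra).
    assert (L1 : ln (2 * M) <= ln z) by (apply ln_le_mono; lra).
    assert (L2 : ln (2 * M + 1) <= ln 4 + ln z).
    { rewrite <- ln_mult by lra. apply ln_le_mono; simpl in Hz; lra. }
    assert (L4 : ln 4 <= 2).
    { left. rewrite <- (ln_exp 2). apply ln_increasing; [lra|].
      assert (e : exp 2 = exp 1 * exp 1) by (rewrite <- exp_plus; f_equal; lra).
      pose proof (exp_ineq1 1 ltac:(lra)). nra. }
    pose proof ln_4_gt_1.
    set (c := INR (length l)) in *.
    assert (C0 : 0 <= c) by apply pos_INR.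
    (* After taking logarithms, (3/4) M ln 4 stands against c ln z and errors of order sqrt z ln z.
       As M is close to z/2 and ln 4 > 1, there is room for z/8. *)
    assert (Hmain : z / 8 <= c * ln z).
    { assert (h1 : c * ln (2 * M) <= c * ln z) by nra.
      assert (h2 : INR (Nat.sqrt (2 * m)) * ln (2 * M) <= t * t * (4 * t)).
      { apply Rmult_le_compat; try lra. apply pos_INR. }
      assert (h3 : INR (Nat.div m 4) * ln 4 <= M / 4 * ln 4) by nra.
      assert (h4 : 3 / 4 * M * 1 <= 3 / 4 * M * ln 4) by nra.
      assert (h5 : t * t * (4 * t) <= t * t * t * t / 25) by (assert (0 <= t*t*t) by (repeat apply Rmult_le_pos; lra); nra).
      assert (h6 : 1000000 * t <= t * t * t * t).
      { assert (10000 <= t * t) by nra. assert (1000000 <= t * t * t) by nra. nra. }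
      fold M in Hcard. replace z with (t * t * t * t) by (rewrite Htz; ring).
      assert (Htz' : z = t * t * t * t) by (rewrite Htz; ring).
      assert (h7 : z / 2 - 1 < M) by lra. rewrite Htz' in h7.
      assert (Hl' : ln (t * t * t * t) <= 4 * t) by (rewrite <- Htz'; auto).
      rewrite Htz' in h1, L2. lra. }
    apply Rmult_le_reg_r with (8 * ln z); [nra|]. field_simplify; nra.
Qed.


(** * The additive large sieve *)

Definition rsum {A : Type} (f : A -> R) (l : list A) : R := fold_right Rplus 0 (map f l).

Section RSum.
Context {A B : Type}.
Implicit Types (f g : A -> R) (l : list A).

Lemma rsum_cons f x l : rsum f (x :: l) = f x + rsum f l.
Proof. reflexivity. Qed.

Lemma rsum_app f l l' : rsum f (l ++ l') = rsum f l + rsum f l'.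
Proof. induction l as [|x l IH]; simpl; [cbn; lra|]. rewrite !rsum_cons, IH. lra. Qed.

Lemma rsum_ext_in f g l : (forall x, In x l -> f x = g x) -> rsum f l = rsum g l.
Proof. unfold rsum. intros H. f_equal. apply map_ext_in; auto. Qed.

Lemma rsum_le f g l : (forall x, In x l -> f x <= g x) -> rsum f l <= rsum g l.
Proof.
  induction l as [|x l IH]; intros H; [apply Rle_refl|].
  rewrite !rsum_cons. apply Rplus_le_compat; [apply H; left; auto|apply IH; intros; apply H; right; auto].
Qed.

Lemma rsum_plus f g l : rsum (fun x => f x + g x) l = rsum f l + rsum g l.
Proof. induction l as [|x l IH]; [cbn; lra|]. rewrite !rsum_cons, IH. lra. Qed.

Lemma rsum_scal c f l : rsum (fun x => c * f x) l = c * rsum f l.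
Proof. induction l as [|x l IH]; [cbn; lra|]. rewrite !rsum_cons, IH. lra. Qed.

Lemma rsum_scal_r c f l : rsum (fun x => f x * c) l = rsum f l * c.
Proof. induction l as [|x l IH]; [cbn; lra|]. rewrite !rsum_cons, IH. lra. Qed.

Lemma rsum_const c l : rsum (fun _ => c) l = INR (length l) * c.
Proof.
  induction l as [|x l IH]; [cbn; lra|]. rewrite rsum_cons, IH.
  change (length (x :: l)) with (S (length l)). rewrite S_INR. lra.
Qed.

Lemma rsum_nonneg f l : (forall x, In x l -> 0 <= f x) -> 0 <= rsum f l.
Proof.
  intros H. apply Rle_trans with (rsum (fun _ => 0) l).
  rewrite rsum_const; lra. apply rsum_le; auto.
Qed.

Lemma rsum_ge_const c f l : (forall x, In x l -> c <= f x) -> INR (length l) * c <= rsum f l.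
Proof. intros H. rewrite <- rsum_const. apply rsum_le; auto. Qed.

Lemma rsum_le_const c f l : (forall x, In x l -> f x <= c) -> rsum f l <= INR (length l) * c.
Proof. intros H. rewrite <- rsum_const. apply rsum_le; auto. Qed.

Lemma rsum_incl f l l' : NoDup l -> incl l l' -> (forall x, In x l' -> 0 <= f x) ->
  rsum f l <= rsum f l'.
Proof.
  revert l'. induction l as [|x l IH]; intros l' Hn Hi H0.
  - apply rsum_nonneg; auto.
  - assert (Hx : In x l') by (apply Hi; left; auto).
    apply in_split in Hx. destruct Hx as (l1 & l2 & ->).
    inversion_clear Hn as [|? ? Hx Hn'].
    rewrite rsum_app, !rsum_cons.
    assert (K : rsum f l <= rsum f (l1 ++ l2)); [|rewrite rsum_app in K; lra].
    apply IH; auto.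
    + intros y Hy. assert (Hy' := Hi y (or_intror Hy)). apply in_app_iff in Hy'.
      apply in_app_iff. destruct Hy' as [?|[->|?]]; auto. contradiction.
    + intros y Hy. apply H0. apply in_app_iff in Hy. apply in_app_iff. simpl. tauto.
Qed.

Lemma rsum_abs f l : Rabs (rsum f l) <= rsum (fun x => Rabs (f x)) l.
Proof.
  induction l as [|x l IH]; [cbn; rewrite Rabs_R0; lra|]. rewrite !rsum_cons.
  eapply Rle_trans; [apply Rabs_triang|]. lra.
Qed.

Lemma rsum_filter (p : A -> bool) f l :
  rsum f (filter p l) = rsum (fun x => if p x then f x else 0) l.
Proof.
  induction l as [|x l IH]; auto. simpl. rewrite rsum_cons. destruct (p x); rewrite ?rsum_cons, IH; lra.
Qed.

Lemma length_filter_rsum (p : A -> bool) l :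
  INR (length (filter p l)) = rsum (fun x => if p x then 1 else 0) l.
Proof. rewrite <- (Rmult_1_r (INR _)), <- rsum_const. apply rsum_filter. Qed.

Lemma rsum_pick f l x : In x l -> (forall y, In y l -> 0 <= f y) -> f x <= rsum f l.
Proof.
  intros Hx H0. apply Rle_trans with (rsum f [x]); [cbn; lra|].
  apply rsum_incl; auto. constructor; [simpl; tauto|constructor]. intros y [->|[]]; auto.
Qed.

Lemma rsum_map (h : A -> B) (f : B -> R) l : rsum f (map h l) = rsum (fun x => f (h x)) l.
Proof. unfold rsum. rewrite map_map. reflexivity. Qed.

End RSum.

Lemma rsum_flat_map {A B : Type} (h : A -> list B) (f : B -> R) (l : list A) :
  rsum f (flat_map h l) = rsum (fun x => rsum f (h x)) l.
Proof. induction l as [|x l IH]; auto. simpl. rewrite rsum_app, rsum_cons, IH. reflexivity. Qed.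
Lemma rsum_swap {A B : Type} (f : A -> B -> R) (l : list A) (l' : list B) :
  rsum (fun x => rsum (f x) l') l = rsum (fun y => rsum (fun x => f x y) l) l'.
Proof.
  induction l as [|x l IH].
  - change (rsum (fun x => rsum (f x) l') []) with 0.
    rewrite (rsum_ext_in _ (fun _ => 0)), rsum_const by reflexivity. lra.
  - rewrite rsum_cons, IH, <- rsum_plus. reflexivity.
Qed.

Lemma rsum_inj_le {A B : Type} (h : A -> B) (f : B -> R) (l : list A) (l' : list B) :
  NoDup l -> (forall x y, In x l -> In y l -> h x = h y -> x = y) ->
  (forall x, In x l -> In (h x) l') -> (forall y, In y l' -> 0 <= f y) ->
  rsum (fun x => f (h x)) l <= rsum f l'.
Proof.
  intros Hn Hinj Hin H0. rewrite <- rsum_map. apply rsum_incl; auto.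
  - clear Hin. induction Hn as [|x l Hx Hn IH]; simpl; constructor.
    + intros Hi. apply in_map_iff in Hi. destruct Hi as (y & e & Hy).
      apply Hx. rewrite (Hinj x y); simpl; auto.
    + apply IH. intros; apply Hinj; simpl; auto.
  - intros y Hy. apply in_map_iff in Hy. destruct Hy as (x & <- & Hx); auto.
Qed.

Lemma rsum_mult {A B : Type} (f : A -> R) (g : B -> R) (l : list A) (l' : list B) :
  rsum f l * rsum g l' = rsum (fun x => rsum (fun y => f x * g y) l') l.
Proof.
  rewrite <- rsum_scal_r. apply rsum_ext_in. intros. rewrite rsum_scal. reflexivity.
Qed.

(** Cauchy-Schwarz against the constant 1, read off from the sum of the squares of n f - s. *)
Lemma rsum_sqr_le {A : Type} (f : A -> R) (l : list A) :
  (rsum f l) ^ 2 <= INR (length l) * rsum (fun x => f x ^ 2) l.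
Proof.
  set (n := INR (length l)). set (s := rsum f l). set (q := rsum (fun x => f x ^ 2) l).
  assert (H : 0 <= rsum (fun x => (n * f x - s) ^ 2) l) by (apply rsum_nonneg; intros; apply pow2_ge_0).
  rewrite (rsum_ext_in _ (fun x => (n * n * f x ^ 2 + - (2 * n * s) * f x) + s * s)) in H by (intros; ring).
  rewrite !rsum_plus, !rsum_scal, rsum_const in H. fold s q n in H.
  assert (Hn : 0 <= n) by apply pos_INR.
  destruct Hn as [Hn|Hn].
  - assert (0 <= n * (n * q - s ^ 2)) by nra. apply Rmult_le_reg_l with n; auto. nra.
  - assert (l = []) as ->.
    { destruct l; auto. exfalso. unfold n in Hn. simpl length in Hn. rewrite S_INR in Hn.
      pose proof (pos_INR (length l)); lra. }
    unfold s, q, n; cbn; lra.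
Qed.

Definition zN (N : nat) : list Z := map Z.of_nat (seq 0 N).

Lemma in_zN (N : nat) (x : Z) : In x (zN N) <-> (0 <= x < Z.of_nat N)%Z.
Proof.
  unfold zN. rewrite in_map_iff. split.
  - intros (k & <- & Hk). apply in_seq in Hk. lia.
  - intros H. exists (Z.to_nat x). rewrite in_seq. lia.
Qed.

Lemma NoDup_zN (N : nat) : NoDup (zN N).
Proof. apply FinFun.Injective_map_NoDup; [intros x y; lia|apply seq_NoDup]. Qed.

Lemma length_zN (N : nat) : length (zN N) = N.
Proof. unfold zN. rewrite length_map, length_seq. reflexivity. Qed.

Lemma zN_S (N : nat) : zN (S N) = zN N ++ [Z.of_nat N].
Proof. unfold zN. rewrite seq_S, map_app. reflexivity. Qed.

(** The squared modulus of the exponential sum of e^(i th s) over S, written through its real and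
    imaginary parts. *)
Definition E2 (S : list Z) (th : R) : R :=
  rsum (fun s => cos (th * IZR s)) S ^ 2 + rsum (fun s => sin (th * IZR s)) S ^ 2.

Lemma E2_nonneg S th : 0 <= E2 S th.
Proof. unfold E2. nra. Qed.

Lemma E2_double S th :
  E2 S th = rsum (fun s => rsum (fun s' => cos (th * IZR (s - s'))) S) S.
Proof.
  unfold E2. rewrite <- !Rsqr_pow2. unfold Rsqr. rewrite !rsum_mult, <- rsum_plus.
  apply rsum_ext_in. intros s _. rewrite <- rsum_plus. apply rsum_ext_in. intros s' _.
  rewrite minus_IZR, Rmult_minus_distr_l, cos_minus. reflexivity.
Qed.

(** [KC] and [KS] are the real and imaginary parts of the Dirichlet kernel, the sum of e^(i th m)
    over 0 <= m < N. Multiplication by 2 sin(th/2) makes both telescope. *)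
Definition KC (N : nat) (th : R) := rsum (fun m => cos (th * IZR m)) (zN N).
Definition KS (N : nat) (th : R) := rsum (fun m => sin (th * IZR m)) (zN N).

Lemma KC_telescope N th :
  2 * sin (th / 2) * KC N th = sin (th * INR N - th / 2) + sin (th / 2).
Proof.
  unfold KC. induction N as [|N IH].
  - cbn. replace (th * 0 - th / 2) with (- (th / 2)) by lra. rewrite sin_neg. lra.
  - rewrite zN_S, rsum_app, Rmult_plus_distr_l, IH. cbn [rsum map fold_right].
    unfold rsum; cbn [map fold_right]. rewrite <- INR_IZR_INZ.
    replace (th * INR (S N) - th / 2) with (th * INR N + th / 2) by (rewrite S_INR; lra).
    rewrite sin_plus, sin_minus. lra.
Qed.

Lemma KS_telescope N th :
  2 * sin (th / 2) * KS N th = cos (th / 2) - cos (th * INR N - th / 2).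
Proof.
  unfold KS. induction N as [|N IH].
  - cbn. replace (th * 0 - th / 2) with (- (th / 2)) by lra. rewrite cos_neg. lra.
  - rewrite zN_S, rsum_app, Rmult_plus_distr_l, IH.
    unfold rsum; cbn [map fold_right]. rewrite <- INR_IZR_INZ.
    replace (th * INR (S N) - th / 2) with (th * INR N + th / 2) by (rewrite S_INR; lra).
    rewrite cos_plus, cos_minus. lra.
Qed.

Lemma KC_opp N th : KC N (- th) = KC N th.
Proof.
  unfold KC. apply rsum_ext_in. intros m _.
  rewrite Ropp_mult_distr_l_reverse, cos_neg. reflexivity.
Qed.

Lemma KS_opp N th : KS N (- th) = - KS N th.
Proof.
  unfold KS. replace (- rsum (fun m => sin (th * IZR m)) (zN N))
    with (-1 * rsum (fun m => sin (th * IZR m)) (zN N)) by ring.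
  rewrite <- rsum_scal. apply rsum_ext_in. intros m _.
  rewrite Ropp_mult_distr_l_reverse, sin_neg. ring.
Qed.

Lemma K_trivial N th : Rabs (KC N th) + Rabs (KS N th) <= 2 * INR N.
Proof.
  assert (H : forall g : R -> R, (forall x, Rabs (g x) <= 1) ->
     Rabs (rsum (fun m => g (th * IZR m)) (zN N)) <= INR N).
  { intros g Hg. eapply Rle_trans; [apply rsum_abs|].
    eapply Rle_trans; [apply (rsum_le_const 1); auto|]. rewrite length_zN; lra. }
  pose proof (H cos ltac:(intros; apply Rabs_le; pose proof (COS_bound x); lra)).
  pose proof (H sin ltac:(intros; apply Rabs_le; pose proof (SIN_bound x); lra)).
  unfold KC, KS. lra.
Qed.

Lemma K_bound N th d : 0 < d -> d <= Rabs (sin (th / 2)) ->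
  Rabs (KC N th) + Rabs (KS N th) <= 2 / d.
Proof.
  intros Hd Hs.
  assert (H : forall k, Rabs (2 * sin (th / 2) * k) <= 2 -> Rabs k <= 1 / d).
  { intros k Hk. rewrite !Rabs_mult, (Rabs_right 2) in Hk by lra.
    apply Rmult_le_reg_r with d; auto. unfold Rdiv. rewrite Rmult_assoc, Rinv_l by lra.
    pose proof (Rabs_pos k). nra. }
  assert (h1 := H (KC N th)). assert (h2 := H (KS N th)).
  rewrite KC_telescope in h1. rewrite KS_telescope in h2.
  pose proof (SIN_bound (th * INR N - th / 2)). pose proof (SIN_bound (th / 2)).
  pose proof (COS_bound (th * INR N - th / 2)). pose proof (COS_bound (th / 2)).
  assert (Rabs (KC N th) <= 1 / d) by (apply h1, Rabs_le; lra).
  assert (Rabs (KS N th) <= 1 / d) by (apply h2, Rabs_le; lra).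
  unfold Rdiv in *. lra.
Qed.

(* Duality: writing T for the left-hand side, T is a sum over S of a
   trigonometric polynomial W in the points, and Cauchy-Schwarz plus completing
   the sum to [0,N) bounds T^2 by |S| times a Hermitian form with kernel (KC, KS). *)
Lemma large_sieve_dual {A : Type} (I : list A) (th : A -> R) (S : list Z) (N : nat) (D : R) :
  NoDup S -> (forall s, In s S -> (0 <= s < Z.of_nat N)%Z) -> 0 <= D ->
  (forall i, In i I ->
     rsum (fun j => Rabs (KC N (th i - th j)) + Rabs (KS N (th i - th j))) I <= D) ->
  rsum (fun i => E2 S (th i)) I <= INR (length S) * D.
Proof.
  intros Hn HS HD HK.
  set (X := fun i => rsum (fun s => cos (th i * IZR s)) S).
  set (Y := fun i => rsum (fun s => sin (th i * IZR s)) S).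
  set (W := fun m => rsum (fun i => X i * cos (th i * IZR m) + Y i * sin (th i * IZR m)) I).
  set (V := fun m => rsum (fun i => X i * sin (th i * IZR m) + - Y i * cos (th i * IZR m)) I).
  set (e := fun i => X i ^ 2 + Y i ^ 2).
  set (K := fun i j => Rabs (KC N (th i - th j)) + Rabs (KS N (th i - th j))).
  set (T := rsum e I). change (T <= INR (length S) * D).
  assert (He : forall i, 0 <= e i) by (intros; unfold e; nra).
  assert (HT0 : 0 <= T) by (apply rsum_nonneg; auto).
  assert (HTW : T = rsum W S).
  { unfold T, W. rewrite rsum_swap. apply rsum_ext_in. intros i _.
    rewrite rsum_plus, !rsum_scal. unfold e, X, Y. ring. }
  assert (H1 : T ^ 2 <= INR (length S) * rsum (fun m => W m ^ 2 + V m ^ 2) (zN N)).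
  { rewrite HTW. eapply Rle_trans; [apply rsum_sqr_le|].
    apply Rmult_le_compat_l; [apply pos_INR|].
    eapply Rle_trans; [|apply (rsum_incl _ S (zN N))]; auto.
    - apply rsum_le. intros; nra.
    - intros s Hs; apply in_zN; auto.
    - intros; nra. }
  assert (H2 : rsum (fun m => W m ^ 2 + V m ^ 2) (zN N) =
     rsum (fun i => rsum (fun j => (X i * X j + Y i * Y j) * KC N (th i - th j)
                                 + (Y i * X j - X i * Y j) * KS N (th i - th j)) I) I).
  { transitivity (rsum (fun m => rsum (fun i => rsum (fun j =>
      (X i * X j + Y i * Y j) * cos ((th i - th j) * IZR m)
      + (Y i * X j - X i * Y j) * sin ((th i - th j) * IZR m)) I) I) (zN N)).
    - apply rsum_ext_in. intros m _. unfold W, V.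
      rewrite <- !Rsqr_pow2. unfold Rsqr. rewrite !rsum_mult, <- rsum_plus.
      apply rsum_ext_in. intros i _. rewrite <- rsum_plus. apply rsum_ext_in. intros j _.
      rewrite !Rmult_minus_distr_r, cos_minus, sin_minus. ring.
    - rewrite rsum_swap. apply rsum_ext_in. intros i _.
      rewrite rsum_swap. apply rsum_ext_in. intros j _.
      rewrite rsum_plus, !rsum_scal. reflexivity. }
  assert (Ksym : forall i j, K i j = K j i).
  { intros i j. unfold K. assert (E : th i - th j = - (th j - th i)) by lra. rewrite E.
    rewrite KC_opp, KS_opp, Rabs_Ropp. reflexivity. }
  (* Schur's test: 2 |u v| <= u^2 + v^2 separates the variables, and the symmetry of [K] then leaves
     only its row sums. *)
  assert (H3 : rsum (fun i => rsum (fun j => (X i * X j + Y i * Y j) * KC N (th i - th j)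
                                 + (Y i * X j - X i * Y j) * KS N (th i - th j)) I) I
     <= rsum (fun i => rsum (fun j => / 2 * (e i * K i j) + / 2 * (e j * K i j)) I) I).
  { apply rsum_le. intros i _. apply rsum_le. intros j _. unfold K.
    assert (ha : Rabs (X i * X j + Y i * Y j) <= / 2 * (e i + e j)).
    { pose proof (pow2_ge_0 (X i - X j)). pose proof (pow2_ge_0 (Y i - Y j)).
      pose proof (pow2_ge_0 (X i + X j)). pose proof (pow2_ge_0 (Y i + Y j)).
      unfold e. apply Rabs_le. split; lra. }
    assert (hb : Rabs (Y i * X j - X i * Y j) <= / 2 * (e i + e j)).
    { pose proof (pow2_ge_0 (Y i - X j)). pose proof (pow2_ge_0 (X i - Y j)).
      pose proof (pow2_ge_0 (Y i + X j)). pose proof (pow2_ge_0 (X i + Y j)).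
      unfold e. apply Rabs_le. split; lra. }
    set (c := KC N (th i - th j)) in *. set (s := KS N (th i - th j)) in *.
    eapply Rle_trans; [apply Rle_abs|]. eapply Rle_trans; [apply Rabs_triang|].
    rewrite !Rabs_mult. pose proof (Rabs_pos c). pose proof (Rabs_pos s). nra. }
  assert (H4 : rsum (fun i => rsum (fun j => / 2 * (e i * K i j) + / 2 * (e j * K i j)) I) I
     <= T * D).
  { rewrite (rsum_ext_in _ (fun i => / 2 * (e i * rsum (K i) I) + / 2 * rsum (fun j => e j * K i j) I)).
    2:{ intros i _. rewrite rsum_plus, !rsum_scal. reflexivity. }
    rewrite rsum_plus, !rsum_scal, rsum_swap.
    rewrite (rsum_ext_in (fun y => rsum (fun x => e y * K x y) I) (fun y => e y * rsum (K y) I)).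
    2:{ intros i _. rewrite rsum_scal. f_equal. apply rsum_ext_in. intros; apply Ksym. }
    assert (rsum (fun i => e i * rsum (K i) I) I <= T * D); [|lra].
    unfold T. rewrite <- rsum_scal_r. apply rsum_le. intros i Hi.
    apply Rmult_le_compat_l; [auto|exact (HK i Hi)]. }
  assert (H5 : T * T <= T * (INR (length S) * D)).
  { replace (T * T) with (T ^ 2) by ring. eapply Rle_trans; [apply H1|].
    replace (T * (INR (length S) * D)) with (INR (length S) * (T * D)) by ring.
    apply Rmult_le_compat_l; [apply pos_INR|]. rewrite H2. lra. }
  destruct HT0 as [HT0|HT0].
  - apply Rmult_le_reg_l with T; auto.
  - rewrite <- HT0. apply Rmult_le_pos; auto. apply pos_INR.
Qed.


(** The bound has this shape because 1/(x(1 - x)) = 1/x + 1/(1 - x): the kernel then splits into one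
    harmonic sum for each side of the circle. Up to 1/2 the cubic Taylor polynomial gives even
    sin(PI x) >= x; the rest is symmetry. *)
Lemma sin_PI_lb (x : R) : 0 <= x <= 1 -> x * (1 - x) <= sin (PI * x).
Proof.
  assert (HPI : 3 < PI) by (pose proof PI2_3_2; lra).
  assert (H : forall x, 0 <= x <= 1 / 2 -> x <= sin (PI * x)).
  { clear x. intros x Hx. pose proof PI_4.
    destruct (sin_bound (PI * x) 0) as [h _]; [nra|nra|].
    eapply Rle_trans; [|apply h].
    unfold sin_approx, sum_f_R0, sin_term. simpl. 
    set (s := PI * x). assert (3 * x <= s) by (unfold s; nra). assert (s <= 2) by (unfold s; nra).
    replace ((-1) * (-1) * 1) with 1 by ring. unfold Rdiv. nra. }
  intros Hx. destruct (Rle_lt_dec x (1 / 2)) as [h|h].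
  - specialize (H x ltac:(lra)). nra.
  - specialize (H (1 - x) ltac:(lra)).
    replace (PI * (1 - x)) with (PI - PI * x) in H by ring. rewrite sin_PI_x in H. nra.
Qed.

(** The numerators of the reduced fractions a/r in [0, 1). For r = 1 this is the single fraction
    0/1, whose energy is the main term |S|^2. *)
Definition cop (r : Z) : list Z := filter (fun a => Z.eqb (Z.gcd a r) 1) (zN (Z.to_nat r)).

Lemma in_cop (r a : Z) : (0 < r)%Z -> In a (cop r) <-> (0 <= a < r)%Z /\ Z.gcd a r = 1%Z.
Proof. intros Hr. unfold cop. rewrite filter_In, in_zN, Z.eqb_eq. lia. Qed.

Lemma NoDup_cop r : NoDup (cop r).
Proof. apply NoDup_filter, NoDup_zN. Qed.

Definition angle (r a : Z) : R := 2 * PI * (IZR a / IZR r).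

(** The contribution of the fractions with exact denominator r to the collisions of S. *)
Definition energy (S : list Z) (r : Z) : R := rsum (fun a => E2 S (angle r a)) (cop r).

Lemma energy_nonneg S r : 0 <= energy S r.
Proof. apply rsum_nonneg. intros; apply E2_nonneg. Qed.

Definition farey (R : nat) : list (Z * Z) :=
  flat_map (fun r => map (pair r) (cop r)) (map Z.of_nat (seq 1 R)).

Lemma in_farey (R : nat) (r a : Z) :
  In (r, a) (farey R) <-> (1 <= r <= Z.of_nat R)%Z /\ (0 <= a < r)%Z /\ Z.gcd a r = 1%Z.
Proof.
  unfold farey. rewrite in_flat_map. split.
  - intros (r' & Hr & H). apply in_map_iff in H. destruct H as (a' & e & H). inversion e; subst.
    apply in_map_iff in Hr. destruct Hr as (k & <- & Hk). apply in_seq in Hk.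
    apply in_cop in H; lia.
  - intros (H1 & H2). exists r. split.
    + apply in_map_iff. exists (Z.to_nat r). rewrite in_seq. lia.
    + apply in_map, in_cop; lia.
Qed.

Lemma NoDup_flat_map {A B : Type} (h : A -> list B) (l : list A) :
  NoDup l -> (forall x, In x l -> NoDup (h x)) ->
  (forall x y b, In x l -> In y l -> In b (h x) -> In b (h y) -> x = y) ->
  NoDup (flat_map h l).
Proof.
  induction 1 as [|x l Hx Hn IH]; intros H1 H2; simpl; [constructor|].
  apply NoDup_app; [apply H1; left; auto|apply IH|].
  - intros; apply H1; right; auto.
  - intros y z b Hy Hz; apply H2; right; auto.
  - intros b Hb Hb'. apply in_flat_map in Hb'. destruct Hb' as (y & Hy & Hb').
    apply Hx. rewrite (H2 x y b); auto; [left|right]; auto.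
Qed.

Lemma NoDup_farey R : NoDup (farey R).
Proof.
  apply NoDup_flat_map.
  - apply FinFun.Injective_map_NoDup; [intros x y; lia|apply seq_NoDup].
  - intros r _. apply FinFun.Injective_map_NoDup; [intros x y e; inversion e; auto|apply NoDup_cop].
  - intros x y b _ _ H1 H2. apply in_map_iff in H1, H2.
    destruct H1 as (? & <- & _). destruct H2 as (? & e & _). inversion e; auto.
Qed.

Lemma coprime_fraction_inj (r a r' a' : Z) :
  (0 < r)%Z -> (0 < r')%Z -> Z.gcd a r = 1%Z -> Z.gcd a' r' = 1%Z ->
  (a * r' = a' * r)%Z -> r = r' /\ a = a'.
Proof.
  intros Hr Hr' H H' E.
  assert (d1 : (r | r')%Z).
  { apply Z.gauss with a; [exists a'; lia|]. rewrite Z.gcd_comm; auto. }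
  assert (d2 : (r' | r)%Z).
  { apply Z.gauss with a'; [exists a; lia|]. rewrite Z.gcd_comm; auto. }
  assert (r = r') by (apply Z.divide_antisym_nonneg; auto; lia). subst. split; auto. nia.
Qed.

(** The index k of the interval [k/D, (k + 1)/D) that contains a/r. For D = R^2 no interval holds
    two fractions with denominators at most R, as distinct ones are at least 1/R^2 apart. *)
Definition bucket (D r a : Z) : Z := (D * a / r)%Z.

Lemma bucket_spec (D r a : Z) : (0 < D)%Z -> (0 <= a < r)%Z ->
  (0 <= bucket D r a < D)%Z /\
  (bucket D r a * r <= D * a < bucket D r a * r + r)%Z.
Proof.
  intros HD Ha. unfold bucket.
  pose proof (Z.div_mod (D * a) r ltac:(lia)). pose proof (Z.mod_pos_bound (D * a) r ltac:(lia)).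
  assert (0 <= D * a / r)%Z by (apply Z.div_pos; nia).
  assert (D * a / r < D)%Z by (apply Z.div_lt_upper_bound; nia). nia.
Qed.

Lemma bucket_inj (R r a r' a' : Z) :
  (1 <= r <= R)%Z -> (1 <= r' <= R)%Z -> (0 <= a < r)%Z -> (0 <= a' < r')%Z ->
  Z.gcd a r = 1%Z -> Z.gcd a' r' = 1%Z ->
  bucket (R * R) r a = bucket (R * R) r' a' -> r = r' /\ a = a'.
Proof.
  intros Hr Hr' Ha Ha' H H' E. apply coprime_fraction_inj; auto; try lia.
  destruct (bucket_spec (R * R) r a) as [_ h]; [nia|auto|].
  destruct (bucket_spec (R * R) r' a') as [_ h']; [nia|auto|].
  rewrite <- E in h'. set (k := bucket (R * R) r a) in *. clearbody k. clear E.
  assert (h1 : (R * R * (a * r' - a' * r) < R * R)%Z).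
  { assert (R * R * a * r' < (k * r + r) * r')%Z by nia.
    assert (k * r' * r <= R * R * a' * r)%Z by nia. nia. }
  assert (h2 : (R * R * (a' * r - a * r') < R * R)%Z).
  { assert (R * R * a' * r < (k * r' + r') * r)%Z by nia.
    assert (k * r * r' <= R * R * a * r')%Z by nia. nia. }
  assert (0 < R * R)%Z by nia. nia.
Qed.

(** Indices that differ by t only force D times the gap to exceed t - 1. The spacing of the
    fractions makes it at least 1 as well, and max(t - 1, 1) >= t/2. The second bound is the same
    argument for the way round the other side of the circle. *)
Lemma bucket_gap (R r a r' a' : Z) :
  (1 <= r <= R)%Z -> (1 <= r' <= R)%Z -> (0 <= a < r)%Z -> (0 <= a' < r')%Z ->
  let t := (bucket (R * R) r a - bucket (R * R) r' a')%Z in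
  (0 < t)%Z ->
  IZR t / 2 <= IZR (R * R) * (IZR a / IZR r - IZR a' / IZR r') /\
  IZR (R * R - t) / 2 <= IZR (R * R) * (1 - (IZR a / IZR r - IZR a' / IZR r')).
Proof.
  intros Hr Hr' Ha Ha' t Ht.
  destruct (bucket_spec (R * R) r a) as [g h]; [nia|auto|].
  destruct (bucket_spec (R * R) r' a') as [g' h']; [nia|auto|].
  set (k := bucket (R * R) r a) in *. set (k' := bucket (R * R) r' a') in *.
  set (D := (R * R)%Z) in *.
  assert (HD : (0 < D)%Z) by (unfold D; nia).
  set (x := IZR a / IZR r). set (x' := IZR a' / IZR r').
  assert (Rr : 1 <= IZR r) by (apply IZR_le; lia).
  assert (Rr' : 1 <= IZR r') by (apply IZR_le; lia).
  assert (hx : IZR k <= IZR D * x < IZR k + 1).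
  { destruct h as [p q]. apply IZR_le in p. apply IZR_lt in q.
    rewrite !mult_IZR in p. rewrite plus_IZR, !mult_IZR in q.
    assert (e : IZR D * IZR a = IZR D * x * IZR r) by (unfold x; field; lra).
    rewrite e in p, q. split; nra. }
  assert (hx' : IZR k' <= IZR D * x' < IZR k' + 1).
  { destruct h' as [p q]. apply IZR_le in p. apply IZR_lt in q.
    rewrite !mult_IZR in p. rewrite plus_IZR, !mult_IZR in q.
    assert (e : IZR D * IZR a' = IZR D * x' * IZR r') by (unfold x'; field; lra).
    rewrite e in p, q. split; nra. }
  assert (Et : IZR t = IZR k - IZR k') by (unfold t; rewrite minus_IZR; auto).
  assert (Ht1 : 1 <= IZR t) by (apply IZR_le; lia).
  assert (Hs : 1 <= IZR D * (x - x')).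
  { (* distinct fractions differ by at least 1/(r r') *)
    assert (e : x - x' = IZR (a * r' - a' * r) / (IZR r * IZR r')).
    { unfold x, x'. rewrite minus_IZR, !mult_IZR. field; lra. }
    assert (0 < IZR D * (x - x')) by lra.
    assert (0 < IZR D) by (apply IZR_lt; auto).
    assert (0 < x - x') by nra.
    assert (h0 : 0 < IZR (a * r' - a' * r)).
    { replace (IZR (a * r' - a' * r)) with ((x - x') * (IZR r * IZR r')) by (rewrite e; field; lra). 
      apply Rmult_lt_0_compat; nra. }
    apply lt_IZR in h0. assert (h1 : (1 <= a * r' - a' * r)%Z) by lia. apply IZR_le in h1.
    assert (h2 : IZR r * IZR r' <= IZR D) by (rewrite <- mult_IZR; apply IZR_le; unfold D; nia).
    assert (h3 : (x - x') * (IZR r * IZR r') = IZR (a * r' - a' * r)) by (rewrite e; field; lra).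
    nra. }
  assert (Hw : 1 <= IZR D * (1 - (x - x'))).
  { assert (e : (1 - x) * IZR r = IZR (r - a)) by (unfold x; rewrite minus_IZR; field; lra).
    assert (h1 : 1 <= IZR (r - a)) by (apply IZR_le; lia).
    assert (h2 : IZR r <= IZR D) by (apply IZR_le; unfold D; nia).
    assert (0 <= x').
    { unfold x'. apply Rmult_le_pos; [apply IZR_le; lia|left; apply Rinv_0_lt_compat; lra]. }
    assert (0 < 1 - x) by nra. nra. }
  rewrite minus_IZR. split; lra.
Qed.

(** The value 0 at t = 0 lets sums run over a full residue system; the zero difference is the
    diagonal term, which is bounded trivially and counted apart. *)
Definition hinv (t : Z) : R := if Z.eqb t 0 then 0 else / IZR t.

Lemma harmonic_le (D : nat) : (1 <= D)%nat -> rsum hinv (zN (S D)) <= 1 + ln (INR D).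
Proof.
  induction D as [|D IH]; [lia|]. intros _. destruct D as [|D].
  - change (INR 1) with 1. rewrite ln_1. cbn. unfold hinv. simpl. lra.
  - rewrite zN_S, rsum_app. specialize (IH ltac:(lia)).
    unfold rsum at 2. cbn [map fold_right]. unfold hinv at 2.
    replace (Z.eqb (Z.of_nat (S (S D))) 0) with false by (symmetry; apply Z.eqb_neq; lia).
    rewrite <- INR_IZR_INZ.
    assert (h : / INR (S (S D)) <= ln (INR (S (S D))) - ln (INR (S D))); [|lra].
    rewrite (S_INR (S D)). assert (H0 : 1 <= INR (S D)) by (rewrite S_INR; pose proof (pos_INR D); lra).
    set (x := INR (S D)) in *. rewrite <- (Ropp_involutive (_ - _)).
    apply Ropp_le_cancel. rewrite Ropp_involutive.
    replace (- (ln (x + 1) - ln x)) with (ln (x / (x + 1))).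
    2:{ unfold Rdiv. rewrite ln_mult, ln_Rinv; try lra. apply Rinv_0_lt_compat; lra. }
    rewrite <- (ln_exp (- / (x + 1))). apply ln_le_mono.
    + apply Rdiv_lt_0_compat; lra.
    + eapply Rle_trans; [|left; apply exp_ineq1].
      * right. field. lra.
      * assert (0 < / (x + 1)) by (apply Rinv_0_lt_compat; lra). lra.
Qed.

(** Bounds the harmonic sum over the M^2 buckets. It is the logarithm that this version of the large
    sieve loses against the sharp one. *)
Definition Lg (M : nat) : R := 1 + ln (INR (M * M)).

(** The row sums that [large_sieve_dual] asks for. Seen from a fixed fraction, the others have
    distinct bucket differences modulo D = R^2, so the row is dominated by a diagonal term 2N and by
    the sums of 1/t and 1/(D - t) over residues t. *)
Lemma farey_kernel_sum (R N : nat) (p : Z * Z) : In p (farey R) ->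
  rsum (fun p' => Rabs (KC N (angle (fst p) (snd p) - angle (fst p') (snd p')))
                + Rabs (KS N (angle (fst p) (snd p) - angle (fst p') (snd p')))) (farey R)
  <= 2 * INR N + 8 * INR (R * R) * Lg R.
Proof.
  destruct p as [r a]. intros Hp. apply in_farey in Hp. destruct Hp as (Hr & Ha & Hg). simpl fst; simpl snd.
  set (Rz := Z.of_nat R). set (D := (Rz * Rz)%Z).
  assert (HD : (0 < D)%Z) by (unfold D, Rz; nia).
  assert (ED : D = Z.of_nat (R * R)) by (unfold D, Rz; lia).
  set (tt := fun p' : Z * Z => ((bucket D r a - bucket D (fst p') (snd p')) mod D)%Z).
  set (g := fun t : Z => (if Z.eqb t 0 then 2 * INR N else 0) + 4 * IZR D * hinv t + 4 * IZR D * hinv ((D - t) mod D)).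
  assert (Dpos : 0 < IZR D) by (apply IZR_lt; auto).
  assert (hinv0 : forall t, (0 <= t)%Z -> 0 <= hinv t).
  { intros t Ht. unfold hinv. destruct (Z.eqb_spec t 0); [lra|]. left. apply Rinv_0_lt_compat, IZR_lt. lia. }
  apply Rle_trans with (rsum (fun p' => g (tt p')) (farey R)).
  - apply rsum_le. intros [r' a'] Hp'. apply in_farey in Hp'. destruct Hp' as (Hr' & Ha' & Hg').
    unfold tt. simpl fst; simpl snd.
    destruct (bucket_spec D r a HD Ha) as [b1 _]. destruct (bucket_spec D r' a' HD Ha') as [b2 _].
    set (k := bucket D r a) in *. set (k' := bucket D r' a') in *.
    assert (h1 : 0 <= hinv ((k - k') mod D)) by (apply hinv0, Z.mod_pos_bound; auto).
    assert (h2 : 0 <= hinv ((D - (k - k') mod D) mod D)) by (apply hinv0, Z.mod_pos_bound; auto).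
    unfold g. destruct (Z.eqb_spec ((k - k') mod D) 0) as [e|ne].
    { eapply Rle_trans; [apply K_trivial|]. nra. }
    (* Either sign of k - k' is reduced to a positive t. Passing from t to D - t merely exchanges
       the two harmonic terms. *)
    assert (gap : exists t x, (0 < t < D)%Z /\
       (angle r a - angle r' a' = 2 * PI * x \/ angle r a - angle r' a' = - (2 * PI * x)) /\
       IZR t / 2 <= IZR D * x /\ IZR (D - t) / 2 <= IZR D * (1 - x) /\
       hinv ((k - k') mod D) + hinv ((D - (k - k') mod D) mod D) = / IZR t + / IZR (D - t)).
    { assert (kk : (0 < k - k' \/ k - k' < 0)%Z).
      { assert (k - k' <> 0)%Z; [|lia]. intros e. rewrite e, Z.mod_0_l in ne; lia. }
      destruct kk as [kk|kk].
      - exists (k - k')%Z, (IZR a / IZR r - IZR a' / IZR r').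
        destruct (bucket_gap Rz r a r' a') as [q1 q2]; auto.
        split; [lia|]. split; [left; unfold angle; ring|]. split; [auto|]. split; [auto|].
        rewrite (Z.mod_small (k - k')) by lia. rewrite Z.mod_small by lia.
        unfold hinv. destruct (Z.eqb_spec (k - k') 0); [lia|]. destruct (Z.eqb_spec (D - (k - k')) 0); [lia|auto].
      - exists (k' - k)%Z, (IZR a' / IZR r' - IZR a / IZR r).
        destruct (bucket_gap Rz r' a' r a) as [q1 q2]; auto; [fold k k' D; lia|].
        split; [lia|]. split; [right; unfold angle; ring|]. split; [auto|]. split; [auto|].
        replace ((k - k') mod D)%Z with (D - (k' - k))%Z.
        2:{ apply Zmod_unique with (-1)%Z; lia. }
        replace (D - (D - (k' - k)))%Z with (k' - k)%Z by lia. rewrite Z.mod_small by lia.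
        unfold hinv. destruct (Z.eqb_spec (k' - k) 0); [lia|]. destruct (Z.eqb_spec (D - (k' - k)) 0); [lia|lra]. }
    destruct gap as (t & x & Ht & Hang & q1 & q2 & Hsum).
    assert (T1 : 0 < IZR t) by (apply IZR_lt; lia).
    assert (T2 : 0 < IZR (D - t)) by (apply IZR_lt; lia).
    assert (x0 : 0 < x) by nra. assert (x1 : 0 < 1 - x) by nra.
    apply Rle_trans with (2 / (x * (1 - x))).
    { apply K_bound; [nra|]. eapply Rle_trans; [apply sin_PI_lb; lra|].
      destruct Hang as [-> | ->].
      - replace (2 * PI * x / 2) with (PI * x) by field. apply Rle_abs.
      - replace (- (2 * PI * x) / 2) with (- (PI * x)) by field. rewrite sin_neg, Rabs_Ropp. apply Rle_abs. }
    replace (0 + 4 * IZR D * hinv ((k - k') mod D) + 4 * IZR D * hinv ((D - (k - k') mod D) mod D))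
      with (4 * IZR D * (hinv ((k - k') mod D) + hinv ((D - (k - k') mod D) mod D))) by ring.
    rewrite Hsum. replace (2 / (x * (1 - x))) with (2 * / x + 2 * / (1 - x)) by (field; lra).
    assert (P : forall s y, 0 < s -> 0 < y -> s / 2 <= IZR D * y -> / y <= 2 * IZR D * / s).
    { intros s y Hs Hy Hsy. apply Rmult_le_reg_l with y; auto. rewrite Rinv_r by lra.
      apply Rmult_le_reg_r with s; auto. replace (y * (2 * IZR D * / s) * s) with (2 * (IZR D * y)) by (field; lra). lra. }
    pose proof (P _ _ T1 x0 q1). pose proof (P _ _ T2 x1 q2). lra.
  - eapply Rle_trans; [apply (rsum_inj_le tt g _ (zN (R * R)))|].
    + apply NoDup_farey.
    + intros [r1 a1] [r2 a2] H1 H2 E. apply in_farey in H1, H2. unfold tt in E. simpl in E.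
      destruct H1 as (? & h1 & ?), H2 as (? & h2 & ?).
      destruct (bucket_spec D r1 a1 HD h1) as [b1 _]. destruct (bucket_spec D r2 a2 HD h2) as [b2 _].
      assert (Eb : bucket D r1 a1 = bucket D r2 a2).
      { assert (M : ((bucket D r2 a2 - bucket D r1 a1) mod D = 0)%Z).
        { replace (bucket D r2 a2 - bucket D r1 a1)%Z with
            ((bucket D r a - bucket D r1 a1) - (bucket D r a - bucket D r2 a2))%Z by lia.
          rewrite Zminus_mod, E, Z.sub_diag. apply Z.mod_0_l; lia. }
        apply Z.mod_divide in M; [|lia]. destruct M as [c M]. assert (c = 0)%Z by nia. nia. }
      destruct (bucket_inj Rz r1 a1 r2 a2) as [-> ->]; auto.
    + intros p' _. apply in_zN. unfold tt. rewrite <- ED. apply Z.mod_pos_bound; auto.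
    + intros t Ht. apply in_zN in Ht. unfold g.
      pose proof (hinv0 t ltac:(lia)). pose proof (hinv0 ((D - t) mod D)%Z ltac:(apply Z.mod_pos_bound; auto)).
      pose proof (pos_INR N). destruct (Z.eqb t 0); nra.
    + unfold g. rewrite !rsum_plus, !rsum_scal.
      assert (R1 : (1 <= R * R)%nat) by lia.
      assert (H1 : rsum hinv (zN (R * R)) <= Lg R).
      { unfold Lg. eapply Rle_trans; [|apply harmonic_le; auto].
        rewrite zN_S, rsum_app. unfold rsum at 3. cbn [map fold_right].
        pose proof (hinv0 (Z.of_nat (R * R)) ltac:(lia)). lra. }
      assert (H2 : rsum (fun t => hinv ((D - t) mod D)) (zN (R * R)) <= rsum hinv (zN (R * R))).
      { apply (rsum_inj_le (fun t => ((D - t) mod D)%Z)).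
        - apply NoDup_zN.
        - intros x y Hx Hy E. apply in_zN in Hx, Hy.
          assert (M : ((y - x) mod D = 0)%Z).
          { replace (y - x)%Z with ((D - x) - (D - y))%Z by lia.
            rewrite Zminus_mod, E, Z.sub_diag. apply Z.mod_0_l; lia. }
          apply Z.mod_divide in M; [|lia]. destruct M as [c M]. assert (c = 0)%Z by nia. nia.
        - intros x _. apply in_zN. rewrite <- ED. apply Z.mod_pos_bound; auto.
        - intros y Hy. apply in_zN in Hy. apply hinv0; lia. }
      assert (H3 : rsum (fun t => if Z.eqb t 0 then 2 * INR N else 0) (zN (R * R)) <= 2 * INR N).
      { rewrite <- (rsum_filter (fun t => Z.eqb t 0) (fun _ => 2 * INR N)), rsum_const.
        assert (L : (length (filter (fun t => Z.eqb t 0) (zN (R * R))) <= length [0%Z])%nat).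
        { apply NoDup_incl_length; [apply NoDup_filter, NoDup_zN|].
          intros t Ht. apply filter_In in Ht. destruct Ht as [_ Ht]. apply Z.eqb_eq in Ht. left; auto. }
        apply le_INR in L. simpl in L. pose proof (pos_INR N). nra. }
      rewrite INR_IZR_INZ with (n := (R * R)%nat), <- ED. nra.
Qed.

Lemma large_sieve (R N : nat) (S : list Z) :
  NoDup S -> (forall s, In s S -> (0 <= s < Z.of_nat N)%Z) -> (1 <= R)%nat ->
  rsum (energy S) (map Z.of_nat (seq 1 R)) <= INR (length S) * (2 * INR N + 8 * INR (R * R) * Lg R).
Proof.
  intros Hn HS HR.
  assert (E : rsum (energy S) (map Z.of_nat (seq 1 R)) = rsum (fun p => E2 S (angle (fst p) (snd p))) (farey R)).
  { unfold farey. rewrite rsum_flat_map. apply rsum_ext_in. intros r _. rewrite rsum_map. reflexivity. }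
  rewrite E. apply large_sieve_dual with (N := N); auto.
  - assert (1 <= INR (R * R)) by (apply (le_INR 1); lia).
    assert (0 <= ln (INR (R * R))) by (rewrite <- ln_1; apply ln_le_mono; lra).
    pose proof (pos_INR N). unfold Lg. nra.
  - intros p Hp. apply farey_kernel_sum; auto.
Qed.


(** * Collisions modulo q as sums over reduced fractions *)

Lemma cos_2PI_Z (k : Z) : cos (2 * PI * IZR k) = 1.
Proof.
  replace (2 * PI * IZR k) with (2 * (IZR k * PI)) by ring.
  rewrite cos_2a_sin, (sin_eq_0_1 (IZR k * PI)); [ring|exists k; auto].
Qed.

Lemma sin_2PI_Z (k : Z) : sin (2 * PI * IZR k) = 0.
Proof. apply sin_eq_0_1. exists (2 * k)%Z. rewrite mult_IZR. ring. Qed.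

Lemma cos_period_Z (x : R) (k : Z) : cos (x + 2 * PI * IZR k) = cos x.
Proof. rewrite cos_plus, cos_2PI_Z, sin_2PI_Z. ring. Qed.

Lemma sin_period_Z (x : R) (k : Z) : sin (x + 2 * PI * IZR k) = sin x.
Proof. rewrite sin_plus, cos_2PI_Z, sin_2PI_Z. ring. Qed.

Lemma E2_period (S : list Z) (x : R) (k : Z) : E2 S (x + 2 * PI * IZR k) = E2 S x.
Proof.
  unfold E2. f_equal; f_equal; apply rsum_ext_in; intros s _;
    replace ((x + 2 * PI * IZR k) * IZR s) with (x * IZR s + 2 * PI * IZR (k * s)) by (rewrite mult_IZR; ring).
  apply cos_period_Z. apply sin_period_Z.
Qed.

Definition coll (S : list Z) (q : Z) : R :=
  rsum (fun s => rsum (fun s' => if Z.eqb ((s - s') mod q) 0 then 1 else 0) S) S.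

Lemma KC_orthogonality (q h : Z) : (0 < q)%Z ->
  KC (Z.to_nat q) (2 * PI * (IZR h / IZR q)) = if Z.eqb (h mod q) 0 then IZR q else 0.
Proof.
  intros Hq. assert (Hq' : 0 < IZR q) by (apply IZR_lt; auto).
  assert (Eq : INR (Z.to_nat q) = IZR q) by (rewrite INR_IZR_INZ, Z2Nat.id; auto; lia).
  destruct (Z.eqb_spec (h mod q) 0) as [e|ne].
  - apply Z.mod_divide in e; [|lia]. destruct e as [c ->].
    unfold KC. rewrite (rsum_ext_in _ (fun _ => 1)).
    + rewrite rsum_const, length_zN, Eq. ring.
    + intros m _. replace (2 * PI * (IZR (c * q) / IZR q) * IZR m) with (2 * PI * IZR (c * m)).
      apply cos_2PI_Z. rewrite !mult_IZR. field. lra.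
  - pose proof (KC_telescope (Z.to_nat q) (2 * PI * (IZR h / IZR q))) as T. rewrite Eq in T.
    set (th := 2 * PI * (IZR h / IZR q)) in *.
    replace (th * IZR q - th / 2) with (- (th / 2) + 2 * PI * IZR h) in T by (unfold th; field; lra).
    rewrite sin_period_Z, sin_neg in T.
    assert (Hs : sin (th / 2) <> 0).
    { intros E. apply sin_eq_0_0 in E. destruct E as [k E]. apply ne.
      apply Z.mod_divide; [lia|]. exists k. apply eq_IZR. rewrite mult_IZR.
      unfold th in E. pose proof PI_RGT_0.
      assert (E' : IZR h * PI = IZR k * PI * IZR q) by (rewrite <- E; field; lra). nra. }
    apply Rmult_eq_reg_l with (2 * sin (th / 2)); [|lra]. lra.
Qed.

(** Parseval modulo q. Since [E2] is a double sum of cosines, the real part of the orthogonality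
    relation suffices. *)
Lemma coll_E2 (S : list Z) (q : Z) : (0 < q)%Z ->
  IZR q * coll S q = rsum (fun a => E2 S (angle q a)) (zN (Z.to_nat q)).
Proof.
  intros Hq. unfold coll. rewrite <- rsum_scal.
  rewrite (rsum_ext_in (fun a => E2 S (angle q a))
    (fun a => rsum (fun s => rsum (fun s' => cos (angle q a * IZR (s - s'))) S) S))
    by (intros; apply E2_double).
  rewrite rsum_swap. apply rsum_ext_in. intros s _.
  rewrite <- rsum_scal, rsum_swap. apply rsum_ext_in. intros s' _.
  transitivity (KC (Z.to_nat q) (2 * PI * (IZR (s - s') / IZR q))).
  - rewrite KC_orthogonality by auto. destruct (Z.eqb _ _); lra.
  - unfold KC. apply rsum_ext_in. intros a _. f_equal. unfold angle. field.
    apply not_0_IZR; lia.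
Qed.

Definition zprod (l : list Z) : Z := fold_right Z.mul 1%Z l.

(** For distinct primes these are the divisors of the product, each once. With repeated primes
    divisors are repeated too, which is harmless in upper bounds. *)
Fixpoint subprods (t : list Z) : list Z :=
  match t with
  | [] => [1%Z]
  | p :: t' => subprods t' ++ map (Z.mul p) (subprods t')
  end.

Lemma zprod_pos (t : list Z) : (forall p, In p t -> prime p) -> (0 < zprod t)%Z.
Proof.
  induction t as [|p t IH]; intros H; simpl; [lia|].
  assert (prime p) as [? _] by (apply H; left; auto).
  assert (0 < zprod t)%Z by (apply IH; intros; apply H; right; auto). nia.
Qed.

(** e collects the primes already known not to divide the numerator. For the next prime p, either p
    divides a and cancels from the fraction, or p moves into e; in the end the fractions are reduced
    with denominator e r. *)
Lemma farey_split (t : list Z) (g : R -> R) : (forall x, 0 <= g x) ->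
  (forall p, In p t -> prime p) -> forall e : Z, (0 < e)%Z ->
  rsum (fun a => g (angle (e * zprod t) a))
    (filter (fun a => Z.eqb (Z.gcd a e) 1) (zN (Z.to_nat (e * zprod t))))
  <= rsum (fun r => rsum (fun a => g (angle (e * r) a)) (cop (e * r))) (subprods t).
Proof.
  intros Hg. induction t as [|p t IH]; intros Hp e He.
  - simpl. unfold rsum at 2. simpl. rewrite Rplus_0_r, !Z.mul_1_r. apply Rle_refl.
  - assert (Pp : prime p) by (apply Hp; left; auto).
    assert (p2 : (2 <= p)%Z) by (apply prime_ge_2; auto).
    assert (Hp' : forall q, In q t -> prime q) by (intros; apply Hp; right; auto).
    pose proof (zprod_pos t Hp') as Hq.
    simpl zprod. simpl subprods. rewrite rsum_app, rsum_map.
    set (q := zprod t) in *. set (n := Z.to_nat (e * (p * q))).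
    set (F := fun a => g (angle (e * (p * q)) a)).
    transitivity (rsum F (filter (fun a => Z.eqb (Z.gcd a e) 1 && Z.eqb (a mod p) 0) (zN n))%bool
                + rsum F (filter (fun a => Z.eqb (Z.gcd a e) 1 && negb (Z.eqb (a mod p) 0)) (zN n))%bool).
    { rewrite !rsum_filter, <- rsum_plus. apply rsum_le. intros a _.
      destruct (Z.eqb (Z.gcd a e) 1), (Z.eqb (a mod p) 0); simpl; lra. }
    apply Rplus_le_compat.
    + eapply Rle_trans; [|apply IH; auto].
      eapply Rle_trans; [|apply (rsum_inj_le (fun a => a / p)%Z)].
      * apply rsum_le. intros a Ha. apply filter_In in Ha. destruct Ha as [_ Ha].
        apply Bool.andb_true_iff in Ha. destruct Ha as [_ Ha]. apply Z.eqb_eq in Ha.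
        unfold F. right. f_equal. unfold angle. f_equal.
        pose proof (Z.div_mod a p ltac:(lia)) as Ea. rewrite Ha, Z.add_0_r in Ea.
        rewrite Ea at 1. rewrite !mult_IZR. field.
        repeat split; apply not_0_IZR; lia.
      * apply NoDup_filter, NoDup_zN.
      * intros x y Hx Hy E. apply filter_In in Hx, Hy. destruct Hx as [_ Hx], Hy as [_ Hy].
        apply Bool.andb_true_iff in Hx, Hy. destruct Hx as [_ Hx], Hy as [_ Hy].
        apply Z.eqb_eq in Hx, Hy.
        pose proof (Z.div_mod x p ltac:(lia)). pose proof (Z.div_mod y p ltac:(lia)). nia.
      * intros x Hx. apply filter_In in Hx. destruct Hx as [Hx1 Hx].
        apply Bool.andb_true_iff in Hx. destruct Hx as [Hx2 Hx3]. apply Z.eqb_eq in Hx2, Hx3.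
        apply in_zN in Hx1. unfold n in Hx1. rewrite Z2Nat.id in Hx1 by nia.
        pose proof (Z.div_mod x p ltac:(lia)) as Ex. rewrite Hx3, Z.add_0_r in Ex.
        apply filter_In. split.
        -- apply in_zN. rewrite Z2Nat.id by nia. nia.
        -- apply Z.eqb_eq. apply Z.divide_antisym_nonneg; [apply Z.gcd_nonneg|lia| |apply Z.divide_1_l].
           rewrite <- Hx2. apply Z.gcd_greatest; [|apply Z.gcd_divide_r].
           apply Z.divide_trans with (x / p)%Z; [apply Z.gcd_divide_l|exists p; auto].
      * intros; apply Hg.
    + transitivity (rsum (fun r => rsum (fun a => g (angle (e * p * r) a)) (cop (e * p * r))) (subprods t)).
      2:{ right. apply rsum_ext_in. intros r _. rewrite <- Z.mul_assoc. reflexivity. }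
      eapply Rle_trans; [|apply IH; auto; nia]. fold q.
      unfold F, n. rewrite <- Z.mul_assoc. apply rsum_incl.
      * apply NoDup_filter, NoDup_zN.
      * intros a Ha. apply filter_In in Ha. destruct Ha as [Ha1 Ha]. apply filter_In. split; auto.
        apply Bool.andb_true_iff in Ha. destruct Ha as [Ha2 Ha3].
        apply Z.eqb_eq in Ha2. apply Bool.negb_true_iff, Z.eqb_neq in Ha3. apply Z.eqb_eq.
        apply Zgcd_1_rel_prime. apply Zgcd_1_rel_prime in Ha2. apply rel_prime_mult; auto.
        apply rel_prime_sym, prime_rel_prime; auto. intros [c ->]. apply Ha3, Z.mod_mul. lia.
      * intros; apply Hg.
Qed.

(* The fractions a/q with a < q, sorted by their reduced denominator. *)
Lemma coll_le_energy (S : list Z) (t : list Z) : (forall p, In p t -> prime p) ->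
  IZR (zprod t) * coll S (zprod t) <= rsum (energy S) (subprods t).
Proof.
  intros Hp. pose proof (zprod_pos t Hp). rewrite coll_E2 by auto.
  pose proof (farey_split t (E2 S) (E2_nonneg S) Hp 1%Z ltac:(lia)) as H0.
  rewrite Z.mul_1_l in H0. eapply Rle_trans; [|eapply Rle_trans; [apply H0|]].
  - rewrite rsum_filter. apply rsum_le. intros a _. rewrite Z.gcd_1_r. simpl. lra.
  - right. apply rsum_ext_in. intros r _. rewrite Z.mul_1_l. reflexivity.
Qed.

(** S is the set of products P H, expressed through its sums. Cauchy-Schwarz over h costs a factor
    |H|, and h, being a unit, permutes the reduced numerators modulo r, so each h contributes the
    energy of P. This allows all but a few bins of S to be dropped. *)
Lemma energy_product (S P H : list Z) (r : Z) : (0 < r)%Z ->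
  (forall f, rsum f S = rsum (fun p => rsum (fun h => f (p * h)%Z) H) P) ->
  (forall h, In h H -> Z.gcd h r = 1%Z) ->
  energy S r <= INR (length H) ^ 2 * energy P r.
Proof.
  intros Hr HS HH.
  assert (H1 : forall th, E2 S th <= INR (length H) * rsum (fun h => E2 P (th * IZR h)) H).
  { intros th. unfold E2. rewrite !HS, rsum_swap, (rsum_swap (fun p h => sin _)), rsum_plus, Rmult_plus_distr_l.
    assert (X : forall g : R -> R, (rsum (fun h => rsum (fun p => g (th * IZR (p * h))) P) H) ^ 2 <=
      INR (length H) * rsum (fun h => rsum (fun p => g (th * IZR h * IZR p)) P ^ 2) H).
    { intros g. eapply Rle_trans; [apply rsum_sqr_le|]. right. f_equal. apply rsum_ext_in. intros h _.
      f_equal. apply rsum_ext_in. intros p _. f_equal. rewrite mult_IZR. ring. }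
    apply Rplus_le_compat; apply X. }
  unfold energy at 1. eapply Rle_trans; [apply rsum_le; intros; apply H1|].
  rewrite rsum_scal, rsum_swap.
  replace (INR (length H) ^ 2 * energy P r) with (INR (length H) * (INR (length H) * energy P r)) by ring.
  apply Rmult_le_compat_l; [apply pos_INR|]. apply rsum_le_const. intros h Hh.
  specialize (HH h Hh). unfold energy.
  eapply Rle_trans; [|apply (rsum_inj_le (fun a => (a * h) mod r)%Z)].
  - right. apply rsum_ext_in. intros a _.
    rewrite <- (E2_period P (angle r ((a * h) mod r)) ((a * h) / r)). f_equal.
    pose proof (Z.div_mod (a * h) r ltac:(lia)) as E. apply (f_equal IZR) in E.
    rewrite plus_IZR, !mult_IZR in E. unfold angle.
    assert (IZR r <> 0) by (apply not_0_IZR; lia).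
    replace (IZR ((a * h) mod r)) with (IZR a * IZR h - IZR r * IZR (a * h / r)) by lra. field. auto.
  - apply NoDup_cop.
  - intros x y Hx Hy E. apply in_cop in Hx, Hy; auto.
    assert (M : ((x - y) * h mod r = 0)%Z).
    { rewrite Z.mul_sub_distr_r, Zminus_mod, E, Z.sub_diag. apply Z.mod_0_l; lia. }
    apply Z.mod_divide in M; [|lia]. rewrite Z.mul_comm in M. apply Z.gauss in M.
    + destruct M as [c M]. assert (c = 0)%Z by nia. lia.
    + rewrite Z.gcd_comm; auto.
  - intros a Ha. apply in_cop in Ha; auto. apply in_cop; auto. split; [apply Z.mod_pos_bound; auto|].
    rewrite Z.gcd_mod by lia. rewrite Z.gcd_comm. apply Zgcd_1_rel_prime.
    apply Zgcd_1_rel_prime in HH. destruct Ha as [_ Ha]. apply Zgcd_1_rel_prime in Ha.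
    apply rel_prime_sym, rel_prime_mult; apply rel_prime_sym; auto.
  - intros; apply E2_nonneg.
Qed.


(** * Products of one prime from each bin *)

Section Families.
Variable bin : R -> list Z.

Fixpoint choose (zs : list R) : list (list Z) :=
  match zs with
  | [] => [[]]
  | z :: zs' => flat_map (fun p => map (cons p) (choose zs')) (bin z)
  end.

Definition pset (zs : list R) : list Z := map zprod (choose zs).

Definition cprod (zs : list R) : R := fold_right (fun z c => INR (length (bin z)) * c) 1 zs.

(** Disjoint bins of primes: an element of [pset] determines its prime in each bin, so products are
    distinct and coprimality can be read off from the bins. *)
Definition good_bins (zs : list R) : Prop :=
  NoDup zs /\
  (forall z, In z zs -> NoDup (bin z) /\ forall p, In p (bin z) -> prime p) /\
  (forall z z' p, In z zs -> In z' zs -> In p (bin z) -> In p (bin z') -> z = z').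

Lemma good_bins_incl zs l : good_bins zs -> NoDup l -> incl l zs -> good_bins l.
Proof. intros (_ & H2 & H3) Hn Hi. split; [auto|split]; eauto. Qed.

Lemma good_bins_cons z zs : good_bins (z :: zs) -> good_bins zs.
Proof.
  intros H. apply (good_bins_incl _ _ H).
  - destruct H as (H & _). inversion H; auto.
  - intros x Hx; right; auto.
Qed.

Lemma in_choose zs t : In t (choose zs) <-> Forall2 (fun p z => In p (bin z)) t zs.
Proof.
  revert t. induction zs as [|z zs IH]; intros t; simpl.
  - split; [intros [<-|[]]; constructor|inversion 1; auto].
  - rewrite in_flat_map. split.
    + intros (p & Hp & H). apply in_map_iff in H. destruct H as (t' & <- & H).
      constructor; auto. apply IH; auto.
    + inversion 1 as [|p ? t' ? Hp Ht]; subst. exists p. split; auto. apply in_map, IH; auto.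
Qed.

Lemma Forall2_in_l {A B : Type} (P : A -> B -> Prop) l l' x :
  Forall2 P l l' -> In x l -> exists y, In y l' /\ P x y.
Proof.
  induction 1 as [|a b l l' H HF IH]; simpl; [tauto|].
  intros [<-|Hx]; [exists b; auto|]. destruct (IH Hx) as (y & Hy & Hp). exists y; auto.
Qed.

Lemma choose_in_bin zs t p : In t (choose zs) -> In p t -> exists z, In z zs /\ In p (bin z).
Proof. intros Ht Hp. apply in_choose in Ht. apply (Forall2_in_l _ _ _ _ Ht Hp). Qed.

Lemma choose_prime zs t p : good_bins zs -> In t (choose zs) -> In p t -> prime p.
Proof.
  intros (_ & H & _) Ht Hp. destruct (choose_in_bin _ _ _ Ht Hp) as (z & Hz & Hpz).
  destruct (H z Hz) as [_ h]; auto.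
Qed.

Lemma prime_divide_zprod (p : Z) (t : list Z) : prime p -> (forall q, In q t -> prime q) ->
  (p | zprod t)%Z -> In p t.
Proof.
  intros Hp. induction t as [|q t IH]; simpl; intros Ht Hd.
  - assert (p2 := prime_ge_2 p Hp). apply Z.divide_1_r_nonneg in Hd; lia.
  - apply prime_mult in Hd; auto. destruct Hd as [Hd|Hd]; [left|right; auto].
    symmetry. apply prime_div_prime; auto.
Qed.

Lemma pset_cons z zs : pset (z :: zs) = flat_map (fun p => map (Z.mul p) (pset zs)) (bin z).
Proof.
  unfold pset. simpl. induction (bin z) as [|p b IH]; simpl; auto.
  rewrite map_app, IH. f_equal. rewrite !map_map. reflexivity.
Qed.

Lemma in_pset_pos zs s : good_bins zs -> In s (pset zs) -> (0 < s)%Z.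
Proof.
  intros H Hs. apply in_map_iff in Hs. destruct Hs as (t & <- & Ht).
  apply zprod_pos. intros. eapply choose_prime; eauto.
Qed.

Lemma pset_not_divisible z zs p s : good_bins (z :: zs) -> In p (bin z) -> In s (pset zs) -> ~ (p | s)%Z.
Proof.
  intros H Hp Hs Hd. apply in_map_iff in Hs. destruct Hs as (t & <- & Ht).
  assert (Pp : prime p) by (destruct H as (_ & H & _); apply (H z); simpl; auto).
  apply prime_divide_zprod in Hd; auto.
  - destruct (choose_in_bin _ _ _ Ht Hd) as (z' & Hz' & Hp').
    destruct H as (Hn & _ & H3). assert (z = z') by (apply (H3 z z' p); simpl; auto). subst.
    inversion Hn; contradiction.
  - intros q Hq. apply (choose_prime zs t); auto. eapply good_bins_cons; eauto.
Qed.

Lemma NoDup_pset zs : good_bins zs -> NoDup (pset zs).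
Proof.
  induction zs as [|z zs IH]; intros H.
  - unfold pset; simpl. constructor; [simpl; tauto|constructor].
  - rewrite pset_cons. pose proof (good_bins_cons _ _ H) as H'.
    assert (Hz : NoDup (bin z) /\ forall p, In p (bin z) -> prime p) by (apply H; simpl; auto).
    destruct Hz as [Hz1 Hz2].
    apply NoDup_flat_map; auto.
    + intros p Hp. pose proof (prime_ge_2 p (Hz2 p Hp)).
      apply FinFun.Injective_map_NoDup; [intros x y E; nia|auto].
    + intros p p' b Hp Hp' Hb Hb'. apply in_map_iff in Hb, Hb'.
      destruct Hb as (s & <- & Hs). destruct Hb' as (s' & E & Hs').
      assert (Hd : (p | p' * s')%Z) by (exists s; lia).
      apply prime_mult in Hd; auto. destruct Hd as [Hd|Hd].
      * apply prime_div_prime; auto.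
      * exfalso. apply (pset_not_divisible z zs p s'); auto.
Qed.

Lemma length_choose zs : INR (length (choose zs)) = cprod zs.
Proof.
  induction zs as [|z zs IH]; [reflexivity|]. cbn [choose cprod fold_right]. fold (cprod zs).
  rewrite <- IH. clear IH. induction (bin z) as [|p b IHb]; [simpl; lra|].
  cbn [flat_map length]. rewrite length_app, length_map, plus_INR, IHb, S_INR. lra.
Qed.

Lemma length_pset zs : INR (length (pset zs)) = cprod zs.
Proof. unfold pset. rewrite length_map. apply length_choose. Qed.

Lemma rsum_pset_app (f : Z -> R) zs1 zs2 :
  rsum f (pset (zs1 ++ zs2)) = rsum (fun p => rsum (fun h => f (p * h)%Z) (pset zs2)) (pset zs1).
Proof.
  revert f. induction zs1 as [|z zs1 IH]; intros f.
  - simpl app. change (pset []) with [1%Z]. rewrite rsum_cons. change (rsum _ []) with 0.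
    rewrite Rplus_0_r. apply rsum_ext_in. intros h _. rewrite Z.mul_1_l. reflexivity.
  - simpl app. rewrite !pset_cons, !rsum_flat_map. apply rsum_ext_in. intros p _.
    rewrite !rsum_map, IH. apply rsum_ext_in. intros x _. apply rsum_ext_in. intros h _.
    f_equal. lia.
Qed.

Lemma cprod_app zs1 zs2 : cprod (zs1 ++ zs2) = cprod zs1 * cprod zs2.
Proof. induction zs1 as [|z zs1 IH]; simpl; [lra|]. rewrite IH. lra. Qed.

(** All sublists of zs: the possible sets of bins from which a divisor of the product takes its
    primes. *)
Fixpoint sel (zs : list R) : list (list R) :=
  match zs with
  | [] => [[]]
  | z :: zs' => sel zs' ++ map (cons z) (sel zs')
  end.

Lemma sel_incl zs l : In l (sel zs) -> incl l zs.
Proof.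
  revert l. induction zs as [|z zs IH]; simpl; intros l.
  - intros [<-|[]]. apply incl_refl.
  - rewrite in_app_iff, in_map_iff. intros [H|(l' & <- & H)].
    + apply incl_tl; auto.
    + intros x [<-|Hx]; [left; auto|right; apply (IH l'); auto].
Qed.

Lemma sel_NoDup zs l : NoDup zs -> In l (sel zs) -> NoDup l.
Proof.
  revert l. induction zs as [|z zs IH]; simpl; intros l Hn.
  - intros [<-|[]]. constructor.
  - inversion Hn; subst. rewrite in_app_iff, in_map_iff. intros [H|(l' & <- & H)]; auto.
    constructor; auto. intros Hz. apply sel_incl in H. auto.
Qed.

(** Isolates the empty sublist, which stands for the divisor r = 1 and hence for the main term. *)
Lemma sel_split zs : exists rest, sel zs = [] :: rest /\ ~ In [] rest.
Proof.
  induction zs as [|z zs (rest & E & H)]; simpl.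
  - exists []. auto.
  - exists (rest ++ map (cons z) (sel zs)). rewrite E. split; auto.
    rewrite in_app_iff, in_map_iff. intros [?|(l & ? & _)]; [contradiction|discriminate].
Qed.

Lemma length_sel zs : INR (length (sel zs)) = 2 ^ length zs.
Proof.
  induction zs as [|z zs IH]; simpl; auto. rewrite length_app, length_map, plus_INR, IH. lra.
Qed.

Definition nonempty_bins (zs : list R) : Prop := forall z, In z zs -> (1 <= length (bin z))%nat.

Lemma cprod_pos zs : nonempty_bins zs -> 0 < cprod zs.
Proof.
  induction zs as [|z zs IH]; simpl; intros H; [lra|].
  assert (0 < INR (length (bin z))) by (apply lt_0_INR, H; simpl; auto).
  assert (0 < cprod zs) by (apply IH; intros x Hx; apply H; simpl; auto). nra.
Qed.

(** Exchange of summation: a divisor r in [pset l] arises from every choice of primes in the bins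
    outside l, that is, from cprod zs / cprod l of the tuples t. *)
Lemma rsum_subprods (f : Z -> R) zs : nonempty_bins zs ->
  rsum (fun t => rsum f (subprods t)) (choose zs)
  = cprod zs * rsum (fun l => / cprod l * rsum f (pset l)) (sel zs).
Proof.
  revert f. induction zs as [|z zs IH]; intros f Hne.
  - unfold pset, rsum. simpl. lra.
  - assert (Hne' : nonempty_bins zs) by (intros x Hx; apply Hne; simpl; auto).
    assert (Hc := cprod_pos _ Hne').
    assert (Hz : 0 < INR (length (bin z))) by (apply lt_0_INR, Hne; simpl; auto).
    simpl choose. rewrite rsum_flat_map.
    rewrite (rsum_ext_in _ (fun p =>
       cprod zs * rsum (fun l => / cprod l * rsum f (pset l)) (sel zs)
     + cprod zs * rsum (fun l => / cprod l * rsum (fun s => f (p * s)%Z) (pset l)) (sel zs))).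
    2:{ intros p _. rewrite rsum_map. rewrite <- !IH by auto. rewrite <- rsum_plus.
        apply rsum_ext_in. intros t _. simpl. rewrite rsum_app, rsum_map. reflexivity. }
    rewrite rsum_plus, rsum_const, rsum_scal, rsum_swap.
    simpl sel. rewrite rsum_app, rsum_map. simpl cprod at 3. cbn [cprod fold_right]. fold (cprod zs).
    rewrite (rsum_ext_in (fun x => / cprod (z :: x) * rsum f (pset (z :: x)))
      (fun l => / INR (length (bin z)) *
         rsum (fun p => / cprod l * rsum (fun s => f (p * s)%Z) (pset l)) (bin z))).
    2:{ intros l _. simpl cprod. rewrite pset_cons, rsum_flat_map, Rinv_mult.
        rewrite rsum_scal, <- Rmult_assoc. f_equal. apply rsum_ext_in. intros p _.
        rewrite rsum_map. reflexivity. }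
    rewrite rsum_scal.
    set (X := rsum _ (sel zs)). set (Y := rsum _ (sel zs)). field. lra.
Qed.

Lemma energy_1 (S : list Z) : energy S 1 = INR (length S) ^ 2.
Proof.
  unfold energy, cop. simpl. unfold rsum at 1. simpl. unfold E2, angle.
  rewrite (rsum_ext_in _ (fun _ => 1)), (rsum_ext_in (fun s => sin _) (fun _ => 0)), !rsum_const.
  - ring.
  - intros. replace (2 * PI * (0 / 1) * IZR x) with 0 by field. apply sin_0.
  - intros. replace (2 * PI * (0 / 1) * IZR x) with 0 by field. apply cos_0.
Qed.

(** The empty sublist cancels |S|^2 exactly, and fewer than 2^(length zs) sublists remain, each
    bounded by th. *)
Lemma excess_average (S : list Z) zs (th : R) : nonempty_bins zs -> 0 <= th ->
  (forall l, In l (sel zs) -> l <> [] -> / cprod l * rsum (energy S) (pset l) <= th * INR (length S) ^ 2) ->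
  rsum (fun t => rsum (energy S) (subprods t) - INR (length S) ^ 2) (choose zs)
  <= cprod zs * (2 ^ length zs * th * INR (length S) ^ 2).
Proof.
  intros Hne Hth H.
  rewrite (rsum_ext_in _ (fun t => rsum (energy S) (subprods t) + - INR (length S) ^ 2)) by (intros; ring).
  rewrite rsum_plus, rsum_const, rsum_subprods, length_choose by auto.
  pose proof (cprod_pos _ Hne) as Hc.
  rewrite <- Rmult_plus_distr_l. apply Rmult_le_compat_l; [lra|].
  destruct (sel_split zs) as (rest & E & Hr).
  assert (HV1 : rsum (energy S) (pset []) = INR (length S) ^ 2).
  { change (pset []) with [1%Z]. unfold rsum. cbn [map fold_right]. rewrite energy_1. lra. }
  pose proof (length_sel zs) as Hl. rewrite E in *. rewrite rsum_cons, HV1. simpl cprod.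
  assert (Hrest : rsum (fun l => / cprod l * rsum (energy S) (pset l)) rest <=
     INR (length rest) * (th * INR (length S) ^ 2)).
  { apply rsum_le_const. intros l Hl'. apply H; [right; auto|]. intros ->. contradiction. }
  change (length ([] :: rest)) with (Datatypes.S (length rest)) in Hl. rewrite S_INR in Hl.
  pose proof (pow2_ge_0 (INR (length S))). rewrite <- Hl.
  assert (0 <= th * INR (length S) ^ 2) by nra. lra.
Qed.

Lemma subprods_energy_lower (S : list Z) t : INR (length S) ^ 2 <= rsum (energy S) (subprods t).
Proof.
  induction t as [|p t IH].
  - unfold rsum. cbn [subprods map fold_right]. rewrite energy_1. lra.
  - simpl. rewrite rsum_app.
    assert (0 <= rsum (energy S) (map (Z.mul p) (subprods t))); [|lra].
    apply rsum_nonneg. intros; apply energy_nonneg.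
Qed.

Lemma zprod_choose_bounds zs t : (forall z p, In z zs -> In p (bin z) -> 0 <= IZR p <= z) ->
  In t (choose zs) -> 0 <= IZR (zprod t) <= fold_right Rmult 1 zs.
Proof.
  intros H Ht. apply in_choose in Ht. induction Ht as [|p z t zs Hp Ht IH]; simpl; [lra|].
  rewrite mult_IZR. assert (0 <= IZR p <= z) by (apply H; simpl; auto).
  assert (0 <= IZR (zprod t) <= fold_right Rmult 1 zs) by (apply IH; intros; apply H; simpl; auto).
  split; [nra|]. apply Rmult_le_compat; lra.
Qed.

Lemma common_divisors_in_bin zs t z p : good_bins zs -> In t (choose zs) -> In z zs ->
  In p (bin z) -> (p | zprod t)%Z -> In p t.
Proof.
  intros H Ht Hz Hp Hd. apply prime_divide_zprod; auto.
  - apply H with z; auto.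
  - intros; eapply choose_prime; eauto.
Qed.

Lemma choose_bin_unique zs t z p p' : good_bins zs -> In t (choose zs) -> In z zs ->
  In p (bin z) -> In p' (bin z) -> In p t -> In p' t -> p = p'.
Proof.
  intros H Ht. apply in_choose in Ht. revert H. induction Ht as [|q y t zs Hq Ht IH]; [intros _ []|].
  intros H Hz Hp Hp' Hpt Hpt'. pose proof H as (Hn & H2 & H3).
  assert (Hno : forall r, In r t -> In r (bin y) -> False).
  { intros r Hr Hr'. destruct (Forall2_in_l _ _ _ _ Ht Hr) as (w & Hw & Hrw).
    assert (w = y) by (apply (H3 w y r); simpl; auto). subst. inversion Hn; contradiction. }
  destruct Hz as [<-|Hz].
  - destruct Hpt as [<-|Hpt]; [|exfalso; eauto]. destruct Hpt' as [<-|Hpt']; [auto|exfalso; eauto].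
  - assert (Hz' : forall r, In r (bin z) -> In r (q :: t) -> In r t).
    { intros r Hr [<-|Hr']; auto. exfalso. assert (z = y) by (apply (H3 z y q); simpl; auto). subst.
      inversion Hn; contradiction. }
    apply IH; auto. eapply good_bins_cons; eauto.
Qed.

(* Each bin contributes at most two primes to a product of two elements of [pset zs]. *)
Lemma factorizations_le zs (x : Z) : good_bins zs -> 
  rsum (fun s => rsum (fun s' => if Z.eqb (s * s') x then 1 else 0) (pset zs)) (pset zs) <= 2 ^ length zs.
Proof.
  intros H.
  assert (H0 : forall zs', incl zs' zs -> good_bins zs' ->
    (forall z, In z zs' -> rsum (fun p => if excluded_middle_informative (p | x)%Z then 1 else 0) (bin z) <= 2) ->
    rsum (fun s => if excluded_middle_informative (s | x)%Z then 1 else 0) (pset zs') <= 2 ^ length zs').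
  { induction zs' as [|z zs' IH]; intros Hi Hg Hb.
    - unfold pset, rsum. simpl. destruct (excluded_middle_informative _); lra.
    - rewrite pset_cons, rsum_flat_map.
      set (c := rsum (fun s => if excluded_middle_informative (s | x)%Z then 1 else 0) (pset zs')) in IH.
      assert (Hc : c <= 2 ^ length zs').
      { apply IH; [intros y Hy; apply Hi; right; auto|eapply good_bins_cons; eauto|intros; apply Hb; right; auto]. }
      assert (Hc0 : 0 <= c) by (apply rsum_nonneg; intros; destruct (excluded_middle_informative _); lra).
      apply Rle_trans with (rsum (fun p => (if excluded_middle_informative (p | x)%Z then 1 else 0) * c) (bin z)).
      + apply rsum_le. intros p _. rewrite rsum_map. unfold c. rewrite <- rsum_scal. apply rsum_le. intros s _.
        destruct (excluded_middle_informative (p * s | x)%Z) as [d|d].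
        * destruct (excluded_middle_informative (p | x)%Z) as [d1|d1].
          2:{ exfalso. apply d1. eapply Z.divide_trans; [|apply d]. apply Z.divide_factor_l. }
          destruct (excluded_middle_informative (s | x)%Z) as [d2|d2].
          2:{ exfalso. apply d2. eapply Z.divide_trans; [|apply d]. apply Z.divide_factor_r. }
          lra.
        * destruct (excluded_middle_informative (p | x)%Z), (excluded_middle_informative (s | x)%Z); lra.
      + rewrite rsum_scal_r. simpl length. simpl pow.
        assert (rsum (fun p => if excluded_middle_informative (p | x)%Z then 1 else 0) (bin z) <= 2) by (apply Hb; left; auto).
        apply Rmult_le_compat; auto.
        apply rsum_nonneg; intros; destruct (excluded_middle_informative _); lra. }
  (* If x has a representation s0 s0' at all, this one already limits the primes of x: in each bin
     they are the factor of s0 and that of s0'. It then suffices to count the s dividing x, because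
     s' = x / s. *)
  destruct (excluded_middle_informative (exists s s', In s (pset zs) /\ In s' (pset zs) /\ (s * s')%Z = x))
    as [(s0 & s0' & Hs0 & Hs0' & Ex)|Hno].
  - apply Rle_trans with (rsum (fun s => if excluded_middle_informative (s | x)%Z then 1 else 0) (pset zs)).
    + apply rsum_le. intros s Hs. pose proof (in_pset_pos _ _ H Hs).
      destruct (excluded_middle_informative (s | x)%Z) as [d|d].
      * rewrite <- (rsum_filter (fun s' => Z.eqb (s * s') x) (fun _ => 1)), rsum_const.
        assert (L : (length (filter (fun s' => Z.eqb (s * s') x) (pset zs)) <= length [(x / s)%Z])%nat).
        { apply NoDup_incl_length; [apply NoDup_filter, NoDup_pset; auto|].
          intros s' Hs'. apply filter_In in Hs'. destruct Hs' as [_ Hs']. apply Z.eqb_eq in Hs'.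
          left. subst x. rewrite <- Hs', Z.mul_comm. apply Z.div_mul. lia. }
        apply le_INR in L. simpl in L. lra.
      * rewrite (rsum_ext_in _ (fun _ => 0)), rsum_const; [lra|]. intros s' _.
        destruct (Z.eqb_spec (s * s') x) as [e|]; auto. exfalso. apply d. exists s'. lia.
    + apply H0; auto using incl_refl. intros z Hz.
      apply in_map_iff in Hs0, Hs0'. destruct Hs0 as (t & <- & Ht). destruct Hs0' as (t' & <- & Ht').
      assert (Hbin : NoDup (bin z) /\ forall p, In p (bin z) -> prime p) by (apply H; auto).
      set (pd := fun p => if excluded_middle_informative (p | x)%Z then true else false).
      rewrite (rsum_ext_in _ (fun p => if pd p then 1 else 0)).
      2:{ intros. unfold pd. destruct (excluded_middle_informative _); auto. }
      rewrite <- length_filter_rsum.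
      assert (L : exists a b, incl (filter pd (bin z)) [a; b]).
      { assert (C : forall u, In u (choose zs) -> exists a, forall p, In p (bin z) -> In p u -> p = a).
        { intros u Hu. destruct (excluded_middle_informative (exists a, In a (bin z) /\ In a u)) as [(a & Ha & Ha')|N].
          - exists a. intros p Hp Hpu. eapply choose_bin_unique; eauto.
          - exists 0%Z. intros p Hp Hpu. exfalso. eauto. }
        destruct (C t Ht) as (a & Ha). destruct (C t' Ht') as (b & Hb). exists a, b.
        intros p Hp. apply filter_In in Hp. destruct Hp as [Hp Hd]. unfold pd in Hd.
        destruct (excluded_middle_informative _) as [d|]; [|discriminate].
        rewrite <- Ex in d. apply prime_mult in d; [|apply Hbin; auto].
        destruct d as [d|d]; [left; symmetry; apply Ha|right; left; symmetry; apply Hb]; auto;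
          eapply common_divisors_in_bin; eauto. }
      destruct L as (a & b & L). apply NoDup_incl_length in L; [|apply NoDup_filter, Hbin].
      apply le_INR in L. simpl in L. lra.
  - apply Rle_trans with 0; [|left; apply pow_lt; lra]. right.
    rewrite (rsum_ext_in _ (fun _ => 0)), rsum_const; [lra|]. intros s Hs.
    rewrite (rsum_ext_in _ (fun _ => 0)), rsum_const; [lra|]. intros s' Hs'.
    destruct (Z.eqb_spec (s * s') x) as [e|]; auto. exfalso. apply Hno. eauto.
Qed.
End Families.


(** * Values of the polynomial *)

(** Cauchy-Schwarz over the n possible values; xs may have repetitions, and the double sum counts
    its equal pairs. *)
Lemma collision_lower (xs : list Z) (n : nat) : (forall x, In x xs -> In x (zN n)) ->
  INR (length xs) ^ 2 <= INR n * rsum (fun x => rsum (fun x' => if Z.eqb x x' then 1 else 0) xs) xs.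
Proof.
  intros H.
  assert (H1 : forall x, In x xs -> rsum (fun c => if Z.eqb x c then 1 else 0) (zN n) = 1).
  { intros x Hx. rewrite <- (length_filter_rsum (fun c => Z.eqb x c)).
    replace (filter (fun c => Z.eqb x c) (zN n)) with [x]; [reflexivity|].
    assert (P : Permutation [x] (filter (fun c => Z.eqb x c) (zN n))).
    { apply NoDup_Permutation; [constructor; [simpl; tauto|constructor]|apply NoDup_filter, NoDup_zN|].
      intros y. rewrite filter_In, Z.eqb_eq. simpl. split; [intros [<-|[]]; auto|intros [_ e]; auto]. }
    apply Permutation_length_1_inv in P. symmetry; exact P. }
  assert (H2 : INR (length xs) = rsum (fun c => rsum (fun x => if Z.eqb x c then 1 else 0) xs) (zN n)).
  { rewrite rsum_swap, (rsum_ext_in _ (fun _ => 1)), rsum_const; [lra|auto]. }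
  rewrite H2. eapply Rle_trans; [apply rsum_sqr_le|]. rewrite length_zN. right. f_equal.
  rewrite (rsum_ext_in _ (fun c => rsum (fun x => rsum (fun x' => if Z.eqb x x' then (if Z.eqb x c then 1 else 0) else 0) xs) xs)).
  - rewrite rsum_swap. apply rsum_ext_in. intros x Hx. rewrite rsum_swap. apply rsum_ext_in. intros x' _.
    destruct (Z.eqb x x'); auto. rewrite rsum_const; lra.
  - intros c _. rewrite <- Rsqr_pow2. unfold Rsqr. rewrite rsum_mult. apply rsum_ext_in. intros x _.
    apply rsum_ext_in. intros x' _.
    destruct (Z.eqb_spec x c), (Z.eqb_spec x' c), (Z.eqb_spec x x'); subst; try lra; congruence.
Qed.

Lemma mod_sub_0 (x y q : Z) : (0 < q)%Z -> ((x - y) mod q = 0)%Z <-> (x mod q = y mod q)%Z.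
Proof.
  intros Hq. split; intros H.
  - apply Z.mod_divide in H; [|lia]. destruct H as [c H].
    replace x with (y + c * q)%Z by lia. apply Z.mod_add. lia.
  - rewrite Zminus_mod, H, Z.sub_diag. apply Z.mod_0_l; lia.
Qed.

(* Cauchy-Schwarz applied to the residues of [s'] and of [r / s] together. *)
Lemma product_residue_pairs (S : list Z) (q r : Z) : (0 < q)%Z ->
  (forall s, In s S -> Z.gcd s q = 1%Z) -> Z.gcd r q = 1%Z ->
  IZR q * coll S q <= 3 / 2 * INR (length S) ^ 2 ->
  INR (length S) ^ 2 / (2 * IZR q) <=
  rsum (fun s => rsum (fun s' => if Z.eqb ((s * s' - r) mod q) 0 then 1 else 0) S) S.
Proof.
  intros Hq HS Hr Hc.
  (* An inverse of s modulo q. Below, f s' = g s says that s s' lies in the class of r. *)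
  set (iv := fun s => epsilon (inhabits 0%Z) (fun i => (s * i - 1) mod q = 0)%Z).
  assert (Hiv : forall s, In s S -> ((s * iv s - 1) mod q = 0)%Z).
  { intros s Hs. unfold iv. apply epsilon_spec.
    assert (Hg := HS s Hs). apply Zgcd_1_rel_prime, rel_prime_bezout in Hg. destruct Hg as [u v E].
    exists u. apply Z.mod_divide; [lia|]. exists (- v)%Z. lia. }
  set (f := fun s => (s mod q)%Z). set (g := fun s => ((r * iv s) mod q)%Z).
  set (cross := rsum (fun s => rsum (fun s' => if Z.eqb ((s * s' - r) mod q) 0 then 1 else 0) S) S).
  assert (Hcs := collision_lower (map f S ++ map g S) (Z.to_nat q)).
  assert (Eq : INR (Z.to_nat q) = IZR q) by (rewrite INR_IZR_INZ, Z2Nat.id; auto; lia).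
  rewrite Eq in Hcs. specialize (Hcs ltac:(intros x Hx; apply in_zN; rewrite Z2Nat.id by lia;
    apply in_app_iff in Hx; destruct Hx as [Hx|Hx]; apply in_map_iff in Hx; destruct Hx as (s & <- & _);
    apply Z.mod_pos_bound; auto)).
  rewrite length_app, !length_map, plus_INR in Hcs.
  set (L := INR (length S)) in *.
  assert (B : rsum (fun x => rsum (fun x' => if Z.eqb x x' then 1 else 0) (map f S ++ map g S)) (map f S ++ map g S)
     <= 2 * coll S q + 2 * cross).
  { rewrite rsum_app, !rsum_map.
    rewrite (rsum_ext_in (fun s => rsum _ (map f S ++ map g S))
      (fun s => rsum (fun s' => if Z.eqb (f s) (f s') then 1 else 0) S + rsum (fun s' => if Z.eqb (f s) (g s') then 1 else 0) S))
      by (intros; rewrite rsum_app, !rsum_map; reflexivity).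
    rewrite (rsum_ext_in (fun s => rsum _ (map f S ++ map g S))
      (fun s => rsum (fun s' => if Z.eqb (g s) (f s') then 1 else 0) S + rsum (fun s' => if Z.eqb (g s) (g s') then 1 else 0) S))
      by (intros; rewrite rsum_app, !rsum_map; reflexivity).
    rewrite !rsum_plus.
    assert (K1 : rsum (fun s => rsum (fun s' => if Z.eqb (f s) (f s') then 1 else 0) S) S <= coll S q).
    { apply rsum_le. intros s _. apply rsum_le. intros s' _.
      destruct (Z.eqb_spec (f s) (f s')) as [e|]; [|destruct (Z.eqb _ 0); lra].
      apply mod_sub_0 in e; auto. rewrite e. simpl. lra. }
    assert (K2 : rsum (fun s => rsum (fun s' => if Z.eqb (g s) (g s') then 1 else 0) S) S <= coll S q).
    { apply rsum_le. intros s Hs. apply rsum_le. intros s' Hs'.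
      destruct (Z.eqb_spec (g s) (g s')) as [e|]; [|destruct (Z.eqb _ 0); lra].
      apply mod_sub_0 in e; auto.
      replace ((s - s') mod q)%Z with 0%Z; [simpl; lra|]. symmetry.
      apply Z.mod_divide; [lia|]. apply Z.gauss with r; [|rewrite Z.gcd_comm; auto].
      apply Z.mod_divide in e; [|lia]. destruct e as [k e].
      pose proof (Hiv s Hs) as i1. pose proof (Hiv s' Hs') as i2.
      apply Z.mod_divide in i1, i2; try lia. destruct i1 as [k1 i1], i2 as [k2 i2].
      exists (r * k1 * s' - r * k2 * s - s * s' * k)%Z.
      assert (E1 : (s * s' * (r * iv s - r * iv s') = r * s' * (s * iv s) - r * s * (s' * iv s'))%Z) by ring.
      rewrite e in E1. replace (s * iv s)%Z with (k1 * q + 1)%Z in E1 by lia.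
      replace (s' * iv s')%Z with (k2 * q + 1)%Z in E1 by lia. 
      replace ((r * k1 * s' - r * k2 * s - s * s' * k) * q)%Z with
         (r * k1 * s' * q - r * k2 * s * q - s * s' * (k * q))%Z by ring. rewrite E1. ring. }
    assert (K0 : forall s s', In s S -> f s' = g s -> ((s * s' - r) mod q = 0)%Z).
    { intros s s' Hs e. unfold f, g in e. apply mod_sub_0 in e; auto.
      apply Z.mod_divide in e; [|lia]. destruct e as [k e].
      pose proof (Hiv s Hs) as i1. apply Z.mod_divide in i1; [|lia]. destruct i1 as [k1 i1].
      apply Z.mod_divide; [lia|]. exists (s * k + r * k1)%Z.
      replace s' with (r * iv s + k * q)%Z by lia.
      replace (s * (r * iv s + k * q) - r)%Z with (r * (s * iv s - 1) + s * k * q)%Z by ring. rewrite i1. ring. }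
    assert (K3 : rsum (fun s => rsum (fun s' => if Z.eqb (g s) (f s') then 1 else 0) S) S <= cross).
    { apply rsum_le. intros s Hs. apply rsum_le. intros s' _.
      destruct (Z.eqb_spec (g s) (f s')) as [e|]; [|destruct (Z.eqb _ 0); lra].
      rewrite (K0 s s'); auto. simpl; lra. }
    assert (K4 : rsum (fun s => rsum (fun s' => if Z.eqb (f s) (g s') then 1 else 0) S) S <= cross).
    { rewrite rsum_swap. apply rsum_le. intros s Hs. apply rsum_le. intros s' _.
      destruct (Z.eqb_spec (f s') (g s)) as [e|]; [|destruct (Z.eqb _ 0); lra].
      rewrite (K0 s s'); auto. simpl; lra. }
    lra. }
  assert (Hq' : 0 < IZR q) by (apply IZR_lt; auto).
  (* The 2 L residues force 4 L^2 <= q (2 coll + 2 cross). The assumption q coll <= (3/2) L^2 uses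
     up 3 L^2, which leaves 2 q cross >= L^2. *)
  assert (F : (L + L) ^ 2 <= IZR q * (2 * coll S q + 2 * cross)).
  { eapply Rle_trans; [apply Hcs|]. apply Rmult_le_compat_l; lra. }
  apply Rmult_le_reg_l with (2 * IZR q); [lra|].
  replace (2 * IZR q * (L ^ 2 / (2 * IZR q))) with (L ^ 2) by (field; lra). nra.
Qed.

(** The form R(c), the sum of c_i a^(d-1-i) b^i with d = length c, in Horner form: once c_0 is fixed
    so that the rest is divisible by b, a form of lower degree remains. *)
Fixpoint Rf (a b : Z) (c : list Z) : Z :=
  match c with
  | [] => 0%Z
  | x :: c' => (x * a ^ Z.of_nat (length c') + b * Rf a b c')%Z
  end.

Lemma in_zrange lo hi x : In x (zrange lo hi) <-> (lo <= x <= hi)%Z.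
Proof.
  unfold zrange. rewrite in_map_iff. split.
  - intros (k & <- & Hk). apply in_seq in Hk. lia.
  - intros H. exists (Z.to_nat (x - lo)). rewrite in_seq. lia.
Qed.

Lemma NoDup_zrange lo hi : NoDup (zrange lo hi).
Proof. apply FinFun.Injective_map_NoDup; [intros x y; lia|apply seq_NoDup]. Qed.

Lemma length_zrange lo hi : length (zrange lo hi) = Z.to_nat (hi - lo + 1).
Proof. unfold zrange. rewrite length_map, length_seq. reflexivity. Qed.

Lemma in_Icent (C : R) x : - C <= IZR x < C -> In x (Icent (2 * C)).
Proof.
  intros H. unfold Icent. replace (2 * C / 2) with C by field. apply in_zrange.
  destruct (zceil_spec (- C)). destruct (zceil_spec C). split.
  - assert (zceil (- C) < x + 1)%Z; [|lia]. apply lt_IZR. rewrite plus_IZR. lra.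
  - assert (x < zceil C)%Z; [|lia]. apply lt_IZR. lra.
Qed.

Lemma tuples_length (I : list Z) d c : In c (tuples I d) -> length c = d.
Proof.
  revert c. induction d as [|d IH]; simpl; intros c.
  - intros [<-|[]]; auto.
  - rewrite in_flat_map. intros (x & _ & H). apply in_map_iff in H. destruct H as (c' & <- & H).
    simpl. f_equal; auto.
Qed.

Lemma length_tuples (I : list Z) d : INR (length (tuples I d)) = INR (length I) ^ d.
Proof.
  induction d as [|d IH]; [simpl; auto|]. cbn [tuples pow]. rewrite <- IH. clear IH.
  generalize (tuples I d). intros T. induction I as [|x l IHl]; [simpl; lra|].
  cbn [flat_map length]. rewrite length_app, length_map, plus_INR, IHl, S_INR. lra.
Qed.

Lemma Rabs_le_bounds (x a : R) : Rabs x <= a -> - a <= x <= a.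
Proof. unfold Rabs. destruct (Rcase_abs x); lra. Qed.

(* Fixing the coefficients one after the other modulo b, with |x| <= C/4; the bound on t
   loses a factor (a/|b|)^k <= 2^-k at step k, so the losses stay summable. *)
Lemma representations (C : R) (a b : Z) : 0 < C -> (0 < a)%Z -> (2 * a <= Z.abs b)%Z -> Z.gcd a b = 1%Z ->
  forall d t, Rabs (IZR t) <= C / 4 * (2 + (1 / 2) ^ d) * IZR (Z.abs b) ^ d ->
  IZR (zfloor (C / (4 * IZR (Z.abs b)))) ^ d <=
  rsum (fun c => if Z.eqb (Rf a b c) t then 1 else 0) (tuples (Icent (2 * C)) (S d)).
Proof.
  intros HC Ha Hab Hg.
  set (B := IZR (Z.abs b)). assert (HB : 2 <= B) by (unfold B; apply IZR_le; lia).
  set (J := zfloor (C / (4 * B))).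
  assert (HJ0 : (0 <= J)%Z).
  { destruct (zfloor_spec (C / (4 * B))) as [_ h]. fold J in h.
    assert (0 < C / (4 * B)) by (apply Rdiv_lt_0_compat; lra).
    assert (-1 < J)%Z; [|lia]. apply lt_IZR. lra. }
  assert (HJ : IZR J * B <= C / 4).
  { destruct (zfloor_spec (C / (4 * B))) as [h _]. fold J in h.
    apply Rmult_le_compat_r with (r := B) in h; [|lra].
    eapply Rle_trans; [apply h|]. right. field. lra. }
  induction d as [|d IH]; intros t Ht.
  (* For a single coefficient the bound on t is 3C/4, which lies inside [-C, C). *)
  - simpl in Ht. rewrite pow_O. 
    assert (Hin : In [t] (tuples (Icent (2 * C)) 1)).
    { cbn [tuples]. apply in_flat_map. exists t. split; [|left; auto]. apply in_Icent.
      apply Rabs_le_bounds in Ht. lra. }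
    eapply Rle_trans; [|apply (rsum_pick _ _ [t])]; auto.
    + cbn [Rf length]. rewrite Z.mul_0_r, Z.pow_0_r, Z.mul_1_r, Z.add_0_r, Z.eqb_refl. lra.
    + intros c _. destruct (Z.eqb _ _); lra.
  - set (A := (a ^ Z.of_nat (S d))%Z).
    assert (HA0 : (0 < A)%Z) by (apply Z.pow_pos_nonneg; lia).
    assert (HA : IZR A <= (1 / 2) ^ S d * B ^ S d).
    { unfold A. rewrite <- pow_IZR, <- Rpow_mult_distr. apply pow_incr.
      split; [apply IZR_le; lia|]. unfold B. apply IZR_le in Hab. rewrite mult_IZR in Hab. lra. }
    assert (HAb : Z.gcd b A = 1%Z).
    { apply Zgcd_1_rel_prime. unfold A. apply rel_prime_Zpower_r; [lia|].
      apply rel_prime_sym, Zgcd_1_rel_prime; auto. }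
    destruct (rel_prime_bezout _ _ (proj1 (Zgcd_1_rel_prime _ _) HAb)) as [u v Euv].
    (* From u b + v A = 1, the residue v t is the one that makes t - x A divisible by b; c1 is its
       first representative from -C/4 on. *)
    set (lo := zceil (- (C / 4))). set (c1 := (lo + (v * t - lo) mod Z.abs b)%Z).
    assert (Hb0 : (0 < Z.abs b)%Z) by lia.
    assert (Hc1 : (lo <= c1 < lo + Z.abs b)%Z) by (unfold c1; pose proof (Z.mod_pos_bound (v * t - lo) _ Hb0); lia).
    assert (Hcong : forall j, (b | t - (c1 + j * Z.abs b) * A)%Z).
    { intros j. assert (d1 : (b | c1 - v * t)%Z).
      { unfold c1. apply Z.divide_abs_l. pose proof (Z.div_mod (v * t - lo) (Z.abs b) ltac:(lia)) as E.
        exists (- ((v * t - lo) / Z.abs b))%Z. lia. }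
      destruct d1 as [k d1]. assert (d2 : (b | Z.abs b)%Z) by (apply Z.divide_abs_r, Z.divide_refl).
      destruct d2 as [k2 d2]. rewrite d2. replace c1 with (v * t + k * b)%Z by lia.
      exists (t * u - k * A - j * k2 * A)%Z.
      replace (t - (v * t + k * b + j * (k2 * b)) * A)%Z with (t * (1 - v * A) - k * b * A - j * k2 * b * A)%Z by ring.
      replace (1 - v * A)%Z with (u * b)%Z by lia. ring. }
    (* J translates of c1 by |b|; since J |b| <= C/4 they all have absolute value at most C/4, and
       they give the factor J of the induction. *)
    set (cand := map (fun j => (c1 + j * Z.abs b)%Z) (zN (Z.to_nat J))).
    assert (Hlo := zceil_spec (- (C / 4))). fold lo in Hlo.
    assert (Hcand : forall x, In x cand -> Rabs (IZR x) <= C / 4 /\ (b | t - x * A)%Z).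
    { intros x Hx. apply in_map_iff in Hx. destruct Hx as (j & <- & Hj). apply in_zN in Hj.
      rewrite Z2Nat.id in Hj by auto. split; [|apply Hcong]. apply Rabs_le.
      assert (h1 : (lo <= c1 + j * Z.abs b)%Z) by (pose proof (Z.mul_nonneg_nonneg j (Z.abs b)); lia).
      assert (h2 : (c1 + j * Z.abs b <= lo + J * Z.abs b - 1)%Z).
      { pose proof (Z.mul_le_mono_nonneg_r (j + 1) J (Z.abs b) ltac:(lia) ltac:(lia)). lia. }
      apply IZR_le in h1, h2. rewrite minus_IZR, (plus_IZR lo), (mult_IZR J) in h2. fold B in h2. lra. }
    set (cnt := fun t1 => rsum (fun c => if Z.eqb (Rf a b c) t1 then 1 else 0) (tuples (Icent (2 * C)) (S d))) in *.
    apply Rle_trans with (rsum (fun x => cnt ((t - x * A) / b)%Z) cand).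
    + apply Rle_trans with (INR (length cand) * IZR J ^ d).
      * right. unfold cand. rewrite length_map, length_zN, INR_IZR_INZ, Z2Nat.id by auto. reflexivity.
      * apply rsum_ge_const. intros x Hx. apply IH. destruct (Hcand x Hx) as [Hx1 [k Hk]].
        rewrite Hk, Z.div_mul by lia.
        apply Rmult_le_reg_r with B; [lra|].
        replace (Rabs (IZR k) * B) with (Rabs (IZR (t - x * A))).
        2:{ rewrite Hk, mult_IZR, Rabs_mult. unfold B. rewrite abs_IZR. reflexivity. }
        rewrite minus_IZR, mult_IZR. unfold Rminus.
        eapply Rle_trans; [apply Rabs_triang|]. rewrite Rabs_Ropp, Rabs_mult.
        assert (h : Rabs (IZR x) * Rabs (IZR A) <= C / 4 * ((1 / 2) ^ S d * B ^ S d)).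
        { apply Rmult_le_compat; try apply Rabs_pos; auto. rewrite Rabs_right; auto.
          apply Rle_ge, IZR_le; lia. }
        replace (C / 4 * (2 + (1 / 2) ^ d) * B ^ d * B) with
          (C / 4 * (2 + (1 / 2) ^ S d) * B ^ S d + C / 4 * ((1 / 2) ^ S d * B ^ S d)) by (simpl; field).
        lra.
    + change (tuples (Icent (2 * C)) (S (S d))) with
        (flat_map (fun x => map (cons x) (tuples (Icent (2 * C)) (S d))) (Icent (2 * C))).
      rewrite rsum_flat_map.
      eapply Rle_trans; [|apply (rsum_incl _ cand)].
      * apply rsum_le. intros x Hx. rewrite rsum_map. apply rsum_le. intros c Hc.
        apply tuples_length in Hc. cbn [Rf]. rewrite Hc. fold A.
        destruct (Hcand x Hx) as [_ [k Hk]]. rewrite Hk, Z.div_mul by lia.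
        destruct (Z.eqb_spec (Rf a b c) k) as [e|]; [|destruct (Z.eqb _ t); lra].
        rewrite e. replace (x * A + b * k)%Z with t by lia. rewrite Z.eqb_refl. lra.
      * apply FinFun.Injective_map_NoDup; [intros x y; nia|apply NoDup_zN].
      * intros x Hx. apply in_Icent. destruct (Hcand x Hx) as [Hx1 _]. apply Rabs_le_bounds in Hx1. lra.
      * intros x _. apply rsum_nonneg. intros c _. destruct (Z.eqb _ _); lra.
Qed.


Lemma zsum_ext (f g : nat -> Z) l : (forall i, In i l -> f i = g i) -> zsum (map f l) = zsum (map g l).
Proof. intros H. f_equal. apply map_ext_in; auto. Qed.

Lemma zsum_scal k (f : nat -> Z) l : zsum (map (fun i => k * f i)%Z l) = (k * zsum (map f l))%Z.
Proof. induction l as [|x l IH]; simpl; [lia|]. unfold zsum in *; simpl. rewrite IH. lia. Qed.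

Lemma zsum_snoc (f : nat -> Z) d : zsum (map f (seq 0 (S d))) = (zsum (map f (seq 0 d)) + f d)%Z.
Proof.
  rewrite seq_S, map_app. simpl. induction (map f (seq 0 d)) as [|x l IH]; unfold zsum in *; simpl in *; lia.
Qed.

Lemma fpoly_eq n m d c x y : length c = d ->
  fpoly n m d c x y = (fhat n m d x y + (x - y * m) * Rf x y c)%Z.
Proof.
  intros Hc. unfold fpoly. f_equal. generalize (x - y * m)%Z. intros w. subst d.
  induction c as [|e c IH]; [simpl; unfold zsum; simpl; lia|].
  cbn [length seq map]. rewrite <- seq_shift, map_map.
  unfold zsum at 1. cbn [fold_right]. fold (zsum (map (fun i => (nth (S i) (e :: c) 0 * w * x ^ Z.of_nat (S (length c) - S i - 1) * y ^ Z.of_nat (S i))%Z) (seq 0 (length c)))).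
  rewrite (zsum_ext _ (fun i => y * (nth i c 0 * w * x ^ Z.of_nat (length c - i - 1) * y ^ Z.of_nat i))%Z).
  - rewrite zsum_scal, IH. cbn [Rf nth]. replace (S (length c) - 0 - 1)%nat with (length c) by lia.
    change (Z.of_nat 0) with 0%Z. rewrite Z.pow_0_r. ring.
  - intros i _. cbn [nth]. replace (S (length c) - S i - 1)%nat with (length c - i - 1)%nat by lia.
    rewrite (Nat2Z.inj_succ i), Z.pow_succ_r by lia. ring.
Qed.

Lemma digits_sum n m d : (0 < m)%Z ->
  zsum (map (fun i => digit n m d i * m ^ Z.of_nat i)%Z (seq 0 (S d))) = n.
Proof.
  intros Hm. rewrite zsum_snoc.
  assert (H : forall k, (zsum (map (fun i => Z.modulo (Z.div n (m ^ Z.of_nat i)) m * m ^ Z.of_nat i)%Z (seq 0 k))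
     + Z.div n (m ^ Z.of_nat k) * m ^ Z.of_nat k = n)%Z).
  { induction k as [|k IH].
    - simpl. unfold zsum. simpl. rewrite Z.div_1_r. lia.
    - rewrite zsum_snoc. rewrite <- IH at 3. rewrite Nat2Z.inj_succ, Z.pow_succ_r by lia.
      assert (0 < m ^ Z.of_nat k)%Z by (apply Z.pow_pos_nonneg; lia).
      rewrite (Z.mul_comm m), <- Zdiv.Zdiv_Zdiv by lia.
      set (X := Z.div n (m ^ Z.of_nat k)). pose proof (Z.div_mod X m ltac:(lia)) as E.
      set (Y := (X / m)%Z) in *. set (r := (X mod m)%Z) in *. rewrite E. ring. }
  etransitivity; [|apply (H d)]. f_equal.
  - apply zsum_ext. intros i Hi. apply in_seq in Hi. unfold digit.
    replace (Nat.ltb i d) with true; auto. symmetry. apply Nat.ltb_lt. lia.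
  - unfold digit. rewrite Nat.ltb_irrefl. reflexivity.
Qed.

Lemma sub_divide_pow (x y : Z) k : (x - y | x ^ Z.of_nat k - y ^ Z.of_nat k)%Z.
Proof.
  induction k as [|k [c IH]].
  - simpl. exists 0%Z. lia.
  - rewrite Nat2Z.inj_succ, !Z.pow_succ_r by lia.
    exists (x ^ Z.of_nat k + y * c)%Z.
    replace (x * x ^ Z.of_nat k - y * y ^ Z.of_nat k)%Z with
      ((x - y) * x ^ Z.of_nat k + y * (x ^ Z.of_nat k - y ^ Z.of_nat k))%Z by ring. rewrite IH. ring.
Qed.

(** a is congruent to b m modulo a - b m, and replacing a by b m turns the form into b^d times the
    base-m expansion of n. *)
Lemma fhat_congr n m d a b : (0 < m)%Z -> (a - b * m | fhat n m d a b - n * b ^ Z.of_nat d)%Z.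
Proof.
  intros Hm. rewrite <- (digits_sum n m d Hm) at 2. unfold fhat.
  rewrite (Z.mul_comm (zsum _)), <- zsum_scal.
  assert (H : forall l, (forall i, In i l -> (i <= d)%nat) ->
     (a - b * m | zsum (map (fun i => digit n m d i * a ^ Z.of_nat i * b ^ Z.of_nat (d - i)) l)
      - zsum (map (fun i => b ^ Z.of_nat d * (digit n m d i * m ^ Z.of_nat i)) l))%Z).
  { induction l as [|i l IH]; intros Hl; [exists 0%Z; unfold zsum; simpl; lia|].
    destruct IH as [k IH]; [intros; apply Hl; right; auto|].
    destruct (sub_divide_pow a (b * m) i) as [c Hc].
    rewrite Z.pow_mul_l in Hc.
    exists (digit n m d i * b ^ Z.of_nat (d - i) * c + k)%Z.
    assert (Eb : (b ^ Z.of_nat d = b ^ Z.of_nat (d - i) * b ^ Z.of_nat i)%Z).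
    { rewrite <- Z.pow_add_r by lia. f_equal. assert (i <= d)%nat by (apply Hl; left; auto). lia. }
    unfold zsum in *. cbn [map fold_right] in *.
    rewrite Z.mul_add_distr_r, <- IH.
    replace (digit n m d i * b ^ Z.of_nat (d - i) * c * (a - b * m))%Z with
      (digit n m d i * b ^ Z.of_nat (d - i) * (c * (a - b * m)))%Z by ring.
    rewrite <- Hc, Eb. ring. }
  apply H. intros i Hi. apply in_seq in Hi. lia.
Qed.

Lemma fhat_bound n m d a b : (0 < m)%Z -> (0 <= n)%Z -> (0 <= a <= Z.abs b)%Z ->
  (Z.abs (fhat n m d a b) <= (Z.of_nat d * m + n / m ^ Z.of_nat d) * Z.abs b ^ Z.of_nat d)%Z.
Proof.
  intros Hm Hn Ha.
  assert (Hterm : forall i, (i <= d)%nat -> (Z.abs (a ^ Z.of_nat i * b ^ Z.of_nat (d - i)) <= Z.abs b ^ Z.of_nat d)%Z).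
  { intros i Hi. rewrite Z.abs_mul, !Z.abs_pow, (Z.abs_eq a) by lia.
    replace (Z.of_nat d) with (Z.of_nat i + Z.of_nat (d - i))%Z by lia. rewrite Z.pow_add_r by lia.
    apply Z.mul_le_mono_nonneg_r; [apply Z.pow_nonneg; lia|apply Z.pow_le_mono_l; lia]. }
  unfold fhat. rewrite zsum_snoc.
  assert (H : forall k, (k <= d)%nat ->
    (Z.abs (zsum (map (fun i => digit n m d i * a ^ Z.of_nat i * b ^ Z.of_nat (d - i)) (seq 0 k)))
     <= Z.of_nat k * m * Z.abs b ^ Z.of_nat d)%Z).
  { induction k as [|k IH]; intros Hk; [unfold zsum; simpl; lia|].
    rewrite zsum_snoc. eapply Z.le_trans; [apply Z.abs_triangle|].
    specialize (IH ltac:(lia)).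
    assert (h : (Z.abs (digit n m d k * a ^ Z.of_nat k * b ^ Z.of_nat (d - k)) <= m * Z.abs b ^ Z.of_nat d)%Z).
    { rewrite <- Z.mul_assoc, Z.abs_mul. apply Z.mul_le_mono_nonneg; try apply Z.abs_nonneg; [|apply Hterm; lia].
      unfold digit. replace (Nat.ltb k d) with true by (symmetry; apply Nat.ltb_lt; lia).
      pose proof (Z.mod_pos_bound (n / m ^ Z.of_nat k) m Hm). lia. }
    rewrite Nat2Z.inj_succ. nia. }
  eapply Z.le_trans; [apply Z.abs_triangle|]. rewrite Z.mul_add_distr_r.
  apply Z.add_le_mono; [apply H; lia|].
  rewrite <- Z.mul_assoc, Z.abs_mul. apply Z.mul_le_mono_nonneg; try apply Z.abs_nonneg; [|apply Hterm; lia].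
  unfold digit. rewrite Nat.ltb_irrefl.
  rewrite Z.abs_eq; [lia|]. apply Z.div_pos; auto. apply Z.pow_pos_nonneg; lia.
Qed.

Lemma fhat_coprime n m d a b : (0 < m)%Z -> Z.gcd a b = 1%Z -> Z.gcd n (a - b * m) = 1%Z ->
  Z.gcd (fhat n m d a b) (a - b * m) = 1%Z.
Proof.
  intros Hm Hab Hn. destruct (fhat_congr n m d a b Hm) as [k Hk]. set (w := (a - b * m)%Z) in *.
  replace (fhat n m d a b) with (n * b ^ Z.of_nat d + k * w)%Z by lia.
  rewrite Z.gcd_comm, Z.gcd_add_mult_diag_r.
  apply Zgcd_1_rel_prime. apply rel_prime_mult.
  - apply Zgcd_1_rel_prime. rewrite Z.gcd_comm; auto.
  - apply rel_prime_Zpower_r; [lia|]. apply rel_prime_sym.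
    apply Zgcd_1_rel_prime. unfold w.
    replace (a - b * m)%Z with (a + (- m) * b)%Z by ring.
    rewrite Z.gcd_add_mult_diag_r, Z.gcd_comm; auto.
Qed.

Lemma smooth_zprod y t : (forall p, In p t -> prime p /\ IZR p <= y) -> smooth y (zprod t).
Proof.
  intros H. split.
  - pose proof (zprod_pos t ltac:(intros; apply H; auto)). lia.
  - intros p Hp Hd. apply prime_divide_zprod in Hd; auto; intros; apply H; auto.
Qed.

Lemma smooth_mul y a b : smooth y a -> smooth y b -> smooth y (a * b).
Proof.
  intros [Ha Ha'] [Hb Hb']. split; [nia|]. intros p Hp Hd. apply prime_mult in Hd; auto.
  destruct Hd; auto.
Qed.

Lemma smooth_opp y a : smooth y a -> smooth y (- a).
Proof. intros [Ha Ha']. split; [lia|]. intros p Hp Hd. apply Ha'; auto. apply (proj1 (Z.divide_opp_r _ _) Hd). Qed.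

Lemma decideP_true (P : Prop) : P -> decideP P = true.
Proof. intros H. unfold decideP. destruct (excluded_middle_informative P); tauto. Qed.

(** Here (a, b) and m are fixed, and the degree is d + 1. Each of the |S|^2 / (2q) pairs with s s'
    in the class of fhat modulo q prescribes a value t = (s s' - fhat) / (a - b m) for R(c); the
    size condition puts t in reach of [representations]. Conversely one value of f is counted by at
    most 2^(length zs) pairs. *)
Lemma smooth_count (bin : R -> list Z) (zs : list R) (n m a b q : Z) (d : nat) (y C : R) :
  good_bins bin zs -> (forall z p, In z zs -> In p (bin z) -> IZR p <= y) ->
  0 < C -> (0 < m)%Z -> (0 < a)%Z -> (2 * a <= Z.abs b)%Z -> Z.gcd a b = 1%Z ->
  Z.abs (a - b * m) = q -> (0 < q)%Z -> Z.gcd n q = 1%Z ->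
  (forall s, In s (pset bin zs) -> Z.gcd s q = 1%Z) ->
  IZR q * coll (pset bin zs) q <= 3 / 2 * cprod bin zs ^ 2 ->
  (forall s s', In s (pset bin zs) -> In s' (pset bin zs) ->
     IZR (s * s') + Rabs (IZR (fhat n m (S d) a b)) <= IZR q * (C / 2 * IZR (Z.abs b) ^ d)) ->
  cprod bin zs ^ 2 / (2 * IZR q) * IZR (zfloor (C / (4 * IZR (Z.abs b)))) ^ d / 2 ^ length zs <=
  rsum (fun c => if decideP (smooth y (fpoly n m (S d) c a b)) then 1 else 0) (tuples (Icent (2 * C)) (S d)).
Proof.
  intros Hbins Hy HC Hm Ha Hab Hg Hw Hq Hn HS Hcoll Hsize.
  set (S := pset bin zs) in *. set (T := tuples (Icent (2 * C)) (Datatypes.S d)).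
  set (w := (a - b * m)%Z) in *. set (r := fhat n m (Datatypes.S d) a b) in *.
  set (J := IZR (zfloor (C / (4 * IZR (Z.abs b)))) ^ d).
  assert (Hpow : 0 < 2 ^ length zs) by (apply pow_lt; lra).
  apply Rmult_le_reg_r with (2 ^ length zs); auto.
  unfold Rdiv at 1. rewrite Rmult_assoc, Rinv_l, Rmult_1_r by lra.
  rewrite <- rsum_scal_r.
  apply Rle_trans with (rsum (fun c => rsum (fun s => rsum (fun s' =>
     if Z.eqb (s * s') (fpoly n m (Datatypes.S d) c a b) then 1 else 0) S) S) T).
  2:{ apply rsum_le. intros c _.
      destruct (excluded_middle_informative (exists s s', In s S /\ In s' S /\ (s * s')%Z = fpoly n m (Datatypes.S d) c a b))
        as [(s & s' & Hs & Hs' & E)|No].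
      - rewrite decideP_true.
        + rewrite Rmult_1_l. apply factorizations_le; auto.
        + rewrite <- E. apply in_map_iff in Hs, Hs'. destruct Hs as (t & <- & Ht), Hs' as (t' & <- & Ht').
          assert (Hsm : forall u, In u (choose bin zs) -> smooth y (zprod u)).
          { intros u Hu. apply smooth_zprod. intros p Hp. split; [eapply choose_prime; eauto|].
            destruct (choose_in_bin _ _ _ _ Hu Hp) as (z & Hz & Hpz). eauto. }
          apply smooth_mul; auto.
      - rewrite (rsum_ext_in _ (fun _ => 0)), rsum_const.
        + destruct (decideP _); lra.
        + intros s Hs. rewrite (rsum_ext_in _ (fun _ => 0)), rsum_const; [lra|].
          intros s' Hs'. destruct (Z.eqb_spec (s * s') (fpoly n m (Datatypes.S d) c a b)) as [e|]; auto.
          exfalso. apply No. eauto. }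
  rewrite rsum_swap.
  assert (Hr : Z.gcd r q = 1%Z).
  { subst q. rewrite Z.gcd_abs_r. apply fhat_coprime; auto. fold w. rewrite <- Z.gcd_abs_r. auto. }
  assert (Hlen : INR (length S) = cprod bin zs) by apply length_pset.
  pose proof (product_residue_pairs S q r Hq HS Hr ltac:(rewrite Hlen; auto)) as Hpairs. rewrite Hlen in Hpairs.
  assert (HJ : 0 <= J).
  { unfold J. apply pow_le. apply IZR_le. destruct (zfloor_spec (C / (4 * IZR (Z.abs b)))) as [_ h].
    assert (0 < C / (4 * IZR (Z.abs b))).
    { apply Rdiv_lt_0_compat; auto. assert (0 < IZR (Z.abs b)) by (apply IZR_lt; lia). lra. }
    assert (-1 < zfloor (C / (4 * IZR (Z.abs b))))%Z; [|lia]. apply lt_IZR. lra. }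
  eapply Rle_trans; [apply Rmult_le_compat_r; [apply HJ|apply Hpairs]|].
  rewrite <- rsum_scal_r. apply rsum_le. intros s Hs. rewrite rsum_swap, <- rsum_scal_r.
  apply rsum_le. intros s' Hs'.
  destruct (Z.eqb_spec ((s * s' - r) mod q) 0) as [e|].
  2:{ rewrite Rmult_0_l. apply rsum_nonneg. intros c _. destruct (Z.eqb _ _); lra. }
  rewrite Rmult_1_l. apply Z.mod_divide in e; [|lia].
  assert (dw : (w | s * s' - r)%Z) by (rewrite <- Hw in e; apply (proj1 (Z.divide_abs_l _ _) e)).
  destruct dw as [t Ht].
  apply Rle_trans with (rsum (fun c => if Z.eqb (Rf a b c) t then 1 else 0) T).
  - apply representations; auto.
    assert (Hqr : 0 < IZR q) by (apply IZR_lt; auto).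
    assert (Hb : 0 <= IZR (Z.abs b) ^ d) by (apply pow_le, IZR_le; lia).
    assert (Hh : 0 <= (1 / 2) ^ d) by (apply pow_le; lra).
    apply Rle_trans with (C / 2 * IZR (Z.abs b) ^ d); [|assert (0 <= C * IZR (Z.abs b) ^ d * (1 / 2) ^ d) by (repeat apply Rmult_le_pos; lra); lra].
    apply Rmult_le_reg_l with (IZR q); auto.
    eapply Rle_trans; [|apply (Hsize s s' Hs Hs')].
    replace (IZR q * Rabs (IZR t)) with (Rabs (IZR (s * s' - r))).
    2:{ rewrite Ht, mult_IZR, Rabs_mult, <- Hw, abs_IZR. ring. }
    rewrite minus_IZR. unfold Rminus. eapply Rle_trans; [apply Rabs_triang|]. rewrite Rabs_Ropp.
    rewrite (Rabs_right (IZR (s * s'))); [lra|]. apply Rle_ge, IZR_le.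
    pose proof (in_pset_pos _ _ _ Hbins Hs). pose proof (in_pset_pos _ _ _ Hbins Hs'). nia.
  - apply rsum_le. intros c Hc. apply tuples_length in Hc.
    rewrite fpoly_eq by auto. fold r w.
    destruct (Z.eqb_spec (Rf a b c) t) as [<-|]; [|destruct (Z.eqb _ _); lra].
    replace (s * s')%Z with (r + w * Rf a b c)%Z by lia. rewrite Z.eqb_refl. lra.
Qed.


Lemma rsum_list_prod {A B : Type} (f : A * B -> R) (l : list A) (l' : list B) :
  rsum f (list_prod l l') = rsum (fun x => rsum (fun y => f (x, y)) l') l.
Proof.
  induction l as [|x l IH]; auto. cbn [list_prod]. rewrite rsum_app, rsum_map, rsum_cons, IH. reflexivity.
Qed.

(* The pair (a, b') and the m with |a - b' m| = q, |b'| = b and 2 a <= b; the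
   sign of b' makes up for the position of q modulo b. *)
Definition witness (qb : Z * Z) : Z * (Z * Z) :=
  let (q, b) := qb in
  if Z.leb (2 * (q mod b)) b then (q / b, (q mod b, - b))%Z
  else (q / b + 1, (b - q mod b, b))%Z.

(** q mod b is nonzero, as b >= 2 is coprime to q; hence a > 0. As m is q/b rounded down or up, b (m
    - 1) <= q <= b (m + 1). *)
Lemma witness_spec q b m a b' : witness (q, b) = (m, (a, b')) ->
  (2 <= b)%Z -> (0 < q)%Z -> Z.gcd b q = 1%Z ->
  (a - b' * m = q \/ a - b' * m = - q)%Z /\ Z.abs b' = b /\ (0 < a)%Z /\ (2 * a <= b)%Z /\
  Z.gcd a b' = 1%Z /\ (b * (m - 1) <= q <= b * (m + 1))%Z.
Proof.
  intros E Hb Hq Hg. unfold witness in E.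
  pose proof (Z.div_mod q b ltac:(lia)) as D. pose proof (Z.mod_pos_bound q b ltac:(lia)) as M.
  assert (G : Z.gcd (q mod b) b = 1%Z) by (rewrite Z.gcd_mod by lia; auto).
  assert (R0 : (q mod b <> 0)%Z) by (intros e; rewrite e, Z.gcd_0_l in G; lia).
  destruct (Z.leb_spec (2 * (q mod b)) b) as [h|h]; inversion E; subst; clear E.
  - repeat split; try lia. rewrite Z.gcd_opp_r; auto.
  - repeat split; try lia.
    replace (b' - q mod b')%Z with (- (q mod b') + 1 * b')%Z by lia.
    rewrite Z.gcd_comm, Z.gcd_add_mult_diag_r, Z.gcd_opp_r, Z.gcd_comm; auto.
Qed.

(** The expectation is a sum over triples (m, a, b') of the number of suitable c, divided by the
    number of pairs (m, c). [witness] is injective, because q = |a - b' m| and b = |b'| can be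
    recovered, so the pairs (q, b) contribute separately: at least b0 values of b for each q and at
    least K0 vectors c for each pair. N bounds the elements of S, and F bounds the sum of the moduli
    of the coefficients of fhat. *)
Lemma ExpX_lower (bin : R -> list Z) (zs : list R) (n d : nat)
  (delta kappa sigma beta : R) (Qs : list Z) (bl : Z -> list Z) (F N b0 K0 : R) :
  let L := Lfun (INR n) (2/3) (/ delta) in
  let C := Lfun (INR n) (2/3) (kappa - / delta) in
  let y := Lfun (INR n) (1/3) beta in
  let H := Lfun (INR n) (1/3) sigma in
  let M := Mset n (S d) delta in
  good_bins bin zs -> (forall z p, In z zs -> In p (bin z) -> IZR p <= y) ->
  (forall s, In s (pset bin zs) -> IZR s <= N) ->
  (forall m, In m M -> (0 < m)%Z /\ INR (S d) * IZR m + IZR (Z.of_nat n / m ^ Z.of_nat (S d)) <= F) ->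
  NoDup Qs ->
  (forall q, In q Qs -> (0 < q)%Z /\ Z.gcd (Z.of_nat n) q = 1%Z /\ smooth y q /\
     (forall s, In s (pset bin zs) -> Z.gcd s q = 1%Z) /\
     IZR q * coll (pset bin zs) q <= 3 / 2 * cprod bin zs ^ 2) ->
  (forall q, In q Qs -> NoDup (bl q) /\ b0 <= INR (length (bl q))) ->
  (forall q b, In q Qs -> In b (bl q) -> (2 <= b)%Z /\ Z.gcd b q = 1%Z /\ IZR b <= H / 2 /\
     IZR b * (Rpower 2 (- (1 / INR (S d))) * L + 1) <= IZR q <= IZR b * (L - 1) /\
     N * N + F * IZR b ^ S d <= IZR q * (C / 2 * IZR b ^ d) /\
     K0 <= cprod bin zs ^ 2 / (2 * IZR q) * IZR (zfloor (C / (4 * IZR b))) ^ d / 2 ^ length zs) ->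
  0 <= K0 -> 
  INR (length Qs) * b0 * K0 / (INR (length M) * INR (length (Icent (2 * C))) ^ S d)
  <= ExpX n (S d) delta kappa sigma beta beta.
Proof.
  intros L C y H M Hbins Hy HN HM HQn HQ Hbl Hb HK0.
  set (T := tuples (Icent (2 * C)) (S d)).
  set (AB := list_prod (zrange 0 (zfloor (H / 2))) (zrange (- zfloor (H / 2)) (zfloor (H / 2)))).
  set (cond := fun (m : Z) (c : list Z) (ab : Z * Z) => let (a, b) := ab in
       decideP ((0 <= a)%Z /\ (a < Z.abs b)%Z
                /\ IZR (Z.abs b) <= H / 2
                /\ smooth y (a - b * m)%Z
                /\ smooth y (fpoly (Z.of_nat n) m (S d) c a b))).
  set (Phi := fun mab : Z * (Z * Z) => rsum (fun c => if cond (fst mab) c (snd mab) then 1 else 0) T).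
  assert (E : ExpX n (S d) delta kappa sigma beta beta =
     rsum Phi (list_prod M AB) / (INR (length M) * INR (length (Icent (2 * C))) ^ S d)).
  { unfold ExpX. fold L C M T. unfold avg. fold (rsum (fun m => fold_right Rplus 0 (map (fun c => INR (cardX n m (S d) c sigma beta beta)) T) / INR (length T)) M).
    rewrite (rsum_ext_in _ (fun m => rsum (fun ab => Phi (m, ab)) AB * / INR (length T))).
    - rewrite rsum_scal_r, rsum_list_prod. unfold T. rewrite length_tuples. unfold Rdiv. rewrite Rinv_mult. ring.
    - intros m _. unfold Rdiv. f_equal. unfold Phi. simpl fst. simpl snd. rewrite rsum_swap.
      unfold rsum at 1. f_equal. apply map_ext_in. intros c _.
      rewrite <- (length_filter_rsum (fun ab => cond m c ab)). reflexivity. }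
  rewrite E. unfold Rdiv. apply Rmult_le_compat_r.
  { assert (D0 : 0 <= INR (length M) * INR (length (Icent (2 * C))) ^ S d)
      by (apply Rmult_le_pos; [apply pos_INR|apply pow_le, pos_INR]).
    destruct D0 as [D0|D0]; [left; apply Rinv_0_lt_compat; auto|rewrite <- D0, Rinv_0; lra]. }
  (* The margins + 1 and - 1 in the condition on q pay for the rounding of q/b to m. *)
  assert (HmM : forall q b m a b', In q Qs -> In b (bl q) -> witness (q, b) = (m, (a, b')) -> In m M).
  { intros q b m a b' Hq Hbb Ew.
    destruct (HQ q Hq) as (Hq0 & _). destruct (Hb q b Hq Hbb) as (Hb2 & Hbq & _ & HbL & _).
    destruct (witness_spec _ _ _ _ _ Ew Hb2 Hq0 Hbq) as (_ & _ & _ & _ & _ & Hm).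
    unfold M, Mset. fold L. apply in_zrange.
        destruct (zceil_spec (Rpower 2 (- (1 / INR (S d))) * L)) as [_ c1].
        destruct (zfloor_spec L) as [_ c2]. destruct Hm as [Hm1 Hm2].
        apply IZR_le in Hm1, Hm2. rewrite mult_IZR, minus_IZR in Hm1. rewrite mult_IZR, plus_IZR in Hm2.
        assert (0 < IZR b) by (apply IZR_lt; lia).
        split.
        - assert (zceil (Rpower 2 (- (1 / INR (S d))) * L) < m + 1)%Z; [|lia].
          apply lt_IZR. rewrite plus_IZR. 
          assert (Rpower 2 (- (1 / INR (S d))) * L + 1 <= IZR m + 1) by (apply Rmult_le_reg_l with (IZR b); lra). lra.
        - assert (m < zfloor L + 1)%Z; [|lia]. apply lt_IZR. rewrite plus_IZR.
          assert (IZR m - 1 <= L - 1) by (apply Rmult_le_reg_l with (IZR b); lra). lra. }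
  set (pairs := flat_map (fun q => map (pair q) (bl q)) Qs).
  assert (Hpairs : forall qb, In qb pairs -> In (fst qb) Qs /\ In (snd qb) (bl (fst qb))).
  { intros qb Hqb. apply in_flat_map in Hqb. destruct Hqb as (q & Hq & Hqb).
    apply in_map_iff in Hqb. destruct Hqb as (b & <- & Hbb). auto. }
  apply Rle_trans with (rsum (fun qb => Phi (witness qb)) pairs).
  - apply Rle_trans with (rsum (fun _ => K0) pairs).
    + unfold pairs. rewrite rsum_flat_map, <- (Rmult_1_r (INR (length Qs))), !Rmult_assoc.
      apply (rsum_ge_const (1 * (b0 * K0))). intros q Hq. rewrite rsum_map, rsum_const.
      destruct (Hbl q Hq) as [_ h]. nra.
    + apply rsum_le. intros [q b] Hqb. apply Hpairs in Hqb. simpl in Hqb. destruct Hqb as [Hq Hbb].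
      destruct (HQ q Hq) as (Hq0 & Hnq & Hqy & HSq & Hcoll).
      destruct (Hb q b Hq Hbb) as (Hb2 & Hbq & HbH & HbL & Hsz & HK).
      destruct (witness (q, b)) as (m & (a & b')) eqn:Ew.
      destruct (witness_spec _ _ _ _ _ Ew Hb2 Hq0 Hbq) as (Hw & Hb' & Ha & Hab & Hg & Hm).
      pose proof (HmM q b m a b' Hq Hbb Ew) as Hmem.
      destruct (HM m Hmem) as [Hm0 HF].
      assert (Hwq : Z.abs (a - b' * m) = q) by lia.
      assert (HC : 0 < C) by apply exp_pos.
      eapply Rle_trans; [apply HK|].
      rewrite <- Hb' at 1.
      eapply Rle_trans; [apply (smooth_count bin zs (Z.of_nat n) m a b' q d y C); auto; try lia|].
      * intros s s' Hs Hs'. rewrite Hb'. eapply Rle_trans; [|apply Hsz].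
        apply Rplus_le_compat.
        { rewrite mult_IZR. pose proof (in_pset_pos _ _ _ Hbins Hs) as p1. pose proof (in_pset_pos _ _ _ Hbins Hs') as p2.
          apply IZR_lt in p1, p2. apply Rmult_le_compat; auto; lra. }
        pose proof (fhat_bound (Z.of_nat n) m (S d) a b' Hm0 ltac:(lia) ltac:(lia)) as Hf.
        apply IZR_le in Hf. rewrite abs_IZR, mult_IZR, plus_IZR, mult_IZR, <- pow_IZR, Hb', <- INR_IZR_INZ in Hf.
        eapply Rle_trans; [apply Hf|]. apply Rmult_le_compat_r; auto. apply pow_le, IZR_le; lia.
      * unfold Phi. simpl fst; simpl snd. fold T. apply rsum_le. intros c _.
        assert (Hs : smooth y (a - b' * m)) by (destruct Hw as [-> | ->]; [auto|apply smooth_opp; auto]).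
        unfold cond. cbv beta iota. destruct (decideP (smooth y (fpoly (Z.of_nat n) m (S d) c a b'))) eqn:Es.
        -- rewrite decideP_true; [lra|]. unfold decideP in Es.
           destruct (excluded_middle_informative _) as [g|]; [|discriminate].
           rewrite Hb'. repeat split; auto; try lia; try apply Hs; apply g.
        -- match goal with |- context [if ?x then _ else _] => destruct x end; [apply Rle_0_1|apply Rle_refl].
  - apply rsum_inj_le.
    + apply NoDup_flat_map; auto.
      * intros q Hq. apply FinFun.Injective_map_NoDup; [intros u v e; inversion e; auto|apply Hbl; auto].
      * intros q q' qb _ _ h h'. apply in_map_iff in h, h'. destruct h as (? & <- & _), h' as (? & e & _).
        inversion e; auto.
    + intros [q b] [q' b'] h h' e. apply Hpairs in h, h'. simpl in h, h'.
      destruct h as [h1 h2], h' as [h1' h2'].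
      destruct (witness (q, b)) as (m & (a & c)) eqn:Ew. symmetry in e.
      destruct (witness_spec _ _ _ _ _ Ew) as (w1 & w2 & _); try apply (Hb q b h1 h2); try apply (HQ q h1).
      destruct (witness_spec _ _ _ _ _ e) as (w1' & w2' & _); try apply (Hb q' b' h1' h2'); try apply (HQ q' h1').
      destruct (HQ q h1) as [? _]. destruct (HQ q' h1') as [? _]. f_equal; lia.
    + intros [q b] h. apply Hpairs in h. simpl in h. destruct h as [Hq Hbb].
      destruct (HQ q Hq) as (Hq0 & Hnq & Hqy & HSq & Hcoll).
      destruct (Hb q b Hq Hbb) as (Hb2 & Hbq & HbH & HbL & Hsz & HK).
      destruct (witness (q, b)) as (m & (a & b')) eqn:Ew.
      destruct (witness_spec _ _ _ _ _ Ew Hb2 Hq0 Hbq) as (Hw & Hb' & Ha & Hab & Hg & Hm).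
      pose proof (HmM q b m a b' Hq Hbb Ew).
      assert (Hbf : (b <= zfloor (H / 2))%Z).
      { destruct (zfloor_spec (H / 2)) as [_ h]. assert (b < zfloor (H / 2) + 1)%Z; [|lia].
        apply lt_IZR. rewrite plus_IZR. lra. }
      apply in_prod_iff. split; auto. apply in_prod_iff. rewrite !in_zrange. lia.
    + intros mab _. apply rsum_nonneg. intros c _. destruct (cond _ _ _); lra.
Qed.


(** * Bins of primes *)

(** Primes dividing n are left out, so that n is coprime to q and n b^d is a reduced class. There
    are at most 2 ln n of them, and [bin_card] charges them to half of the Chebyshev count. *)
Definition bin (n : Z) (z : R) : list Z :=
  filter (fun p => decideP (prime p /\ z / 16 < IZR p <= z /\ ~ (p | n)%Z)) (zrange 1 (zfloor z)).

Lemma in_bin n z p : In p (bin n z) <-> prime p /\ z / 16 < IZR p <= z /\ ~ (p | n)%Z.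
Proof.
  unfold bin. rewrite filter_In. split.
  - intros [_ H]. unfold decideP in H. destruct (excluded_middle_informative _); [auto|discriminate].
  - intros H. split; [|apply decideP_true; auto]. destruct H as (H1 & H2 & _).
    apply in_zrange. pose proof (prime_ge_2 p H1). split; [lia|].
    destruct (zfloor_spec z) as [_ h]. assert (p < zfloor z + 1)%Z; [|lia].
    apply lt_IZR. rewrite plus_IZR. lra.
Qed.

Lemma NoDup_bin n z : NoDup (bin n z).
Proof. apply NoDup_filter, NoDup_zrange. Qed.

Lemma zprod_divide (n : Z) l : NoDup l -> (forall p, In p l -> prime p /\ (p | n)%Z) -> (zprod l | n)%Z.
Proof.
  induction 1 as [|p l Hp Hn IH]; intros H; simpl; [apply Z.divide_1_l|].
  destruct (H p) as [h1 h2]; [left; auto|]. destruct IH as [c Hc]; [intros; apply H; right; auto|].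
  assert (d : (p | c)%Z).
  { rewrite Hc in h2. apply prime_mult in h2; auto. destruct h2 as [|h2]; auto. exfalso.
    apply Hp, prime_divide_zprod; auto. intros; apply H; right; auto. }
  destruct d as [e He]. exists e. rewrite Hc, He. ring.
Qed.

Lemma zprod_ge_pow2 l : (forall p, In p l -> prime p) -> 2 ^ length l <= IZR (zprod l).
Proof.
  induction l as [|p l IH]; intros H; simpl; [lra|].
  assert (p2 := prime_ge_2 p (H p (or_introl eq_refl))). apply IZR_le in p2.
  rewrite mult_IZR. apply Rmult_le_compat; try lra; [left; apply pow_lt; lra|].
  apply IH. intros; apply H; right; auto.
Qed.

Lemma prime_divisors_le (n : Z) l : (0 < n)%Z -> NoDup l -> (forall p, In p l -> prime p /\ (p | n)%Z) ->
  INR (length l) * ln 2 <= ln (IZR n).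
Proof.
  intros Hn Hl H. rewrite <- ln_pow by lra. apply ln_le_mono; [apply pow_lt; lra|].
  eapply Rle_trans; [apply zprod_ge_pow2; intros; apply H; auto|].
  apply IZR_le, Z.divide_pos_le; auto. apply zprod_divide; auto.
Qed.

Lemma ln2_lb : 1 / 2 < ln 2.
Proof.
  pose proof ln_4_gt_1 as H. replace 4 with (2 * 2) in H by lra. rewrite ln_mult in H by lra. lra.
Qed.

Lemma bin_card n z : (0 < n)%Z -> 10 ^ 8 <= z -> 2 * ln (IZR n) <= z / (16 * ln z) ->
  z / (16 * ln z) <= INR (length (bin n z)).
Proof.
  intros Hn Hz Hb. destruct (chebyshev_window z Hz) as (l & Hnd & Hp & Hl).
  set (dv := fun p => decideP (p | n)%Z).
  assert (E : INR (length l) = INR (length (filter dv l)) + INR (length (filter (fun p => negb (dv p)) l))).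
  { rewrite <- plus_INR. f_equal. clear. induction l as [|p l IH]; auto. simpl. destruct (dv p); simpl; lia. }
  assert (H1 : INR (length (filter dv l)) * ln 2 <= ln (IZR n)).
  { apply prime_divisors_le; auto; [apply NoDup_filter; auto|]. intros p Hpl. apply filter_In in Hpl.
    destruct Hpl as [Hpl Hd]. split; [apply Hp; auto|]. unfold dv, decideP in Hd.
    destruct (excluded_middle_informative _); [auto|discriminate]. }
  assert (H2 : (length (filter (fun p => negb (dv p)) l) <= length (bin n z))%nat).
  { apply NoDup_incl_length; [apply NoDup_filter; auto|]. intros p Hpl. apply filter_In in Hpl.
    destruct Hpl as [Hpl Hd]. apply in_bin. destruct (Hp p Hpl). split; [auto|split; auto].
    unfold dv, decideP in Hd. destruct (excluded_middle_informative _); [discriminate|auto]. }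
  apply le_INR in H2. pose proof ln2_lb. pose proof (pos_INR (length (filter dv l))).
  assert (HE : z / (8 * ln z) = 2 * (z / (16 * ln z))).
  { field. assert (0 < ln z); [|lra]. rewrite <- ln_1. apply ln_increasing; simpl in Hz; lra. }
  nra.
Qed.

Definition prodR (zs : list R) : R := fold_right Rmult 1 zs.

Lemma prodR_bounds (a b : R) zs : 0 <= a -> (forall z, In z zs -> a <= z <= b) ->
  a ^ length zs <= prodR zs <= b ^ length zs.
Proof.
  intros Ha. induction zs as [|z zs IH]; simpl; intros H; [lra|].
  destruct (H z (or_introl eq_refl)). destruct IH as [h1 h2]; [intros; apply H; right; auto|].
  assert (0 <= a ^ length zs) by (apply pow_le; auto). split; apply Rmult_le_compat; lra.
Qed.

Lemma prodR_sel zs l : (forall z, In z zs -> 1 <= z) -> In l (sel zs) -> 1 <= prodR l <= prodR zs.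
Proof.
  revert l. induction zs as [|z zs IH]; simpl; intros l H Hl.
  - destruct Hl as [<-|[]]; simpl; lra.
  - assert (1 <= z) by (apply H; auto).
    apply in_app_iff in Hl. destruct Hl as [Hl|Hl].
    + specialize (IH l ltac:(auto) Hl). nra.
    + apply in_map_iff in Hl. destruct Hl as (l' & <- & Hl). specialize (IH l' ltac:(auto) Hl). simpl. nra.
Qed.

Lemma cprod_lower (bn : R -> list Z) (G : R) zs : 0 < G ->
  (forall z, In z zs -> 0 <= z /\ z / G <= INR (length (bn z))) ->
  prodR zs / G ^ length zs <= cprod bn zs.
Proof.
  intros HG. induction zs as [|z zs IH]; simpl; intros H; [lra|].
  destruct (H z (or_introl eq_refl)) as [h0 h].
  specialize (IH ltac:(intros; apply H; right; auto)).
  assert (HGp : 0 < G ^ length zs) by (apply pow_lt; auto).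
  replace (z * prodR zs / (G * G ^ length zs)) with (z / G * (prodR zs / G ^ length zs)) by (field; lra).
  assert (0 <= prodR zs).
  { assert (Hz : forall w, In w zs -> 0 <= w) by (intros; apply H; right; auto). clear -Hz.
    induction zs as [|w zs IH]; simpl; [lra|]. apply Rmult_le_pos; [apply Hz; left; auto|apply IH; intros; apply Hz; right; auto]. }
  apply Rmult_le_compat; auto.
  - apply Rmult_le_pos; auto. left. apply Rinv_0_lt_compat; auto.
  - apply Rmult_le_pos; auto. left. apply Rinv_0_lt_compat; auto.
Qed.

(** The points e^tau 16^(-i): with this ratio the bins (z/16, z] are adjacent and do not overlap. *)
Definition grid (tau : R) (k : nat) : list R := map (fun i => exp (tau - INR i * ln 16)) (seq 0 k).

Lemma ln16_pos : 0 < ln 16.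
Proof. rewrite <- ln_1. apply ln_increasing; lra. Qed.

Lemma length_grid tau k : length (grid tau k) = k.
Proof. unfold grid. rewrite length_map, length_seq. reflexivity. Qed.

Lemma in_grid tau k z : In z (grid tau k) -> exists i, (i < k)%nat /\ z = exp (tau - INR i * ln 16).
Proof.
  intros H. apply in_map_iff in H. destruct H as (i & <- & Hi). apply in_seq in Hi. exists i. split; [lia|auto].
Qed.

Lemma grid_bounds tau k z : In z (grid tau k) -> exp (tau - INR k * ln 16) * 16 <= z <= exp tau.
Proof.
  intros H. apply in_grid in H. destruct H as (i & Hi & ->). pose proof ln16_pos as h16. pose proof (pos_INR i).
  split.
  - rewrite <- (exp_ln 16) at 2 by lra. rewrite <- exp_plus. apply exp_le_mono.
    assert (Hi' : (S i <= k)%nat) by lia. apply le_INR in Hi'. rewrite S_INR in Hi'. nra.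
  - apply exp_le_mono. nra.
Qed.

(* The exponent of the grid is chosen later so that this product is a prescribed real. *)
Lemma prodR_grid tau k : prodR (grid tau k) = exp (INR k * tau - INR k * (INR k - 1) / 2 * ln 16).
Proof.
  unfold grid, prodR. induction k as [|k IH].
  - simpl. rewrite <- exp_0. f_equal. field.
  - rewrite seq_S, map_app, fold_right_app. cbn [map fold_right].
    assert (E : forall a l, fold_right Rmult a l = fold_right Rmult 1 l * a).
    { intros a l. induction l as [|y l IHl]; simpl; [lra|]. rewrite IHl. lra. }
    rewrite E, IH. replace (0 + k)%nat with k by lia. rewrite Rmult_1_r, <- exp_plus. f_equal.
    rewrite S_INR. field.
Qed.

Lemma bin_grid_disjoint n tau k z z' p : In z (grid tau k) -> In z' (grid tau k) ->
  In p (bin n z) -> In p (bin n z') -> z = z'.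
Proof.
  intros H H' Hp Hp'. apply in_bin in Hp, Hp'. destruct Hp as (_ & Hp & _), Hp' as (_ & Hp' & _).
  apply in_grid in H, H'. destruct H as (i & _ & ->), H' as (j & _ & ->).
  assert (K : forall i j, (i < j)%nat -> exp (tau - INR j * ln 16) <= exp (tau - INR i * ln 16) / 16).
  { clear. intros i j Hij. rewrite <- (exp_ln 16) at 3 by lra. unfold Rdiv. rewrite <- exp_Ropp, <- exp_plus.
    apply exp_le_mono. assert (h : (S i <= j)%nat) by lia. apply le_INR in h. rewrite S_INR in h.
    pose proof ln16_pos. nra. }
  destruct (Nat.lt_total i j) as [h|[->|h]]; auto; apply K in h; lra.
Qed.

Lemma NoDup_grid tau k : NoDup (grid tau k).
Proof.
  apply FinFun.Injective_map_NoDup; [|apply seq_NoDup]. intros i j E.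
  apply exp_inv in E. pose proof ln16_pos. apply INR_eq. nra.
Qed.

(** The primes of the first family lie above [mid], those of the second do not exceed it. *)
Lemma good_bins_two_grids n tau k tau' k' (mid : R) :
  (forall z, In z (grid tau k) -> mid <= z / 16) -> (forall z, In z (grid tau' k') -> z <= mid) ->
  good_bins (bin n) (grid tau k ++ grid tau' k').
Proof.
  intros H H'.
  assert (X : forall z z', In z (grid tau k) -> In z' (grid tau' k') -> z' < z).
  { intros z z' h h'. specialize (H z h). specialize (H' z' h').
    assert (0 < z) by (apply in_grid in h; destruct h as (? & _ & ->); apply exp_pos). lra. }
  split; [|split].
  - apply NoDup_app; try apply NoDup_grid. intros z h h'. specialize (X z z h h'). lra.
  - intros z _. split; [apply NoDup_bin|]. intros p Hp. apply in_bin in Hp. tauto.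
  - intros z z' p Hz Hz' Hp Hp'. apply in_app_iff in Hz, Hz'.
    destruct Hz as [Hz|Hz], Hz' as [Hz'|Hz']; try (eapply bin_grid_disjoint; eauto; fail); exfalso;
      apply in_bin in Hp, Hp'; destruct Hp as (_ & Hp & _), Hp' as (_ & Hp' & _).
    + specialize (H z Hz). specialize (H' z' Hz'). lra.
    + specialize (H z' Hz'). specialize (H' z Hz). lra.
Qed.

Lemma zprod_coprime t r : (forall p, In p t -> prime p) -> (forall p, In p t -> ~ (p | r)%Z) ->
  Z.gcd (zprod t) r = 1%Z.
Proof.
  intros Hp Hd. apply Zgcd_1_rel_prime. induction t as [|p t IH]; simpl; [apply rel_prime_1|].
  apply rel_prime_sym, rel_prime_mult; apply rel_prime_sym.
  - apply prime_rel_prime; [apply Hp|apply Hd]; left; auto.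
  - apply IH; intros; [apply Hp|apply Hd]; right; auto.
Qed.

Lemma NoDup_app_disjoint {A : Type} (l1 l2 : list A) x : NoDup (l1 ++ l2) -> In x l1 -> In x l2 -> False.
Proof.
  induction l1 as [|y l1 IH]; simpl; intros Hn H1 H2; auto. inversion Hn as [|? ? Hy Hn']; subst.
  destruct H1 as [<-|H1]; [apply Hy, in_app_iff; auto|auto].
Qed.

Lemma pset_coprime (bn : R -> list Z) l1 l2 s r : good_bins bn (l1 ++ l2) ->
  In s (pset bn l1) -> In r (pset bn l2) -> Z.gcd s r = 1%Z.
Proof.
  intros H Hs Hr.
  assert (N1 : NoDup l1) by (destruct H as (H & _); apply NoDup_app_remove_r in H; auto).
  assert (N2 : NoDup l2) by (destruct H as (H & _); apply NoDup_app_remove_l in H; auto).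
  assert (G1 : good_bins bn l1) by (apply (good_bins_incl _ _ _ H N1), incl_appl, incl_refl).
  assert (G2 : good_bins bn l2) by (apply (good_bins_incl _ _ _ H N2), incl_appr, incl_refl).
  apply in_map_iff in Hs, Hr. destruct Hs as (t & <- & Ht), Hr as (t' & <- & Ht').
  apply zprod_coprime; [intros q Hq; apply (choose_prime bn l1 t); auto|]. intros p Hp Hd.
  apply prime_divide_zprod in Hd; [|apply (choose_prime bn l1 t); auto|intros q Hq; apply (choose_prime bn l2 t'); auto].
  destruct (choose_in_bin _ _ _ _ Ht Hp) as (z & Hz & Hpz).
  destruct (choose_in_bin _ _ _ _ Ht' Hd) as (z' & Hz' & Hpz').
  destruct H as (Hn & _ & H3).
  assert (z = z') by (apply (H3 z z' p); auto; apply in_app_iff; auto). subst.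
  eapply NoDup_app_disjoint; eauto.
Qed.


(** * The average contribution of the nontrivial divisors *)

Lemma sel_length (zs l : list R) : In l (sel zs) -> (length l <= length zs)%nat.
Proof.
  revert l. induction zs as [|z zs IH]; simpl; intros l H.
  - destruct H as [<-|[]]; auto.
  - apply in_app_iff in H. destruct H as [H|H]; [apply IH in H; lia|].
    apply in_map_iff in H. destruct H as (l' & <- & H). apply IH in H. simpl. lia.
Qed.

(** The elements of [pset l] are distinct integers up to prodR l, so the large sieve over all
    denominators up to that bound covers them. The surplus denominators cost no more than the
    inverse density of [pset l]. *)
Lemma pset_sieve (bn : R -> list Z) (l zs : list R) (La : R) :
  good_bins bn l -> good_bins bn zs ->
  (forall z p, In z (l ++ zs) -> In p (bn z) -> IZR p <= z) ->
  1 <= prodR l -> 1 <= prodR zs -> 1 + 2 * ln (prodR l) <= La ->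
  rsum (energy (pset bn zs)) (pset bn l) <= cprod bn zs * (4 * prodR zs + 8 * prodR l ^ 2 * La).
Proof.
  intros Hl Hz Hp Rl Nz HLa.
  set (S := pset bn zs).
  assert (bound : forall m, good_bins bn m -> incl m (l ++ zs) -> forall s, In s (pset bn m) -> 1 <= IZR s <= prodR m).
  { intros m Hm Hi s Hs. split; [pose proof (in_pset_pos _ _ _ Hm Hs); apply IZR_le; lia|].
    apply in_map_iff in Hs. destruct Hs as (t & <- & Ht). apply (zprod_choose_bounds bn); auto.
    intros z p Hzm Hpz. split; [|apply Hp; auto].
    destruct Hm as (_ & Hm & _). destruct (Hm z Hzm) as [_ h]. pose proof (prime_ge_2 p (h p Hpz)). apply IZR_le; lia. }
  set (M := Z.to_nat (zfloor (prodR l))). set (N := Z.to_nat (zfloor (prodR zs) + 1)).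
  destruct (zfloor_spec (prodR l)) as [f1 f2]. destruct (zfloor_spec (prodR zs)) as [g1 g2].
  assert (F1 : (1 <= zfloor (prodR l))%Z).
  { assert (0 < zfloor (prodR l))%Z; [|lia]. apply lt_IZR. lra. }
  assert (G1 : (1 <= zfloor (prodR zs))%Z).
  { assert (0 < zfloor (prodR zs))%Z; [|lia]. apply lt_IZR. lra. }
  assert (EM : INR M = IZR (zfloor (prodR l))) by (unfold M; rewrite INR_IZR_INZ, Z2Nat.id; auto; lia).
  assert (EN : INR N = IZR (zfloor (prodR zs)) + 1) by (unfold N; rewrite INR_IZR_INZ, Z2Nat.id, plus_IZR; auto; lia).
  eapply Rle_trans; [apply (rsum_incl _ _ (map Z.of_nat (seq 1 M)))|].
  - apply NoDup_pset; auto.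
  - intros s Hs. destruct (bound l Hl (incl_appl _ (incl_refl _)) s Hs) as [b1 b2].
    apply in_map_iff. exists (Z.to_nat s). apply le_IZR in b1. rewrite in_seq.
    assert (s < zfloor (prodR l) + 1)%Z by (apply lt_IZR; rewrite plus_IZR; lra). unfold M. lia.
  - intros; apply energy_nonneg.
  - eapply Rle_trans; [apply (large_sieve M N S)|].
    + apply NoDup_pset; auto.
    + intros s Hs. destruct (bound zs Hz (incl_appr _ (incl_refl _)) s Hs) as [b1 b2].
      apply le_IZR in b1.
      assert (s < zfloor (prodR zs) + 1)%Z by (apply lt_IZR; rewrite plus_IZR; lra). unfold N. lia.
    + unfold M; lia.
    + unfold S. rewrite length_pset. apply Rmult_le_compat_l; [rewrite <- length_pset; apply pos_INR|].
      rewrite EN. apply Rplus_le_compat; [lra|].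
      assert (m1 : 1 <= INR M) by (rewrite EM; apply IZR_le; auto).
      assert (HL : Lg M <= La).
      { unfold Lg. rewrite mult_INR, ln_mult by lra.
        assert (ln (INR M) <= ln (prodR l)) by (apply ln_le_mono; lra). lra. }
      assert (H0 : 0 <= Lg M).
      { unfold Lg. assert (0 <= ln (INR (M * M))); [|lra]. rewrite <- ln_1. apply ln_le_mono; [lra|].
        rewrite mult_INR. nra. }
      rewrite mult_INR. apply Rmult_le_compat; auto; nra.
Qed.

(** Write R for prodR l and N for the product of the bins used from S. After division by the number
    of denominators and by the square of the number of products, the two terms of the large sieve
    become 4/R and 8 La R/N, times a loss G for each bin. [Hbig] serves the sublists with more than
    j0 bins, [Hsmall] those with at most j0. *)
Lemma sieve_average (bn : R -> list Z) (zsQ zsS : list R) (G Y0 Y La th : R) (j0 jP : nat) :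
  good_bins bn (zsQ ++ zsS) -> 1 <= G -> 1 <= Y0 ->
  (forall z, In z (zsQ ++ zsS) -> Y0 <= z <= Y /\ z / G <= INR (length (bn z)) /\
     forall p, In p (bn z) -> IZR p <= z) ->
  1 + 2 * ln (prodR zsQ) <= La ->
  (jP <= length zsS)%nat ->
  G ^ (length zsQ + length zsS) * (4 / Y0 ^ S j0 + 8 * La * prodR zsQ / prodR zsS) <= th ->
  G ^ (j0 + jP) * (4 / Y0 + 8 * La * Y ^ j0 / Y0 ^ jP) <= th ->
  forall l, In l (sel zsQ) -> l <> [] ->
  / cprod bn l * rsum (energy (pset bn zsS)) (pset bn l) <= th * INR (length (pset bn zsS)) ^ 2.
Proof.
  intros Hg HG HY0 Hz HLa HjP Hbig Hsmall l Hl Hne.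
  assert (NQ : NoDup zsQ) by (destruct Hg as (H & _); apply NoDup_app_remove_r in H; auto).
  assert (NS : NoDup zsS) by (destruct Hg as (H & _); apply NoDup_app_remove_l in H; auto).
  assert (Hli : incl l zsQ) by (apply sel_incl; auto).
  assert (Nl : NoDup l) by (apply (sel_NoDup zsQ); auto).
  assert (Gl : good_bins bn l) by (apply (good_bins_incl _ _ _ Hg Nl); intros x Hx; apply in_app_iff; auto).
  assert (GS : good_bins bn zsS) by (apply (good_bins_incl _ _ _ Hg NS), incl_appr, incl_refl).
  assert (ge1 : forall m, incl m (zsQ ++ zsS) -> 1 <= prodR m).
  { intros m Hm. eapply Rle_trans; [|apply (prodR_bounds 1 Y m); [lra|]].
    - rewrite pow1. lra.
    - intros z Hzm. destruct (Hz z (Hm z Hzm)) as [h _]. lra. }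
  assert (HY : 1 <= Y).
  { destruct l as [|z l]; [contradiction|]. destruct (Hz z) as [h _]; [apply in_app_iff; left; apply Hli; left; auto|lra]. }
  assert (Rl : 1 <= prodR l <= prodR zsQ).
  { apply prodR_sel; auto. intros z Hzz. destruct (Hz z) as [h _]; [apply in_app_iff; auto|lra]. }
  assert (NS1 : 1 <= prodR zsS) by (apply ge1, incl_appr, incl_refl).
  assert (Rlen : Y0 ^ length l <= prodR l <= Y ^ length l).
  { apply prodR_bounds; [lra|]. intros z Hzz. apply Hz, in_app_iff. left; auto. }
  assert (low : forall m, incl m (zsQ ++ zsS) -> prodR m / G ^ length m <= cprod bn m).
  { intros m Hm. apply cprod_lower; [lra|]. intros z Hzm. destruct (Hz z (Hm z Hzm)) as (h1 & h2 & _). split; [lra|auto]. }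
  assert (HLa' : 1 + 2 * ln (prodR l) <= La).
  { assert (ln (prodR l) <= ln (prodR zsQ)) by (apply ln_le_mono; lra). lra. }
  assert (La0 : 0 <= La).
  { assert (0 <= ln (prodR l)) by (rewrite <- ln_1; apply ln_le_mono; lra). lra. }
  assert (Gpos : forall k, 0 < G ^ k) by (intros; apply pow_lt; lra).
  assert (Ypos : forall k, 0 < Y0 ^ k) by (intros; apply pow_lt; lra).
  assert (cl : / cprod bn l <= G ^ length l / prodR l).
  { assert (h := low l ltac:(intros x Hx; apply in_app_iff; auto)).
    assert (0 < prodR l / G ^ length l) by (apply Rdiv_lt_0_compat; [lra|auto]).
    replace (G ^ length l / prodR l) with (/ (prodR l / G ^ length l)) by (field; split; [lra|pose proof (Gpos (length l)); lra]).
    apply Rinv_le_contravar; auto. }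
  assert (l1 : (1 <= length l)%nat) by (destruct l; [contradiction|simpl; lia]).
  assert (Y0l : Y0 <= prodR l).
  { eapply Rle_trans; [|apply Rlen]. rewrite <- (pow_1 Y0) at 1. apply Rle_pow; auto. }
  (* Stated for any part m of the bins of S, since it is applied both to the first jP bins and to
     all of them. *)
  assert (core : forall m, incl m zsS -> NoDup m ->
     / cprod bn l * rsum (energy (pset bn m)) (pset bn l)
       <= G ^ (length l + length m) * (4 / prodR l + 8 * La * prodR l / prodR m) * cprod bn m ^ 2).
  { intros m Hm Nm.
    assert (Gm : good_bins bn m) by (apply (good_bins_incl _ _ _ Hg Nm); intros x Hx; apply in_app_iff; auto).
    assert (m1 : 1 <= prodR m) by (apply ge1; intros x Hx; apply in_app_iff; auto).
    assert (cm : prodR m / G ^ length m <= cprod bn m) by (apply low; intros x Hx; apply in_app_iff; auto).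
    assert (cm0 : 0 < cprod bn m).
    { eapply Rlt_le_trans; [|apply cm]. apply Rdiv_lt_0_compat; [lra|auto]. }
    assert (HV : rsum (energy (pset bn m)) (pset bn l) <= cprod bn m * (4 * prodR m + 8 * prodR l ^ 2 * La)).
    { apply pset_sieve; auto; [|lra].
      intros z p Hzz. apply Hz. apply in_app_iff in Hzz. apply in_app_iff. destruct Hzz; auto. }
    assert (HV0 : 0 <= rsum (energy (pset bn m)) (pset bn l)) by (apply rsum_nonneg; intros; apply energy_nonneg).
    assert (K0 : 0 < 4 * prodR m + 8 * prodR l ^ 2 * La).
    { assert (0 <= prodR l ^ 2 * La) by (apply Rmult_le_pos; auto; apply pow_le; lra). lra. }
    apply Rle_trans with (G ^ length l / prodR l * (cprod bn m * (4 * prodR m + 8 * prodR l ^ 2 * La))).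
    { apply Rmult_le_compat; auto. left. apply Rinv_0_lt_compat. 
      eapply Rlt_le_trans; [|apply (low l); intros x Hx; apply in_app_iff; auto]. apply Rdiv_lt_0_compat; [lra|auto]. }
    replace (G ^ (length l + length m) * (4 / prodR l + 8 * La * prodR l / prodR m) * cprod bn m ^ 2) with
      (G ^ length l / prodR l * (cprod bn m * (4 * prodR m + 8 * prodR l ^ 2 * La)) * (cprod bn m / (prodR m / G ^ length m))).
    2:{ rewrite pow_add. field. repeat split; try lra. pose proof (Gpos (length m)); lra. }
    rewrite <- (Rmult_1_r (G ^ length l / prodR l * _)) at 1. apply Rmult_le_compat_l.
    { apply Rmult_le_pos; [|apply Rmult_le_pos; lra]. left. apply Rdiv_lt_0_compat; [auto|lra]. }
    assert (0 < prodR m / G ^ length m) by (apply Rdiv_lt_0_compat; [lra|auto]).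
    apply Rmult_le_reg_r with (prodR m / G ^ length m); auto. unfold Rdiv at 2. rewrite Rmult_assoc, Rinv_l by lra. lra. }
  rewrite length_pset.
  (* Denominators with few prime factors are handled with a bounded number jP of
     bins of S, which costs only G^(j0+jP); the others exceed Y0^(j0+1), which
     absorbs the density G^-(length zsS) of the whole of S. *)
  destruct (le_lt_dec (length l) j0) as [Hj|Hj].
  - set (m := firstn jP zsS). set (h := skipn jP zsS).
    assert (Emh : zsS = m ++ h) by (symmetry; apply firstn_skipn).
    assert (Nm : NoDup m) by (rewrite Emh in NS; apply NoDup_app_remove_r in NS; auto).
    assert (Nh : NoDup h) by (rewrite Emh in NS; apply NoDup_app_remove_l in NS; auto).
    assert (Hmi : incl m zsS) by (rewrite Emh; apply incl_appl, incl_refl).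
    assert (Hhi : incl h zsS) by (rewrite Emh; apply incl_appr, incl_refl).
    assert (Lm : length m = jP) by (apply firstn_length_le; auto).
    specialize (core m Hmi Nm). rewrite Lm in core.
    assert (HV : rsum (energy (pset bn zsS)) (pset bn l) <= INR (length (pset bn h)) ^ 2 * rsum (energy (pset bn m)) (pset bn l)).
    { rewrite <- rsum_scal. apply rsum_le. intros r Hr. apply energy_product.
      - apply (in_pset_pos _ _ _ Gl Hr).
      - intros f. rewrite Emh at 1. apply rsum_pset_app.
      - intros x Hx. rewrite Z.gcd_comm. apply (pset_coprime bn l h); auto.
        apply (good_bins_incl _ _ _ Hg).
        + apply NoDup_app; auto. intros y Hy Hy'. destruct Hg as (Hn & _).
          apply (NoDup_app_disjoint zsQ zsS y); auto.
        + apply incl_app; [intros y Hy; apply in_app_iff; auto|intros y Hy; apply in_app_iff; auto]. }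
    rewrite length_pset in HV.
    assert (cl0 : 0 < / cprod bn l).
    { apply Rinv_0_lt_compat. eapply Rlt_le_trans; [|apply (low l); intros x Hx; apply in_app_iff; auto]. apply Rdiv_lt_0_compat; [lra|auto]. }
    rewrite Emh at 2. rewrite cprod_app.
    apply Rle_trans with (cprod bn h ^ 2 * (th * cprod bn m ^ 2)); [|right; ring].
    apply Rle_trans with (cprod bn h ^ 2 * (/ cprod bn l * rsum (energy (pset bn m)) (pset bn l))).
    { replace (cprod bn h ^ 2 * (/ cprod bn l * rsum (energy (pset bn m)) (pset bn l))) with
       (/ cprod bn l * (cprod bn h ^ 2 * rsum (energy (pset bn m)) (pset bn l))) by ring.
      apply Rmult_le_compat_l; lra. }
    apply Rmult_le_compat_l; [apply pow2_ge_0|].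
    eapply Rle_trans; [apply core|]. apply Rmult_le_compat_r; [apply pow2_ge_0|].
    eapply Rle_trans; [|apply Hsmall].
    assert (m1 : Y0 ^ jP <= prodR m).
    { rewrite <- Lm. apply (prodR_bounds Y0 Y); [lra|]. intros z Hzm. apply Hz, in_app_iff; auto. }
    assert (RY : prodR l <= Y ^ j0).
    { eapply Rle_trans; [apply Rlen|]. apply Rle_pow; auto. }
    assert (0 < 8 * La * prodR l \/ La = 0) by (destruct La0; [left; nra|right; auto]).
    apply Rmult_le_compat.
    + left; auto.
    + apply Rplus_le_le_0_compat; [left; apply Rdiv_lt_0_compat; lra|].
      apply Rmult_le_pos; [nra|]. left. apply Rinv_0_lt_compat. specialize (Ypos jP); lra.
    + apply Rle_pow; auto. lia.
    + apply Rplus_le_compat.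
      * apply Rmult_le_compat_l; [lra|]. apply Rinv_le_contravar; lra.
      * apply Rmult_le_compat; [nra| |nra|].
        -- left. apply Rinv_0_lt_compat. specialize (Ypos jP); lra.
        -- apply Rinv_le_contravar; auto.
  - eapply Rle_trans; [apply (core zsS (incl_refl _) NS)|]. apply Rmult_le_compat_r; [apply pow2_ge_0|].
    eapply Rle_trans; [|apply Hbig].
    apply Rmult_le_compat.
    + left; auto.
    + apply Rplus_le_le_0_compat; [left; apply Rdiv_lt_0_compat; lra|].
      apply Rmult_le_pos; [nra|]. left. apply Rinv_0_lt_compat. lra.
    + apply Rle_pow; auto. pose proof (sel_length _ _ Hl). lia.
    + apply Rplus_le_compat.
      * apply Rmult_le_compat_l; [lra|]. apply Rinv_le_contravar; auto.
        eapply Rle_trans; [|apply Rlen]. apply Rle_pow; auto.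
      * apply Rmult_le_compat_r; [left; apply Rinv_0_lt_compat; lra|]. nra.
Qed.


(** * Asymptotics *)

(* Used with V = ln (ln n) and U^3 = ln n / V, for which ln U <= V / 3. *)
Definition ev (P : R -> R -> Prop) : Prop :=
  exists K, forall U V, K <= U -> K <= V -> ln U <= V / 3 -> P U V.

Lemma ev_and P Q : ev P -> ev Q -> ev (fun U V => P U V /\ Q U V).
Proof.
  intros [K HK] [K' HK']. exists (Rmax K K'). intros U V HU HV Hl.
  pose proof (Rmax_l K K'). pose proof (Rmax_r K K'). split; [apply HK|apply HK']; lra.
Qed.

Lemma ev_mono (P Q : R -> R -> Prop) : (forall U V, P U V -> Q U V) -> ev P -> ev Q.
Proof. intros H [K HK]. exists K. auto. Qed.

Lemma ev_U c : ev (fun U V => c <= U).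
Proof. exists c. auto. Qed.

Lemma ev_V c : ev (fun U V => c <= V).
Proof. exists c. auto. Qed.

Lemma ev_lnU : ev (fun U V => ln U <= V / 3).
Proof. exists 0. auto. Qed.

Lemma exp_pow_nat a k : exp a ^ k = exp (INR k * a).
Proof.
  induction k as [|k IH]; [simpl; rewrite Rmult_0_l, exp_0; auto|].
  rewrite S_INR. cbn [pow]. rewrite IH, <- exp_plus. f_equal. ring.
Qed.

Lemma ev_lnV e : 0 < e -> ev (fun U V => ln V <= e * V).
Proof.
  intros He. exists (Rmax 1 (4 / (e * e))). intros U V _ HV _.
  pose proof (Rmax_l 1 (4 / (e * e))). pose proof (Rmax_r 1 (4 / (e * e))).
  assert (V0 : 0 < V) by lra. set (s := sqrt V).
  assert (Hs : s * s = V) by (apply sqrt_sqrt; lra).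
  assert (s0 : 0 < s) by (apply sqrt_lt_R0; auto).
  assert (E : ln V <= 2 * s).
  { rewrite <- Hs, ln_mult by auto. pose proof (ln_lt_self s s0). lra. }
  assert (h : 2 <= e * s).
  { destruct (Rle_lt_dec 2 (e * s)) as [|h]; auto. exfalso.
    assert (h1 : (e * s) * (e * s) < 2 * 2) by (apply Rmult_le_0_lt_compat; nra).
    assert (4 <= e * e * V).
    { apply Rmult_le_reg_l with (/ (e * e)); [apply Rinv_0_lt_compat; nra|].
      rewrite <- Rmult_assoc, Rinv_l by nra. unfold Rdiv in *. lra. }
    rewrite <- Hs in H1. lra. }
  rewrite <- Hs in E |- *. nra.
Qed.

Lemma ev_exp a c k : 0 < a -> ev (fun U V => c * (U * V) ^ k <= exp (a * (U * V))).
Proof.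
  intros Ha. set (m := INR (S k)). assert (m0 : 0 < m) by (apply lt_0_INR; lia).
  set (c' := Rabs c * (m / a) ^ S k).
  exists (Rmax 1 c'). intros U V HU HV _.
  pose proof (Rmax_l 1 c'). pose proof (Rmax_r 1 c').
  set (x := U * V). assert (Hx : 1 <= x) by (unfold x; nra). assert (Hx' : c' <= x) by (unfold x; nra).
  assert (E : (a / m * x) ^ S k <= exp (a * x)).
  { replace (a * x) with (INR (S k) * (a / m * x)) by (fold m; field; lra). rewrite <- exp_pow_nat.
    apply pow_incr. assert (0 < a / m * x) by (apply Rmult_lt_0_compat; [apply Rdiv_lt_0_compat; auto|lra]).
    split; [lra|]. pose proof (exp_ineq1 (a / m * x)). lra. }
  eapply Rle_trans; [|apply E]. rewrite Rpow_mult_distr. cbn [pow]. rewrite <- (Rmult_assoc _ x).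
  assert (xk : 0 < x ^ k) by (apply pow_lt; lra).
  apply Rmult_le_compat_r; [lra|].
  assert (am : 0 < a / m) by (apply Rdiv_lt_0_compat; auto).
  change (a / m * (a / m) ^ k) with ((a / m) ^ S k).
  assert (pm : 0 < (a / m) ^ S k) by (apply pow_lt; auto).
  apply Rle_trans with (Rabs c); [apply Rle_abs|].
  replace (Rabs c) with ((a / m) ^ S k * c').
  - apply Rmult_le_compat_l; lra.
  - unfold c'. rewrite (Rmult_comm (Rabs c)), <- Rmult_assoc, <- Rpow_mult_distr.
    replace (a / m * (m / a)) with 1 by (field; lra). rewrite pow1. lra.
Qed.

Lemma pigeonhole {A : Type} (l : list A) (f : A -> Z) (lo hi : Z) :
  (forall x, In x l -> (lo <= f x <= hi)%Z) -> l <> [] ->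
  exists x, In x l /\
    INR (length l) <= IZR (hi - lo + 1) * INR (length (filter (fun y => Z.eqb (f y) (f x)) l)).
Proof.
  intros H Hne.
  destruct (excluded_middle_informative (exists x, In x l /\
    INR (length l) <= IZR (hi - lo + 1) * INR (length (filter (fun y => Z.eqb (f y) (f x)) l)))) as [|No]; auto.
  exfalso.
  assert (Hlh : (lo <= hi)%Z) by (destruct l as [|x l]; [contradiction|specialize (H x (or_introl eq_refl)); lia]).
  set (n := IZR (hi - lo + 1)). assert (n1 : 1 <= n) by (apply IZR_le; lia).
  assert (Hn : INR (length (zrange lo hi)) = n).
  { rewrite length_zrange, INR_IZR_INZ, Z2Nat.id by lia. reflexivity. }
  assert (L0 : 0 < INR (length l)) by (destruct l; [contradiction|apply lt_0_INR; simpl; lia]).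
  set (c := fun w => INR (length (filter (fun y => Z.eqb (f y) w) l))).
  assert (E : INR (length l) = rsum c (zrange lo hi)).
  { unfold c. rewrite (rsum_ext_in _ (fun w => rsum (fun y => if Z.eqb (f y) w then 1 else 0) l))
      by (intros w _; apply (length_filter_rsum (fun y => Z.eqb (f y) w))).
    rewrite rsum_swap, (rsum_ext_in _ (fun _ => 1)), rsum_const; [lra|].
    intros y Hy. rewrite <- (length_filter_rsum (fun w => Z.eqb (f y) w)).
    replace (filter (fun w => Z.eqb (f y) w) (zrange lo hi)) with [f y]; [reflexivity|].
    symmetry. apply Permutation_length_1_inv.
    apply NoDup_Permutation; [constructor; [simpl; tauto|constructor]|apply NoDup_filter, NoDup_zrange|].
    intros w. rewrite filter_In, Z.eqb_eq, in_zrange. simpl. specialize (H y Hy).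
    split; [intros [<-|[]]; auto|intros [_ e]; auto]. }
  destruct (excluded_middle_informative (exists x, In x l /\ INR (length l) <= n * c (f x))) as [[x [Hx h]]|No']; [apply No; exists x; auto|].
  destruct (excluded_middle_informative (exists w, In w (zrange lo hi) /\ INR (length l) <= n * c w)) as [[w [Hw h]]|No2].
  - destruct (filter (fun y => Z.eqb (f y) w) l) as [|x l'] eqn:Ef.
    + unfold c in h. rewrite Ef in h. simpl in h. lra.
    + assert (Hx : In x (filter (fun y => Z.eqb (f y) w) l)) by (rewrite Ef; left; auto).
      apply filter_In in Hx. destruct Hx as [Hx e]. apply Z.eqb_eq in e. apply No'. exists x. rewrite e. auto.
  - assert (X : forall w, In w (zrange lo hi) -> n * c w < INR (length l)).
    { intros w Hw. apply Rnot_le_lt. intros h. apply No2. eauto. }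
    assert (Y : n * rsum c (zrange lo hi) < n * INR (length l)); [|rewrite <- E in Y; lra].
    rewrite <- rsum_scal, <- Hn at 1. rewrite <- rsum_const.
    assert (Z0 : zrange lo hi <> []) by (intros e; rewrite e in Hn; simpl in Hn; lra).
    clear -X Z0. induction (zrange lo hi) as [|w r IH]; [contradiction|]. rewrite !rsum_cons.
    destruct r as [|w' r].
    + unfold rsum. simpl. specialize (X w (or_introl eq_refl)). lra.
    + apply Rplus_lt_compat; [apply X; left; auto|apply IH; [intros; apply X; right; auto|discriminate]].
Qed.

Lemma count_multiples (p lo hi : Z) : (0 < p)%Z -> (lo <= hi + 1)%Z ->
  INR (length (filter (fun b => Z.eqb (b mod p) 0) (zrange lo hi))) <= IZR (hi - lo + 1) / IZR p + 1.
Proof.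
  intros Hp Hlh.
  assert (L : (length (filter (fun b => Z.eqb (b mod p) 0) (zrange lo hi)) <=
     length (map (Z.mul p) (zrange ((lo + p - 1) / p) (hi / p))))%nat).
  { apply NoDup_incl_length; [apply NoDup_filter, NoDup_zrange|]. intros b Hb. apply filter_In in Hb.
    destruct Hb as [Hb e]. apply Z.eqb_eq in e. apply in_zrange in Hb. pose proof (Z.div_mod b p ltac:(lia)).
    apply in_map_iff. exists (b / p)%Z. split; [lia|]. apply in_zrange. split.
    - apply Z.lt_succ_r. apply Z.div_lt_upper_bound; lia.
    - apply Z.div_le_mono; lia. }
  rewrite length_map, length_zrange in L. apply le_INR in L. eapply Rle_trans; [apply L|].
  assert (Hp' : 0 < IZR p) by (apply IZR_lt; auto).
  assert (0 <= IZR (hi - lo + 1) / IZR p).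
  { apply Rmult_le_pos; [apply IZR_le; lia|left; apply Rinv_0_lt_compat; auto]. }
  rewrite INR_IZR_INZ.
  destruct (Z.le_gt_cases 0 (hi / p - (lo + p - 1) / p + 1)) as [h|h].
  - rewrite Z2Nat.id by auto.
    pose proof (Z.mul_div_le hi p Hp). pose proof (Z.mul_succ_div_gt (lo + p - 1) p Hp).
    assert (h1 : (p * (hi / p - (lo + p - 1) / p + 1) <= (hi - lo + 1) + p)%Z) by nia.
    apply IZR_le in h1. rewrite mult_IZR, (plus_IZR (hi - lo + 1) p) in h1.
    apply Rmult_le_reg_l with (IZR p); auto.
    replace (IZR p * (IZR (hi - lo + 1) / IZR p + 1)) with (IZR (hi - lo + 1) + IZR p) by (field; lra). lra.
  - revert h. generalize (hi / p - (lo + p - 1) / p + 1)%Z. intros w h.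
    replace (Z.to_nat w) with 0%nat by lia. simpl. lra.
Qed.

(** Union bound over the primes of t: each removes a proportion of at most 1/Y, up to one
    element. *)
Lemma count_coprime (t : list Z) (Y : R) (lo hi : Z) : 0 < Y -> (lo <= hi + 1)%Z ->
  (forall p, In p t -> prime p /\ Y <= IZR p) ->
  IZR (hi - lo + 1) - INR (length t) * (IZR (hi - lo + 1) / Y + 1) <=
  INR (length (filter (fun b => Z.eqb (Z.gcd b (zprod t)) 1) (zrange lo hi))).
Proof.
  intros HY Hlh. set (D := IZR (hi - lo + 1)).
  assert (D0 : 0 <= D) by (apply IZR_le; lia).
  assert (EL : INR (length (zrange lo hi)) = D) by (rewrite length_zrange, INR_IZR_INZ, Z2Nat.id; auto; lia).
  intros H. rewrite length_filter_rsum.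
  apply Rle_trans with (rsum (fun b => 1 + -1 * rsum (fun p => if Z.eqb (b mod p) 0 then 1 else 0) t) (zrange lo hi)).
  - rewrite rsum_plus, rsum_const, EL, rsum_scal, rsum_swap.
    assert (X : rsum (fun p => rsum (fun b => if Z.eqb (b mod p) 0 then 1 else 0) (zrange lo hi)) t
       <= INR (length t) * (D / Y + 1)); [|lra].
    apply rsum_le_const. intros p Hp. destruct (H p Hp) as [Pp Hp']. pose proof (prime_ge_2 p Pp).
    rewrite <- (length_filter_rsum (fun b => Z.eqb (b mod p) 0)).
    eapply Rle_trans; [apply count_multiples; lia|]. fold D. apply Rplus_le_compat_r.
    apply Rmult_le_compat_l; auto. apply Rinv_le_contravar; auto.
  - apply rsum_le. intros b _.
    assert (P0 : forall p, In p t -> 0 <= if Z.eqb (b mod p) 0 then 1 else 0) by (intros p _; destruct (Z.eqb _ _); lra).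
    pose proof (rsum_nonneg _ _ P0) as P1.
    destruct (Z.eqb_spec (Z.gcd b (zprod t)) 1) as [|ne]; [lra|].
    destruct (excluded_middle_informative (exists p, In p t /\ (p | b)%Z)) as [(p & Hp & Hd)|No].
    + pose proof (rsum_pick (fun p => if Z.eqb (b mod p) 0 then 1 else 0) t p Hp P0) as X. cbv beta in X.
      replace (b mod p)%Z with 0%Z in X; [simpl in X; lra|].
      symmetry. apply Z.mod_divide; auto. pose proof (prime_ge_2 p (proj1 (H p Hp))). lia.
    + exfalso. apply ne. rewrite Z.gcd_comm. apply zprod_coprime; [intros p Hp; apply H; auto|].
      intros p Hp Hd. apply No. eauto.
Qed.

Lemma bernoulli h n : 0 <= h <= 1 -> 1 - INR n * h <= (1 - h) ^ n.
Proof.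
  intros Hh. induction n as [|n IH]; [simpl; lra|]. rewrite S_INR. cbn [pow].
  assert (0 <= INR n) by apply pos_INR.
  assert (0 <= (1 - h) ^ n) by (apply pow_le; lra).
  assert (INR n * h * h >= 0) by (apply Rle_ge; repeat apply Rmult_le_pos; lra). nra.
Qed.

(** The upper bound is Bernoulli's inequality (1 - 1/(2d))^d >= 1/2. It shows that the range of m is
    not too short: its relative length is at least 1/(2d). *)
Lemma root2_bounds d : (1 <= d)%nat ->
  / 2 <= Rpower 2 (- (1 / INR d)) <= 1 - 1 / (2 * INR d).
Proof.
  intros Hd. apply le_INR in Hd. change (INR 1) with 1 in Hd. set (D := INR d) in *.
  unfold Rpower. assert (l2 : 0 < ln 2) by (pose proof ln2_lb; lra).
  assert (i1 : 0 < / D <= 1).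
  { split; [apply Rinv_0_lt_compat; lra|]. rewrite <- Rinv_1. apply Rinv_le_contravar; lra. }
  split.
  - rewrite <- (exp_ln 2) at 1 by lra. rewrite <- exp_Ropp. apply exp_le_mono. unfold Rdiv. nra.
  - assert (H : 1 / 2 <= (1 - 1 / (2 * D)) ^ d).
    { eapply Rle_trans; [|apply bernoulli].
      - fold D. right. field. lra.
      - replace (1 / (2 * D)) with (/ 2 * / D) by (field; lra). nra. }
    assert (P : 0 < 1 - 1 / (2 * D)) by (replace (1 / (2 * D)) with (/ 2 * / D) by (field; lra); nra).
    rewrite <- (exp_ln (1 - 1 / (2 * D))) by auto. apply exp_le_mono.
    apply ln_le_mono in H; [|lra]. rewrite ln_pow in H by auto. fold D in H.
    replace (1 / 2) with (/ 2) in H by lra. rewrite ln_Rinv in H by lra.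
    apply Rmult_le_reg_l with D; [lra|]. replace (D * (- (1 / D) * ln 2)) with (- ln 2) by (field; lra). lra.
Qed.

Lemma NoDup_map_filter {A B : Type} (f : A -> B) (p : A -> bool) l : NoDup (map f l) -> NoDup (map f (filter p l)).
Proof.
  induction l as [|x l IH]; simpl; intros H; auto. inversion H; subst.
  destruct (p x); simpl; auto. constructor; auto.
  intros Hx. apply H2. apply in_map_iff in Hx. destruct Hx as (y & <- & Hy). apply filter_In in Hy.
  apply in_map. tauto.
Qed.

Fixpoint largest (P : nat -> Prop) (k : nat) : nat :=
  match k with
  | O => O
  | S k' => if excluded_middle_informative (P (S k')) then S k' else largest P k'
  end.

Lemma largest_spec (P : nat -> Prop) k j : (j <= k)%nat -> P j -> (j <= largest P k)%nat /\ P (largest P k).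
Proof.
  induction k as [|k IH]; simpl; intros Hj Hp.
  - assert (j = 0)%nat by lia. subst. auto.
  - destruct (excluded_middle_informative (P (S k))) as [h|h]; [split; auto|].
    apply IH; auto. assert (j <> S k) by (intros ->; auto). lia.
Qed.

(** At n, take eta = 1/(k + 1) with k <= n the largest index for which the property holds at n.
    Every fixed k is admissible eventually, so eta tends to 0; the case k = 0 provides the threshold
    from which some index is admissible. *)
Lemma diagonal (P : R -> nat -> Prop) :
  (forall eta, 0 < eta -> exists N, forall n, (N <= n)%nat -> P eta n) ->
  exists e, tends_to_zero e /\ exists N, forall n, (N <= n)%nat -> P (e n) n.
Proof.
  intros H.
  assert (Hk : forall k, 0 < / INR (S k)) by (intros; apply Rinv_0_lt_compat, lt_0_INR; lia).
  exists (fun n => / INR (S (largest (fun k => P (/ INR (S k)) n) n))). split.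
  - intros eps Heps.
    destruct (archimed_cor1 eps Heps) as (k & Hk1 & Hk2).
    destruct (H _ (Hk k)) as [N HN]. exists (Nat.max N k). intros n Hn.
    destruct (largest_spec (fun k => P (/ INR (S k)) n) n k ltac:(lia) (HN n ltac:(lia))) as [h _].
    rewrite Rabs_right by (left; apply Hk). eapply Rle_lt_trans; [|apply Hk1].
    apply Rinv_le_contravar; [apply lt_0_INR; lia|apply le_INR; lia].
  - destruct (H _ (Hk 0%nat)) as [N HN]. exists N. intros n Hn.
    apply (largest_spec (fun k => P (/ INR (S k)) n) n 0%nat); [lia|apply HN; auto].
Qed.


(** * Families of prescribed size and the choice of a window *)

Lemma ln2_ub : ln 2 <= 1.
Proof.
  apply Rle_trans with (ln (exp 1)); [|rewrite ln_exp; lra].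
  apply ln_le_mono; [lra|]. pose proof (exp_ineq1 1 ltac:(lra)). lra.
Qed.

Lemma ln16_ub : ln 16 <= 4.
Proof.
  replace 16 with (2 * (2 * (2 * 2))) by lra. rewrite !ln_mult by lra. pose proof ln2_ub. lra.
Qed.

(** The logarithms of the k grid points are centred at T/k, so their product is exactly exp T. With
    k the quotient T/(theta y) rounded up, T/k falls short of theta y by at most eps y/2, and the
    whole spread k ln 16 is at most eps y/2 too. *)
Lemma grid_family (theta eps y T : R) : 0 < theta <= 1 -> 0 < eps -> 0 < y ->
  2 <= eps * (T / (theta * y)) -> 8 * (T / (theta * y) + 1) <= eps * y ->
  exists tau k, T / (theta * y) <= INR k < T / (theta * y) + 1 /\
    prodR (grid tau k) = exp T /\
    forall z, In z (grid tau k) -> exp ((theta - eps) * y) * 16 <= z <= exp ((theta + eps) * y).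
Proof.
  intros Hth Heps Hy H1 H2. set (r := T / (theta * y)) in *.
  destruct (zceil_spec r) as [c1 c2]. set (k := Z.to_nat (zceil r)).
  assert (Ek : INR k = IZR (zceil r)).
  { unfold k. rewrite INR_IZR_INZ, Z2Nat.id; auto. apply le_IZR. nra. }
  assert (r0 : 0 < r) by nra.
  assert (k0 : 0 < INR k) by lra.
  exists (T / INR k + (INR k - 1) / 2 * ln 16), k.
  split; [rewrite Ek; lra|]. split.
  - rewrite prodR_grid. f_equal. field. lra.
  - intros z Hz. apply grid_bounds in Hz.
    set (tau := T / INR k + (INR k - 1) / 2 * ln 16) in *.
    pose proof ln16_pos. pose proof ln16_ub.
    assert (ty : 0 < theta * y) by nra.
    assert (ET : T = r * (theta * y)) by (unfold r; field; lra).
    assert (k1 : 1 <= INR k).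
    { rewrite Ek. apply IZR_le. assert (0 < zceil r)%Z; [|lia]. apply lt_IZR. lra. }
    assert (kl : INR k * ln 16 <= eps * y / 2).
    { assert (INR k * ln 16 <= (r + 1) * 4) by (apply Rmult_le_compat; lra). lra. }
    assert (u1 : T / INR k <= theta * y).
    { apply Rmult_le_reg_r with (INR k); auto. unfold Rdiv. rewrite Rmult_assoc, Rinv_l, Rmult_1_r by lra.
      rewrite ET, Rmult_comm. apply Rmult_le_compat_l; lra. }
    assert (u2 : theta * y - eps * y / 2 <= T / INR k).
    { apply Rmult_le_reg_r with (INR k); auto. unfold Rdiv at 2. rewrite Rmult_assoc, Rinv_l, Rmult_1_r by lra.
      rewrite ET.
      assert (2 <= eps * INR k) by nra.
      assert (theta * y * INR k - theta * y <= r * (theta * y)) by nra.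
      assert (theta * y <= y) by nra.
      assert (y <= eps * y / 2 * INR k) by nra. nra. }
    assert (e1 : tau <= (theta + eps) * y) by (unfold tau; nra).
    assert (e2 : (theta - eps) * y <= tau - INR k * ln 16) by (unfold tau; nra).
    apply exp_le_mono in e1, e2. lra.
Qed.

(** In this range ln z <= beta x, which makes the density bound uniform, and ln n <= x^3 makes the
    prime divisors of n negligible in each bin. *)
Lemma bin_large (n : Z) (x beta lam z : R) : (0 < n)%Z -> 0 < beta -> 1 <= x ->
  10 ^ 8 <= exp (beta * x / 2) -> 32 * beta * x ^ 4 <= exp (beta * x / 2) ->
  ln (IZR n) <= x ^ 3 -> exp (beta * x / 2) <= z <= exp (beta * x) ->
  z / (16 * beta * x) <= INR (length (bin n z)).
Proof.
  intros Hn Hb Hx E1 E2 Hl [Hz1 Hz2].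
  assert (z0 : 0 < z) by (pose proof (exp_pos (beta * x / 2)); lra).
  assert (z1 : 1 < z) by (simpl in E1; lra).
  assert (lz0 : 0 < ln z) by (rewrite <- ln_1; apply ln_increasing; lra).
  assert (lz : ln z <= beta * x) by (rewrite <- (ln_exp (beta * x)); apply ln_le_mono; auto).
  assert (Hle : z / (16 * beta * x) <= z / (16 * ln z)).
  { apply Rmult_le_compat_l; [lra|]. apply Rinv_le_contravar; nra. }
  eapply Rle_trans; [apply Hle|]. apply bin_card; auto; [lra|].
  eapply Rle_trans; [|apply Hle]. apply Rle_trans with (2 * x ^ 3); [lra|].
  assert (bx : 0 < 16 * beta * x) by nra.
  apply Rmult_le_reg_r with (16 * beta * x); auto.
  replace (z / (16 * beta * x) * (16 * beta * x)) with z by (field; lra).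
  replace (2 * x ^ 3 * (16 * beta * x)) with (32 * beta * x ^ 4) by ring. lra.
Qed.

Lemma choose_ln_bounds (n : Z) zs t : (forall z, In z zs -> 0 < z) -> In t (choose (bin n) zs) ->
  0 < IZR (zprod t) /\
  ln (prodR zs) - INR (length zs) * ln 16 <= ln (IZR (zprod t)) <= ln (prodR zs).
Proof.
  intros Hz Ht. apply in_choose in Ht.
  assert (P : 0 < prodR zs).
  { clear Ht. induction zs as [|z zs IH]; simpl; [lra|]. apply Rmult_lt_0_compat; [apply Hz; left; auto|].
    apply IH; intros; apply Hz; right; auto. }
  revert P. induction Ht as [|p z t zs Hp Ht IH]; intros P.
  - simpl. rewrite ln_1. split; [lra|]. simpl. lra.
  - assert (z0 : 0 < z) by (apply Hz; left; auto).
    cbn [prodR fold_right] in P. fold (prodR zs) in P.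
    assert (P' : 0 < prodR zs) by nra.
    destruct IH as (q0 & q1 & q2); [intros; apply Hz; right; auto|auto|].
    apply in_bin in Hp. destruct Hp as (_ & Hp & _).
    assert (p0 : 0 < IZR p) by lra.
    cbn [zprod fold_right prodR length]. fold (zprod t). fold (prodR zs).
    rewrite mult_IZR, !ln_mult, S_INR by auto.
    assert (l1 : ln (IZR p) <= ln z) by (apply ln_le_mono; lra).
    assert (l2 : ln z - ln 16 <= ln (IZR p)).
    { replace (ln z - ln 16) with (ln (z / 16)); [apply ln_le_mono; lra|].
      unfold Rdiv. rewrite ln_mult, ln_Rinv by lra. lra. }
    split; [apply Rmult_lt_0_compat; auto|]. lra.
Qed.

(** The products spread over a factor of at most 16^k, that is, over fewer than 6k windows of ratio
    e. Fixing the popular one lets a single S, sized by w, serve all q. *)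
Lemma popular_window (n : Z) zs : (forall z, In z zs -> 0 < z) -> (1 <= length zs)%nat ->
  0 < cprod (bin n) zs ->
  exists w : Z, ln (prodR zs) - 4 * INR (length zs) - 1 <= IZR w <= ln (prodR zs) /\
   cprod (bin n) zs <= 6 * INR (length zs) *
     INR (length (filter (fun t => Z.eqb (zfloor (ln (IZR (zprod t)))) w) (choose (bin n) zs))).
Proof.
  intros Hz Hl Hc. set (k := INR (length zs)). assert (k1 : 1 <= k) by (apply (le_INR 1); auto).
  pose proof ln16_ub. pose proof ln16_pos. rewrite <- (length_choose (bin n)) in *.
  set (f := fun t => zfloor (ln (IZR (zprod t)))).
  set (lo := zfloor (ln (prodR zs) - k * ln 16)). set (hi := zfloor (ln (prodR zs))).
  destruct (zfloor_spec (ln (prodR zs) - k * ln 16)) as [a1 a2]. fold lo in a1, a2.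
  destruct (zfloor_spec (ln (prodR zs))) as [b1 b2]. fold hi in b1, b2.
  assert (B : forall t, In t (choose (bin n) zs) -> (lo <= f t <= hi)%Z).
  { intros t Ht. destruct (choose_ln_bounds n zs t Hz Ht) as (_ & h1 & h2). fold k in h1.
    destruct (zfloor_spec (ln (IZR (zprod t)))) as [c1 c2]. fold (f t) in c1, c2. split.
    - assert (lo < f t + 1)%Z; [|lia]. apply lt_IZR. rewrite plus_IZR. lra.
    - assert (f t < hi + 1)%Z; [|lia]. apply lt_IZR. rewrite plus_IZR. lra. }
  assert (Hne : choose (bin n) zs <> []) by (intros e; rewrite e in Hc; simpl in Hc; lra).
  destruct (pigeonhole (choose (bin n) zs) f lo hi B Hne) as (t & Ht & Hcard).
  exists (f t). split.
  - destruct (choose_ln_bounds n zs t Hz Ht) as (_ & h1 & h2). fold k in h1.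
    destruct (zfloor_spec (ln (IZR (zprod t)))) as [c1 c2]. fold (f t) in c1, c2. nra.
  - eapply Rle_trans; [apply Hcard|]. apply Rmult_le_compat_r; [apply pos_INR|].
    rewrite plus_IZR, minus_IZR. nra.
Qed.

(** Markov's inequality: the excess over |S|^2 is nonnegative for every t, so its average over all
    choices limits the number of t with excess above |S|^2 / 2, also within the subset W. *)
Lemma good_in_window (bn : R -> list Z) zsQ (S : list Z) (th : R) (W : list (list Z)) :
  good_bins bn zsQ -> nonempty_bins bn zsQ -> 0 <= th -> 0 < INR (length S) ->
  (forall l, In l (sel zsQ) -> l <> [] -> / cprod bn l * rsum (energy S) (pset bn l) <= th * INR (length S) ^ 2) ->
  forall p : list Z -> bool, W = filter p (choose bn zsQ) ->
  let good := filter (fun t => decideP (rsum (energy S) (subprods t) <= 3 / 2 * INR (length S) ^ 2)) W in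
  INR (length W) - 2 * 2 ^ length zsQ * th * cprod bn zsQ <= INR (length good).
Proof.
  intros Hg Hne Hth HS Hav p HW good.
  set (L := INR (length S)) in *.
  set (isg := fun t => decideP (rsum (energy S) (subprods t) <= 3 / 2 * L ^ 2)).
  pose proof (excess_average bn S zsQ th Hne Hth Hav) as HE. fold L in HE.
  assert (pos : forall t, In t (choose bn zsQ) -> 0 <= rsum (energy S) (subprods t) - L ^ 2).
  { intros t _. pose proof (subprods_energy_lower S t) as H. fold L in H. lra. }
  assert (HL : 0 < L ^ 2) by (apply pow_lt; auto).
  assert (X : rsum (fun t => if isg t then 0 else / 2 * L ^ 2) W <= cprod bn zsQ * (2 ^ length zsQ * th * L ^ 2)).
  { eapply Rle_trans; [|apply HE]. rewrite HW, rsum_filter. apply rsum_le. intros t Ht. specialize (pos t Ht).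
    destruct (p t); auto. unfold isg, decideP. destruct (excluded_middle_informative _) as [h|h]; auto.
    apply Rnot_le_lt in h. lra. }
  assert (Y : rsum (fun t => if isg t then 0 else / 2 * L ^ 2) W = (INR (length W) - INR (length good)) * (/ 2 * L ^ 2)).
  { unfold good. fold isg. rewrite length_filter_rsum, <- (Rmult_1_r (INR (length W))), <- rsum_const.
    unfold Rminus. rewrite Rmult_plus_distr_r, <- rsum_scal_r, Ropp_mult_distr_l_reverse, <- rsum_scal_r.
    rewrite <- (Rmult_1_l (rsum (fun x => (if isg x then 1 else 0) * _) W)), <- Ropp_mult_distr_l_reverse, <- rsum_scal, <- rsum_plus.
    apply rsum_ext_in. intros t _. destruct (isg t); lra. }
  rewrite Y in X.
  assert (Z0 : (INR (length W) - INR (length good)) * (/ 2 * L ^ 2) <= (2 * 2 ^ length zsQ * th * cprod bn zsQ) * (/ 2 * L ^ 2)).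
  { eapply Rle_trans; [apply X|]. right. field. }
  apply Rmult_le_reg_r in Z0; [lra|]. lra.
Qed.


Lemma div_le_iff a b c : 0 < b -> a <= c * b -> a / b <= c.
Proof.
  intros Hb H. apply Rmult_le_reg_r with b; auto. unfold Rdiv. rewrite Rmult_assoc, Rinv_l by lra. lra.
Qed.

Lemma le_div_iff a b c : 0 < b -> c * b <= a -> c <= a / b.
Proof.
  intros Hb H. apply Rmult_le_reg_r with b; auto. unfold Rdiv. rewrite Rmult_assoc, Rinv_l by lra. lra.
Qed.

(** For these b the quotient q/b falls in the range of m with a margin of 1 at both ends; the margin
    is available because L/(8D) >= 2. *)
Lemma b_range (L D q b : R) : 1 <= D -> 16 * D <= L -> 0 < q ->
  q / L * (1 + 1 / (8 * D)) <= b <= q / L * (1 + 1 / (4 * D)) ->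
  b * ((1 - 1 / (2 * D)) * L + 1) <= q <= b * (L - 1) /\ b * L <= 5 / 4 * q /\ q / L <= b.
Proof.
  intros HD HL Hq. set (X := q / L). assert (L0 : 0 < L) by lra.
  assert (X0 : 0 < X) by (apply Rdiv_lt_0_compat; lra).
  assert (EX : q = X * L) by (unfold X; field; lra).
  set (s := / (8 * D)). assert (s0 : 0 < s) by (apply Rinv_0_lt_compat; lra).
  assert (s1 : s <= / 8). { apply Rinv_le_contravar; lra. }
  replace (1 / (8 * D)) with s by (unfold s; field; lra).
  replace (1 / (4 * D)) with (2 * s) by (unfold s; field; lra).
  replace (1 / (2 * D)) with (4 * s) by (unfold s; field; lra).
  assert (sL : 2 <= s * L).
  { replace 2 with (s * (16 * D)) by (unfold s; field; lra). apply Rmult_le_compat_l; lra. }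
  intros [b1 b2]. rewrite EX.
  assert (b0 : 0 < b) by nra.
  assert (t1 : (1 + 2 * s) * ((1 - 4 * s) * L + 1) <= L).
  { replace ((1 + 2 * s) * ((1 - 4 * s) * L + 1)) with (L - 2 * (s * L) - 8 * s * (s * L) + 1 + 2 * s) by ring. nra. }
  assert (t2 : L <= (1 + s) * (L - 1)).
  { replace ((1 + s) * (L - 1)) with (L + s * L - 1 - s) by ring. lra. }
  assert (t3 : 0 <= (1 - 4 * s) * L + 1) by nra.
  repeat split.
  - apply Rle_trans with (X * (1 + 2 * s) * ((1 - 4 * s) * L + 1)); [apply Rmult_le_compat_r; auto|].
    rewrite Rmult_assoc. apply Rmult_le_compat_l; lra.
  - apply Rle_trans with (X * (1 + s) * (L - 1)); [|apply Rmult_le_compat_r; lra].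
    rewrite Rmult_assoc. apply Rmult_le_compat_l; lra.
  - nra.
  - nra.
Qed.

Lemma Mset_bounds n d delta m : (1 <= d)%nat ->
  In m (Mset n d delta) ->
  Lfun (INR n) (2/3) (/ delta) / 2 <= IZR m <= Lfun (INR n) (2/3) (/ delta) /\
  Rpower 2 (- (1 / INR d)) * Lfun (INR n) (2/3) (/ delta) <= IZR m.
Proof.
  intros Hd H. unfold Mset in H. set (L := Lfun (INR n) (2/3) (/ delta)) in *.
  assert (L0 : 0 < L) by apply exp_pos.
  apply in_zrange in H. destruct H as [h1 h2]. apply IZR_le in h1, h2.
  destruct (zceil_spec (Rpower 2 (- (1 / INR d)) * L)). destruct (zfloor_spec L).
  destruct (root2_bounds d Hd) as [r1 _].
  assert (/ 2 * L <= Rpower 2 (- (1 / INR d)) * L) by (apply Rmult_le_compat_r; lra). split; lra.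
Qed.

Lemma root2_pow d (L : R) : (1 <= d)%nat -> 0 < L ->
  (Rpower 2 (- (1 / INR d)) * L) ^ d = L ^ d / 2.
Proof.
  intros Hd HL. apply le_INR in Hd. change (INR 1) with 1 in Hd.
  rewrite Rpow_mult_distr. unfold Rpower at 1. rewrite exp_pow_nat.
  replace (INR d * (- (1 / INR d) * ln 2)) with (- ln 2) by (field; lra).
  rewrite exp_Ropp, exp_ln by lra. field.
Qed.

Lemma Mset_length n d delta : (1 <= d)%nat -> 16 * INR d <= Lfun (INR n) (2/3) (/ delta) ->
  0 < INR (length (Mset n d delta)) <= Lfun (INR n) (2/3) (/ delta).
Proof.
  intros Hd HL. unfold Mset. set (L := Lfun (INR n) (2/3) (/ delta)) in *. rewrite length_zrange.
  destruct (zceil_spec (Rpower 2 (- (1 / INR d)) * L)) as [a1 a2]. destruct (zfloor_spec L) as [b1 b2].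
  destruct (root2_bounds d Hd) as [r1 r2].
  assert (Hd' : 1 <= INR d) by (apply (le_INR 1); auto).
  assert (h1 : / 2 * L <= Rpower 2 (- (1 / INR d)) * L) by (apply Rmult_le_compat_r; lra).
  assert (h2 : Rpower 2 (- (1 / INR d)) * L <= L - 8).
  { apply Rle_trans with ((1 - 1 / (2 * INR d)) * L); [apply Rmult_le_compat_r; lra|].
    assert (8 <= 1 / (2 * INR d) * L); [|lra].
    replace 8 with (1 / (2 * INR d) * (16 * INR d)) by (field; lra).
    apply Rmult_le_compat_l; [|lra]. left. apply Rdiv_lt_0_compat; lra. }
  set (u := zceil (Rpower 2 (- (1 / INR d)) * L)) in *. set (v := zfloor L) in *.
  assert (huv : (u < v)%Z) by (apply lt_IZR; lra).
  rewrite INR_IZR_INZ, Z2Nat.id by lia. rewrite plus_IZR, minus_IZR. apply IZR_lt in huv. lra.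
Qed.

Lemma Icent_length C : 1 <= C -> 0 < INR (length (Icent (2 * C))) <= 3 * C.
Proof.
  intros HC. split.
  - assert (H : In 0%Z (Icent (2 * C))) by (apply in_Icent; lra).
    destruct (Icent (2 * C)); [destruct H|]. apply lt_0_INR. simpl. lia.
  - unfold Icent. replace (2 * C / 2) with C by field. rewrite length_zrange.
    destruct (zceil_spec C) as [a1 a2]. destruct (zceil_spec (- C)) as [b1 b2].
    assert (h1 : (1 <= zceil C)%Z) by (apply le_IZR; lra).
    assert (h2 : (zceil (- C) <= 0)%Z) by (assert (zceil (- C) < 1)%Z; [apply lt_IZR; lra|lia]).
    rewrite INR_IZR_INZ, Z2Nat.id by lia. rewrite plus_IZR, !minus_IZR. lra.
Qed.


(** * The construction for given large parameters *)

Lemma ln_small_ub : ln 8 <= 3 /\ ln 6 <= 3 /\ ln 32 <= 5 /\ ln 3 <= 2 /\ 0 <= ln 8 /\ 0 <= ln 6 /\ 0 <= ln 3 /\ 0 <= ln 32.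
Proof.
  pose proof ln2_ub.
  assert (L8 : ln 8 = 3 * ln 2) by (replace 8 with (2 * (2 * 2)) by lra; rewrite !ln_mult by lra; lra).
  assert (L32 : ln 32 = 5 * ln 2) by (replace 32 with (2 * (2 * (2 * (2 * 2)))) by lra; rewrite !ln_mult by lra; lra).
  assert (L4 : ln 4 = 2 * ln 2) by (replace 4 with (2 * 2) by lra; rewrite !ln_mult by lra; lra).
  assert (ln 6 <= ln 8) by (apply ln_le_mono; lra).
  assert (ln 3 <= ln 4) by (apply ln_le_mono; lra).
  assert (P : forall t, 1 <= t -> 0 <= ln t) by (intros; rewrite <- ln_1; apply ln_le_mono; lra).
  repeat split; try lra; apply P; lra.
Qed.

Lemma exp_sub a b : exp (a - b) = exp a / exp b.
Proof. unfold Rminus. rewrite exp_plus, exp_Ropp. reflexivity. Qed.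

(* With U = (ln n / ln ln n)^(1/3) and x = U ln ln n, L_n(1/3, c) is exp (c x) and
   L_n(2/3, c) is exp (c U x).  1/G bounds from below the density of the primes in a bin.
   exp lnQ is the largest modulus q considered; for q in [e^w, e^(w+1)) the values b are of
   order exp (lb w), and the products s s' of two elements of S are at most exp (2 TS w),
   one eighth of C L b^d.  The primes of q have size exp ((1 - 2 eps) beta x), those of s
   have size exp ((1 - 5 eps) beta x), up to a factor exp (eps beta x). *)
Section LargeParameters.
Variables (delta kappa sigma beta eps c1 c2 c3 U x : R) (j0 jP n d' : nat).
Let A := / delta.
Let G := 16 * beta * x.
Let D := INR (S d').
(** c1 U and c3 U bound the numbers of bins of q and of S, and U ln G <= x turns the resulting
    density losses into exp((c1 + c3) x). A product of more than j0 primes, each at least exp(beta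
    x/2), exceeds this by a further exp(beta x). jP = 2 j0 + 1 bins of S exceed the square of a
    divisor with j0 primes in the sense that exp(beta x)^j0 / exp(beta x/2)^jP = exp(-beta x/2). The
    conditions named g hold once U and V are large. *)
Hypotheses (Hdelta : 0 < delta) (Hsigma : 0 < sigma) (Hbeta : 0 < beta) (Heps : 0 < eps <= 1 / 12)
  (Hkappa : A < kappa) (HAk : A < (sigma * delta + kappa) / 2)
  (Hc1 : (A + sigma) / ((1 - 2 * eps) * beta) + 1 <= c1)
  (Hc2 : 4 * c1 + 4 <= c2)
  (Hc3 : (kappa + (delta + 1) * sigma) / (2 * (1 - 5 * eps) * beta) + 1 <= c3)
  (Hj0 : c1 + c3 + beta <= INR (S j0) * beta / 2)
  (HjP : jP = (2 * j0 + 1)%nat)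
  (g0 : 1 <= U <= x)
  (g1 : 8 * c1 * U <= eps * beta * x) (g1' : 8 * c3 * U <= eps * beta * x)
  (g2 : 2 * beta <= eps * A * U) (g2' : INR jP * beta <= A * U)
  (g3 : 3 <= sigma * x) (g3' : 2 * c2 * U <= sigma * x)
  (g4 : delta * c2 * (U * U) <= (kappa + sigma * delta - 2 * A) / 2 * (U * x))
  (g4' : 3 * sigma + 3 + 2 * (c1 + c3 + beta) <= (kappa + sigma * delta - 2 * A) / 2 * U)
  (g5 : 10 ^ 8 <= exp (beta * x / 2)) (g5' : 32 * beta * x ^ 4 <= exp (beta * x / 2))
  (g6 : 1 <= G) (g6' : U * ln G <= x)
  (g7 : G ^ (j0 + jP) * ((4 + 8 * (1 + 2 * (A + sigma))) * x ^ 2) <= exp (beta * x / 4))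
  (g8 : c1 * U <= beta * x / 8) (g8' : 24 * c1 * x <= exp (beta * x / 8))
  (g9 : 4 * c1 * x <= exp (beta * x / 2))
  (g9' : 64 * (delta + 1) * (1 + c1) * x ^ 2 <= exp (sigma * x / 2))
  (g10 : 16 * (delta + 1) * x <= exp (A * x)) (g10' : 8 * (delta + 3) * x <= exp ((kappa - A) * x))
  (g10'' : sigma + 5 <= (kappa - A) * U)
  (Hn : ln (INR n) = U * U * x)
  (HL1 : forall c, Lfun (INR n) (1 / 3) c = exp (c * x))
  (HL2 : forall c, Lfun (INR n) (2 / 3) c = exp (c * (U * x)))
  (HD : Rabs (D - delta * U) <= 1).

(** The largest q is L H / 8 with L = exp(A U x), H = exp(sigma x). As b <= (5/4) q/L, this keeps b
    below H/2. *)
Let lnQ := A * (U * x) + sigma * x - ln 8.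
Let lb (w : Z) := IZR w - A * (U * x).
Let TS (w : Z) := (kappa * (U * x) + D * lb w - ln 8) / 2.

Lemma A_pos : 0 < A. Proof. apply Rinv_0_lt_compat, Hdelta. Qed.

Lemma D_bounds : 1 <= D /\ delta * U - 1 <= D <= (delta + 1) * U.
Proof.
  assert (1 <= D) by (unfold D; rewrite S_INR; pose proof (pos_INR d'); lra).
  apply Rabs_le_bounds in HD. split; [lra|]. nra.
Qed.

Lemma c_pos : 1 <= c1 /\ 1 <= c3.
Proof.
  pose proof A_pos.
  assert (0 < (A + sigma) / ((1 - 2 * eps) * beta)) by (apply Rdiv_lt_0_compat; [lra|apply Rmult_lt_0_compat; lra]).
  assert (0 < (kappa + (delta + 1) * sigma) / (2 * (1 - 5 * eps) * beta)).
  { apply Rdiv_lt_0_compat; [nra|apply Rmult_lt_0_compat; lra]. }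
  lra.
Qed.

Lemma Q_family : exists tau k, prodR (grid tau k) = exp lnQ /\
  (1 <= k)%nat /\ INR k <= c1 * U /\ INR k <= (A * U + sigma) / ((1 - 2 * eps) * beta) + 1 /\
  forall z, In z (grid tau k) -> exp ((1 - 3 * eps) * (beta * x)) * 16 <= z <= exp ((1 - eps) * (beta * x)).
Proof.
  pose proof A_pos. pose proof c_pos. destruct ln_small_ub as (l8 & _ & _ & _ & l8' & _).
  assert (tb : 0 < (1 - 2 * eps) * beta) by (apply Rmult_lt_0_compat; lra).
  assert (x1 : 1 <= x) by lra.
  set (r := lnQ / ((1 - 2 * eps) * (beta * x))).
  assert (tbx : 0 < (1 - 2 * eps) * (beta * x)) by (rewrite <- Rmult_assoc; apply Rmult_lt_0_compat; lra).
  assert (r1 : r <= (A * U + sigma) / ((1 - 2 * eps) * beta)).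
  { unfold r. apply div_le_iff; auto.
    replace ((A * U + sigma) / ((1 - 2 * eps) * beta) * ((1 - 2 * eps) * (beta * x))) with ((A * U + sigma) * x) by (field; lra).
    unfold lnQ. lra. }
  assert (r2 : (A * U + sigma) / ((1 - 2 * eps) * beta) <= (c1 - 1) * U).
  { apply Rle_trans with ((A + sigma) / ((1 - 2 * eps) * beta) * U).
    - replace ((A + sigma) / ((1 - 2 * eps) * beta) * U) with ((A + sigma) * U / ((1 - 2 * eps) * beta)) by (field; lra).
      apply Rmult_le_compat_r; [left; apply Rinv_0_lt_compat; auto|nra].
    - apply Rmult_le_compat_r; lra. }
  assert (r3 : A * U / beta <= r).
  { unfold r. apply le_div_iff; auto.
    replace (A * U / beta * ((1 - 2 * eps) * (beta * x))) with (A * (U * x) * (1 - 2 * eps)) by (field; lra).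
    assert (a0 : 0 <= A * (U * x)) by (apply Rmult_le_pos; [lra|apply Rmult_le_pos; lra]).
    pose proof (Rmult_le_pos eps _ ltac:(lra) a0). unfold lnQ. lra. }
  assert (r4 : 2 / eps <= A * U / beta).
  { apply le_div_iff; auto. apply Rmult_le_reg_l with eps; [lra|].
    replace (eps * (2 / eps * beta)) with (2 * beta) by (field; lra). lra. }
  destruct (grid_family (1 - 2 * eps) eps (beta * x) lnQ) as (tau & k & k1 & k2 & k3).
  - lra.
  - lra.
  - apply Rmult_lt_0_compat; lra.
  - fold r. apply Rmult_le_reg_l with (/ eps); [apply Rinv_0_lt_compat; lra|].
    rewrite <- Rmult_assoc, Rinv_l, Rmult_1_l by lra. unfold Rdiv in r4. lra.
  - fold r. lra.
  - exists tau, k. fold r in k1. split; [auto|]. split; [|split; [|split]].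
    + apply INR_le. change (INR 1) with 1. assert (24 <= 2 / eps).
      { apply le_div_iff; lra. } lra.
    + lra.
    + lra.
    + intros z Hz. specialize (k3 z Hz).
      replace (1 - 3 * eps) with (1 - 2 * eps - eps) by ring. replace (1 - eps) with (1 - 2 * eps + eps) by ring. auto.
Qed.

(** The window lies below lnQ by at most the spread of the products, 4k + 1, which c2 U absorbs. *)
Lemma lb_bounds w k : INR k <= c1 * U -> lnQ - 4 * INR k - 1 <= IZR w <= lnQ ->
  sigma * x - c2 * U <= lb w <= sigma * x - ln 8.
Proof.
  intros Hk Hw. destruct ln_small_ub as (l8 & _). unfold lb. unfold lnQ in Hw.
  assert (4 * c1 * U + 4 * U <= c2 * U) by nra. split; lra.
Qed.

(** The place where 1/delta < (sigma delta + kappa)/2 is used: it makes the leading term of TS - lnQ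
    a positive multiple of U x, which outgrows all terms of order x and U^2. Thus the products of S
    range beyond q by the factor exp((c1 + c3 + beta) x) that the sieve needs. *)
Lemma TS_bounds w : sigma * x - c2 * U <= lb w <= sigma * x - ln 8 ->
  lnQ + (c1 + c3 + beta) * x <= TS w /\ TS w <= (kappa * (U * x) + (delta * U + 1) * sigma * x) / 2.
Proof.
  intros [h1 h2]. destruct ln_small_ub as (l8 & _ & _ & _ & l8' & _).
  destruct D_bounds as (D1 & D2 & D3). pose proof c_pos. pose proof A_pos.
  apply Rabs_le_bounds in HD.
  assert (lb0 : 0 <= lb w) by nra. 
  unfold TS. split.
  - assert (hD : (delta * U - 1) * (sigma * x - c2 * U) <= D * lb w).
    { apply Rle_trans with (D * (sigma * x - c2 * U)).
      - apply Rmult_le_compat_r; nra.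
      - apply Rmult_le_compat_l; lra. }
    set (e0 := (kappa + sigma * delta - 2 * A) / 2) in *.
    assert (k0 : (3 * sigma + 3 + 2 * (c1 + c3 + beta)) * x <= e0 * U * x) by (apply Rmult_le_compat_r; lra).
    assert (EE : kappa * (U * x) + (delta * U - 1) * (sigma * x - c2 * U) - 2 * (A * (U * x)) =
      2 * (e0 * (U * x)) - delta * c2 * (U * U) - sigma * x + c2 * U) by (unfold e0; field).
    unfold lnQ. assert (0 <= c2 * U) by nra. nra.
  - assert (hD : D * lb w <= (delta * U + 1) * (sigma * x)).
    { apply Rmult_le_compat; lra. }
    lra.
Qed.

Lemma S_family w : sigma * x - c2 * U <= lb w <= sigma * x - ln 8 ->
  exists tau k, prodR (grid tau k) = exp (TS w) /\
  (jP <= k)%nat /\ INR k <= c3 * U /\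
  2 * INR k <= (kappa * U + delta * U * sigma + sigma) / ((1 - 5 * eps) * beta) + 2 /\
  forall z, In z (grid tau k) -> exp ((1 - 6 * eps) * (beta * x)) * 16 <= z <= exp ((1 - 4 * eps) * (beta * x)).
Proof.
  intros Hw. destruct (TS_bounds w Hw) as [T1 T2].
  pose proof A_pos. pose proof c_pos. destruct ln_small_ub as (l8 & _ & _ & _ & l8' & _).
  assert (tb : 0 < (1 - 5 * eps) * beta) by (apply Rmult_lt_0_compat; lra).
  assert (x1 : 1 <= x) by lra.
  set (T := TS w) in *. set (r := T / ((1 - 5 * eps) * (beta * x))).
  assert (tbx : 0 < (1 - 5 * eps) * (beta * x)) by (rewrite <- Rmult_assoc; apply Rmult_lt_0_compat; lra).
  set (m := (kappa * U + delta * U * sigma + sigma) / (2 * (1 - 5 * eps) * beta)).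
  assert (r1 : r <= m).
  { unfold r. apply div_le_iff; auto.
    replace (m * ((1 - 5 * eps) * (beta * x))) with ((kappa * (U * x) + (delta * U + 1) * sigma * x) / 2) by (unfold m; field; lra).
    lra. }
  assert (r2 : m <= (c3 - 1) * U).
  { apply Rle_trans with ((kappa + (delta + 1) * sigma) / (2 * (1 - 5 * eps) * beta) * U).
    - unfold m. replace ((kappa + (delta + 1) * sigma) / (2 * (1 - 5 * eps) * beta) * U) with
        ((kappa + (delta + 1) * sigma) * U / (2 * (1 - 5 * eps) * beta)) by (field; lra).
      apply Rmult_le_compat_r; [left; apply Rinv_0_lt_compat; lra|nra].
    - apply Rmult_le_compat_r; lra. }
  assert (AT : A * (U * x) <= T).
  { assert (0 <= (c1 + c3 + beta) * x) by (apply Rmult_le_pos; lra). unfold lnQ in T1. lra. }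
  assert (r3 : A * U / beta <= r).
  { unfold r. apply le_div_iff; auto.
    replace (A * U / beta * ((1 - 5 * eps) * (beta * x))) with (A * (U * x) * (1 - 5 * eps)) by (field; lra).
    assert (a0 : 0 <= A * (U * x)) by (apply Rmult_le_pos; [lra|apply Rmult_le_pos; lra]).
    pose proof (Rmult_le_pos eps _ ltac:(lra) a0). lra. }
  assert (r4 : 2 / eps <= A * U / beta).
  { apply le_div_iff; auto. apply Rmult_le_reg_l with eps; [lra|].
    replace (eps * (2 / eps * beta)) with (2 * beta) by (field; lra). lra. }
  assert (r5 : INR jP <= A * U / beta) by (apply le_div_iff; auto).
  destruct (grid_family (1 - 5 * eps) eps (beta * x) T) as (tau & k & k1 & k2 & k3).
  - lra.
  - lra.
  - apply Rmult_lt_0_compat; lra.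
  - fold r. apply Rmult_le_reg_l with (/ eps); [apply Rinv_0_lt_compat; lra|].
    rewrite <- Rmult_assoc, Rinv_l, Rmult_1_l by lra. unfold Rdiv in r4. lra.
  - fold r. lra.
  - exists tau, k. fold r in k1. split; [auto|]. split; [|split; [|split]].
    + apply INR_le. lra.
    + lra.
    + apply Rle_trans with (2 * m + 2); [lra|]. right. unfold m. field. lra.
    + intros z Hz. specialize (k3 z Hz).
      replace (1 - 6 * eps) with (1 - 5 * eps - eps) by ring. replace (1 - 4 * eps) with (1 - 5 * eps + eps) by ring. auto.
Qed.

Lemma n_pos : (0 < Z.of_nat n)%Z.
Proof.
  (* [ln 0] is 0 by convention, against ln n = U^2 x > 0. *)
  destruct n as [|n']; [|lia]. exfalso. simpl in Hn. unfold ln in Hn.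
  destruct (Rlt_dec 0 0) as [h|h]; [lra|].
  assert (0 < U * U * x) by (repeat apply Rmult_lt_0_compat; lra). lra.
Qed.

Lemma exponent_half c : 1 / 2 <= c -> exp (beta * x / 2) <= exp (c * (beta * x)).
Proof.
  intros Hc. apply exp_le_mono. assert (0 < beta * x) by (apply Rmult_lt_0_compat; lra).
  assert (1 / 2 * (beta * x) <= c * (beta * x)) by (apply Rmult_le_compat_r; lra). lra.
Qed.

Lemma exponent_le_1 c : c <= 1 -> exp (c * (beta * x)) <= exp (beta * x).
Proof.
  intros Hc. apply exp_le_mono. assert (0 < beta * x) by (apply Rmult_lt_0_compat; lra).
  assert (c * (beta * x) <= 1 * (beta * x)) by (apply Rmult_le_compat_r; lra). lra.
Qed.

Lemma families_good tau k tau' k' :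
  (forall z, In z (grid tau k) -> exp ((1 - 3 * eps) * (beta * x)) * 16 <= z <= exp ((1 - eps) * (beta * x))) ->
  (forall z, In z (grid tau' k') -> exp ((1 - 6 * eps) * (beta * x)) * 16 <= z <= exp ((1 - 4 * eps) * (beta * x))) ->
  good_bins (bin (Z.of_nat n)) (grid tau k ++ grid tau' k') /\
  forall z, In z (grid tau k ++ grid tau' k') ->
    exp (beta * x / 2) * 16 <= z <= exp (beta * x) /\ z / G <= INR (length (bin (Z.of_nat n) z)) /\
    forall p, In p (bin (Z.of_nat n) z) -> IZR p <= z.
Proof.
  intros H H'.
  assert (R : forall z, In z (grid tau k ++ grid tau' k') -> exp (beta * x / 2) * 16 <= z <= exp (beta * x)).
  { intros z Hz. apply in_app_iff in Hz. destruct Hz as [Hz|Hz]; [specialize (H z Hz)|specialize (H' z Hz)].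
    - pose proof (exponent_half (1 - 3 * eps) ltac:(lra)). pose proof (exponent_le_1 (1 - eps) ltac:(lra)). lra.
    - pose proof (exponent_half (1 - 6 * eps) ltac:(lra)). pose proof (exponent_le_1 (1 - 4 * eps) ltac:(lra)). lra. }
  split.
  - apply good_bins_two_grids with (mid := exp ((1 - 4 * eps) * (beta * x))).
    + intros z Hz. specialize (H z Hz).
      assert (exp ((1 - 4 * eps) * (beta * x)) <= exp ((1 - 3 * eps) * (beta * x))); [|lra].
      apply exp_le_mono, Rmult_le_compat_r; [apply Rmult_le_pos; lra|lra].
    + intros z Hz. apply H'; auto.
  - intros z Hz. specialize (R z Hz). split; [auto|]. split.
    + apply bin_large; auto; try lra.
      * apply n_pos.
      * rewrite <- INR_IZR_INZ, Hn. replace (x ^ 3) with (x * x * x) by ring.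
        apply Rmult_le_compat_r; [lra|]. apply Rmult_le_compat; lra.
    + intros p Hp. apply in_bin in Hp. lra.
Qed.

Lemma poly_bound : 0 <= 1 + 2 * lnQ /\ 4 + 8 * (1 + 2 * lnQ) <= (4 + 8 * (1 + 2 * (A + sigma))) * x ^ 2.
Proof.
  destruct ln_small_ub as (l8 & _ & _ & _ & l8' & _). pose proof A_pos.
  assert (a0 : 0 <= A * (U * x)) by (apply Rmult_le_pos; [lra|apply Rmult_le_pos; lra]).
  assert (x2 : 1 <= x ^ 2) by (apply pow_R1_Rle; lra).
  assert (a1 : A * (U * x) <= A * x ^ 2).
  { apply Rmult_le_compat_l; [lra|]. replace (x ^ 2) with (x * x) by ring. apply Rmult_le_compat_r; lra. }
  assert (a2 : sigma * x <= sigma * x ^ 2).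
  { apply Rmult_le_compat_l; [lra|]. replace (x ^ 2) with (x * x) by ring.
    rewrite <- (Rmult_1_l x) at 1. apply Rmult_le_compat_r; lra. }
  unfold lnQ. split; lra.
Qed.

Lemma G_pow k : G ^ k = exp (INR k * ln G).
Proof. rewrite <- (exp_ln G) at 1 by lra. apply exp_pow_nat. Qed.

Lemma lnG_nonneg : 0 <= ln G.
Proof. rewrite <- ln_1. apply ln_le_mono; lra. Qed.

(** Both conditions of [sieve_average], with the saving th = exp(-beta x/4). For long sublists the
    loss exp((c1 + c3) x) is beaten by the choice of j0 and by the margin TS - lnQ. For short ones
    the loss G^(j0 + jP) is only polynomial in x, against exp(-beta x/2). *)
Lemma sieve_ok w tau k tau' k' :
  (forall z, In z (grid tau k) -> exp ((1 - 3 * eps) * (beta * x)) * 16 <= z <= exp ((1 - eps) * (beta * x))) ->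
  (forall z, In z (grid tau' k') -> exp ((1 - 6 * eps) * (beta * x)) * 16 <= z <= exp ((1 - 4 * eps) * (beta * x))) ->
  prodR (grid tau k) = exp lnQ -> prodR (grid tau' k') = exp (TS w) ->
  INR k <= c1 * U -> INR k' <= c3 * U -> (jP <= k')%nat ->
  lnQ + (c1 + c3 + beta) * x <= TS w ->
  forall l, In l (sel (grid tau k)) -> l <> [] ->
    / cprod (bin (Z.of_nat n)) l * rsum (energy (pset (bin (Z.of_nat n)) (grid tau' k'))) (pset (bin (Z.of_nat n)) l)
    <= exp (- (beta * x / 4)) * INR (length (pset (bin (Z.of_nat n)) (grid tau' k'))) ^ 2.
Proof.
  intros HQ HS EQ ES Hk Hk' HjPk HT.
  destruct (families_good _ _ _ _ HQ HS) as [Hg Hz]. destruct poly_bound as [p0 p1].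
  assert (bx : 0 < beta * x) by (apply Rmult_lt_0_compat; lra).
  assert (e0 : 1 <= exp (beta * x / 2)) by (rewrite <- exp_0; apply exp_le_mono; lra).
  pose proof lnG_nonneg as lG. pose proof c_pos as [cc1 cc3].
  assert (P4 : exp (beta * x / 4) * exp (- (beta * x / 2)) <= exp (- (beta * x / 4))).
  { rewrite <- exp_plus. apply exp_le_mono. lra. }
  apply (sieve_average (bin (Z.of_nat n)) _ _ G (exp (beta * x / 2)) (exp (beta * x)) (1 + 2 * lnQ) _ j0 jP); auto.
  - intros z h. destruct (Hz z h) as ([h1 h2] & h3 & h4). split; [|auto]. lra.
  - rewrite EQ, ln_exp. lra.
  - rewrite length_grid; auto.
  - rewrite !length_grid, G_pow, plus_INR, EQ, ES, exp_pow_nat.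
    assert (gk : (INR k + INR k') * ln G <= (c1 + c3) * x).
    { apply Rle_trans with ((c1 + c3) * (U * ln G)).
      - rewrite <- Rmult_assoc. apply Rmult_le_compat_r; lra.
      - apply Rmult_le_compat_l; lra. }
    assert (t1 : 4 / exp (INR (S j0) * (beta * x / 2)) <= 4 * exp (- ((c1 + c3 + beta) * x))).
    { unfold Rdiv. rewrite <- exp_Ropp. apply Rmult_le_compat_l; [lra|]. apply exp_le_mono.
      assert ((c1 + c3 + beta) * x <= INR (S j0) * beta / 2 * x) by (apply Rmult_le_compat_r; lra). lra. }
    assert (t2 : 8 * (1 + 2 * lnQ) * exp lnQ / exp (TS w) <= 8 * (1 + 2 * lnQ) * exp (- ((c1 + c3 + beta) * x))).
    { unfold Rdiv. rewrite <- exp_Ropp, Rmult_assoc, <- exp_plus. apply Rmult_le_compat_l; [lra|]. apply exp_le_mono. lra. }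
    apply Rle_trans with (exp ((c1 + c3) * x) * ((4 + 8 * (1 + 2 * lnQ)) * exp (- ((c1 + c3 + beta) * x)))).
    { apply Rmult_le_compat.
      - left; apply exp_pos.
      - apply Rplus_le_le_0_compat.
        + left. apply Rdiv_lt_0_compat; [lra|apply exp_pos].
        + apply Rmult_le_pos; [|left; apply Rinv_0_lt_compat, exp_pos]. apply Rmult_le_pos; [lra|left; apply exp_pos].
      - apply exp_le_mono; auto.
      - lra. }
    rewrite <- Rmult_assoc, (Rmult_comm (exp _)), Rmult_assoc, <- exp_plus.
    replace ((c1 + c3) * x + - ((c1 + c3 + beta) * x)) with (- (beta * x)) by ring.
    assert (Gj : 1 <= G ^ (j0 + jP)) by (apply pow_R1_Rle; auto).
    assert (q1 : 4 + 8 * (1 + 2 * lnQ) <= exp (beta * x / 4)).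
    { eapply Rle_trans; [apply p1|]. eapply Rle_trans; [|apply g7].
      rewrite <- (Rmult_1_l ((4 + _) * _)) at 1. apply Rmult_le_compat_r; lra. }
    apply Rle_trans with (exp (beta * x / 4) * exp (- (beta * x))).
    + apply Rmult_le_compat_r; [left; apply exp_pos|auto].
    + rewrite <- exp_plus. apply exp_le_mono. lra.
  - rewrite !exp_pow_nat.
    assert (EP : INR j0 * (beta * x) - INR jP * (beta * x / 2) = - (beta * x / 2)).
    { rewrite HjP, plus_INR, mult_INR. simpl (INR 2). simpl (INR 1). field. }
    assert (t2 : exp (INR j0 * (beta * x)) / exp (INR jP * (beta * x / 2)) = exp (- (beta * x / 2))).
    { rewrite <- EP. unfold Rdiv. rewrite <- exp_Ropp, <- exp_plus. reflexivity. }
    replace (4 / exp (beta * x / 2) + 8 * (1 + 2 * lnQ) * exp (INR j0 * (beta * x)) / exp (INR jP * (beta * x / 2)))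
      with ((4 + 8 * (1 + 2 * lnQ)) * exp (- (beta * x / 2))).
    2:{ pose proof (exp_Ropp (beta * x / 2)) as t3.
        transitivity (4 * / exp (beta * x / 2) + 8 * (1 + 2 * lnQ) * (exp (INR j0 * (beta * x)) / exp (INR jP * (beta * x / 2)))).
        rewrite t2, <- t3. ring. unfold Rdiv. ring. }
    rewrite <- Rmult_assoc. eapply Rle_trans; [|apply P4]. apply Rmult_le_compat_r; [left; apply exp_pos|].
    eapply Rle_trans; [|apply g7]. apply Rmult_le_compat_l; [apply pow_le; lra|auto].
Qed.

(** The order of the choices matters: w is found from the bins of q alone, S is then sized by w, and
    only afterwards are the q with too many collisions modulo q discarded. *)
Lemma good_moduli : exists (w : Z) (zS : list R) (kQ : nat) (Qs : list Z),
  (1 <= kQ)%nat /\ INR kQ <= c1 * U /\ INR kQ <= (A * U + sigma) / ((1 - 2 * eps) * beta) + 1 /\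
  sigma * x - c2 * U <= lb w <= sigma * x - ln 8 /\
  good_bins (bin (Z.of_nat n)) zS /\
  (forall z p, In z zS -> In p (bin (Z.of_nat n) z) -> IZR p <= exp (beta * x)) /\
  (forall s, In s (pset (bin (Z.of_nat n)) zS) -> IZR s <= exp (TS w)) /\
  INR (length zS) <= c3 * U /\
  2 * INR (length zS) <= (kappa * U + delta * U * sigma + sigma) / ((1 - 5 * eps) * beta) + 2 /\
  exp (TS w - INR (length zS) * ln G) <= cprod (bin (Z.of_nat n)) zS /\
  NoDup Qs /\ exp (lnQ - INR kQ * ln G) <= 12 * INR kQ * INR (length Qs) /\
  forall q, In q Qs -> exists t, q = zprod t /\ length t = kQ /\
    (forall p, In p t -> prime p /\ exp (beta * x / 2) <= IZR p <= exp (beta * x) /\ ~ (p | Z.of_nat n)%Z) /\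
    exp (IZR w) <= IZR q < exp (IZR w + 1) /\ IZR q <= exp lnQ /\
    (forall s, In s (pset (bin (Z.of_nat n)) zS) -> Z.gcd s q = 1%Z) /\
    IZR q * coll (pset (bin (Z.of_nat n)) zS) q <= 3 / 2 * cprod (bin (Z.of_nat n)) zS ^ 2.
Proof.
  destruct Q_family as (tau & k & EQ & k1 & kU & kb & HQ).
  pose proof lnG_nonneg as lG. pose proof c_pos as [cc1 cc3].
  set (bn := bin (Z.of_nat n)). set (zQ := grid tau k) in *.
  assert (lzQ : length zQ = k) by apply length_grid.
  assert (bx : 0 < beta * x) by (apply Rmult_lt_0_compat; lra).
  assert (posQ : forall z, In z zQ -> 0 < z).
  { intros z Hz. specialize (HQ z Hz). pose proof (exp_pos ((1 - 3 * eps) * (beta * x))). lra. }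
  (* S is not chosen yet; an empty second grid yields the bounds for the bins of q. *)
  destruct (families_good tau k 0 0 HQ ltac:(intros z [])) as [_ HzQ]. fold zQ bn in HzQ.
  assert (HzQ' : forall z, In z zQ -> exp (beta * x / 2) * 16 <= z <= exp (beta * x) /\ z / G <= INR (length (bn z)) /\
    forall p, In p (bn z) -> IZR p <= z) by (intros z Hz; apply HzQ, in_app_iff; auto).
  assert (neQ : nonempty_bins bn zQ).
  { intros z Hz. destruct (HzQ' z Hz) as (_ & h & _). assert (0 < z / G) by (apply Rdiv_lt_0_compat; [auto|lra]).
    assert (h0 : 0 < INR (length (bn z))) by lra. destruct (length (bn z)); [simpl in h0; lra|lia]. }
  pose proof (cprod_pos bn zQ neQ) as cQ.
  destruct (popular_window (Z.of_nat n) zQ posQ ltac:(lia) cQ) as (w & Hw & Hpop). fold bn in Hpop.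
  rewrite EQ, ln_exp, lzQ in Hw. rewrite lzQ in Hpop.
  pose proof (lb_bounds w k kU Hw) as Hlb. destruct (TS_bounds w Hlb) as [T1 T2].
  destruct (S_family w Hlb) as (tau' & k' & ES & kj & kU' & kb' & HS).
  set (zS := grid tau' k') in *. assert (lzS : length zS = k') by apply length_grid.
  destruct (families_good _ _ _ _ HQ HS) as [Hg Hz]. fold zQ zS bn in Hg, Hz.
  pose proof (sieve_ok w _ _ _ _ HQ HS EQ ES kU kU' kj T1) as Hav. fold zQ zS bn in Hav.
  set (th := exp (- (beta * x / 4))) in *.
  assert (gQ : good_bins bn zQ) by (apply (good_bins_incl _ _ _ Hg); [apply NoDup_grid|apply incl_appl, incl_refl]).
  assert (gS : good_bins bn zS) by (apply (good_bins_incl _ _ _ Hg); [apply NoDup_grid|apply incl_appr, incl_refl]).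
  assert (low : forall zs, incl zs (zQ ++ zS) -> prodR zs / G ^ length zs <= cprod bn zs).
  { intros zs Hi. apply cprod_lower; [lra|]. intros z Hzz. destruct (Hz z (Hi z Hzz)) as (h1 & h2 & _).
    split; [pose proof (exp_pos (beta * x / 2)); lra|auto]. }
  assert (lowE : forall zs T, incl zs (zQ ++ zS) -> prodR zs = exp T -> exp (T - INR (length zs) * ln G) <= cprod bn zs).
  { intros zs T Hi E. eapply Rle_trans; [|apply (low zs Hi)]. rewrite E, G_pow. unfold Rdiv, Rminus.
    rewrite exp_plus, exp_Ropp. lra. }
  assert (cS : exp (TS w - INR (length zS) * ln G) <= cprod bn zS) by (apply lowE; auto; apply incl_appr, incl_refl).
  set (S := pset bn zS) in *.
  assert (LS : INR (length S) = cprod bn zS) by apply length_pset.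
  assert (LS0 : 0 < INR (length S)) by (rewrite LS; eapply Rlt_le_trans; [apply exp_pos|apply cS]).
  set (W := filter (fun t => Z.eqb (zfloor (ln (IZR (zprod t)))) w) (choose bn zQ)) in *.
  pose proof (good_in_window bn zQ S th W gQ neQ ltac:(left; apply exp_pos) LS0 Hav _ eq_refl) as Hgood.
  cbv zeta in Hgood. set (good := filter (fun t => decideP (rsum (energy S) (subprods t) <= 3 / 2 * INR (length S) ^ 2)) W) in *.
  rewrite lzQ in Hgood.
  assert (Hin : forall t, In t good -> In t (choose bn zQ) /\ zfloor (ln (IZR (zprod t))) = w /\
      rsum (energy S) (subprods t) <= 3 / 2 * INR (length S) ^ 2).
  { intros t Ht. apply filter_In in Ht. destruct Ht as [Ht h]. apply filter_In in Ht. destruct Ht as [Ht h'].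
    apply Z.eqb_eq in h'. unfold decideP in h. destruct (excluded_middle_informative _); [auto|discriminate]. }
  exists w, zS, k, (map zprod good).
  split; [auto|]. split; [auto|]. split; [auto|]. split; [auto|]. split; [auto|].
  split. { intros z p h hp. destruct (Hz z ltac:(apply in_app_iff; auto)) as (h1 & _ & h2). specialize (h2 p hp). lra. }
  split.
  { intros s Hs. apply in_map_iff in Hs. destruct Hs as (t & <- & Ht). rewrite <- ES.
    apply (zprod_choose_bounds bn); auto. intros z p h hp.
    destruct (Hz z ltac:(apply in_app_iff; auto)) as (h1 & _ & h2). split; [|apply h2; auto].
    destruct gS as (_ & gS & _). destruct (gS z h) as [_ gp]. pose proof (prime_ge_2 p (gp p hp)). apply IZR_le; lia. }
  rewrite lzS in *.
  split; [auto|]. split; [auto|]. split; [auto|].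
  split. { apply NoDup_map_filter, NoDup_map_filter. apply NoDup_pset; auto. }
  split.
  - rewrite length_map.
    pose proof (lowE zQ lnQ (incl_appl _ (incl_refl _)) EQ) as cQl. rewrite lzQ in cQl.
    eapply Rle_trans; [apply cQl|].
    assert (kr : 1 <= INR k) by (apply (le_INR 1); auto).
    assert (two : 2 ^ k <= exp (beta * x / 8)).
    { apply Rle_trans with (exp 1 ^ k).
      - apply pow_incr. split; [lra|]. pose proof (exp_ineq1 1 ltac:(lra)). lra.
      - rewrite exp_pow_nat. apply exp_le_mono. lra. }
    (* The window holds at least cprod zQ / (6k) choices; this inequality says that at most half of
       that number are discarded. *)
    assert (bad : 24 * INR k * 2 ^ k * th <= 1).
    { apply Rle_trans with (exp (beta * x / 8) * exp (beta * x / 8) * th).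
      - apply Rmult_le_compat_r; [left; apply exp_pos|]. apply Rmult_le_compat; [lra|left; apply pow_lt; lra| |auto].
        eapply Rle_trans; [|apply g8'].
        assert (c1 * U <= c1 * x) by (apply Rmult_le_compat_l; lra). lra.
      - unfold th. rewrite <- !exp_plus. rewrite <- exp_0. apply exp_le_mono. lra. }
    assert (bad' : 6 * INR k * (2 * 2 ^ k * th * cprod bn zQ) <= cprod bn zQ / 2).
    { replace (6 * INR k * (2 * 2 ^ k * th * cprod bn zQ)) with (24 * INR k * 2 ^ k * th * (cprod bn zQ / 2)) by field.
      rewrite <- (Rmult_1_l (cprod bn zQ / 2)) at 2. apply Rmult_le_compat_r; lra. }
    assert (Hg2 : 6 * INR k * (INR (length W) - 2 * 2 ^ k * th * cprod bn zQ) <= 6 * INR k * INR (length good)).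
    { apply Rmult_le_compat_l; lra. }
    lra.
  - intros q Hq. apply in_map_iff in Hq. destruct Hq as (t & <- & Ht). destruct (Hin t Ht) as (h1 & h2 & h3).
    exists t. destruct (choose_ln_bounds (Z.of_nat n) zQ t posQ h1) as (q0 & q1 & q2).
    rewrite EQ, ln_exp in q2.
    split; [auto|]. split.
    { pose proof (proj1 (in_choose bn zQ t) h1) as F. apply Forall2_length in F. lia. }
    split.
    { intros p Hp. split; [apply (choose_prime bn zQ t); auto|].
      destruct (choose_in_bin _ _ _ _ h1 Hp) as (z & Hzz & Hpz).
      destruct (HzQ' z Hzz) as (r1 & _ & r3). specialize (r3 p Hpz). apply in_bin in Hpz.
      destruct Hpz as (_ & Hpz & nd). split; [lra|auto]. }
    split.
    { destruct (zfloor_spec (ln (IZR (zprod t)))) as [f1 f2]. rewrite h2 in f1, f2. split.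
      - rewrite <- (exp_ln (IZR (zprod t))) by auto. apply exp_le_mono; auto.
      - rewrite <- (exp_ln (IZR (zprod t))) by auto. apply exp_increasing; auto. }
    split. { rewrite <- (exp_ln (IZR (zprod t))) by auto. apply exp_le_mono; auto. }
    split.
    { intros s Hs. rewrite Z.gcd_comm. apply (pset_coprime bn zQ zS); auto. apply in_map; auto. }
    eapply Rle_trans; [apply coll_le_energy; intros; apply (choose_prime bn zQ t); auto|]. rewrite <- LS. auto.
Qed.

(** The lower end 2^(-1/d) L of the range of m controls the top digit: m^d >= L^d / 2 and n <=
    L^(d+1) give n / m^d <= 2 L. The other d digits are below m <= L. *)
Lemma Mset_values m : In m (Mset n (S d') delta) ->
  (0 < m)%Z /\ INR (S d') * IZR m + IZR (Z.of_nat n / m ^ Z.of_nat (S d')) <= (D + 2) * exp (A * (U * x)).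
Proof.
  intros Hm. pose proof A_pos. destruct D_bounds as (D1 & D2 & D3).
  destruct (Mset_bounds n (S d') delta m ltac:(lia) Hm) as [[m1 m2] m3].
  pose proof (root2_pow (S d') (Lfun (INR n) (2 / 3) (/ delta)) ltac:(lia) ltac:(apply exp_pos)) as Hroot.
  rewrite HL2 in m1, m2, m3, Hroot. fold A in m1, m2, m3, Hroot. set (L := exp (A * (U * x))) in *.
  assert (L0 : 0 < L) by apply exp_pos.
  assert (m0 : (0 < m)%Z) by (apply lt_IZR; lra).
  split; auto.
  assert (hm : L ^ S d' / 2 <= IZR m ^ S d').
  { rewrite <- Hroot. apply pow_incr. split; [|auto]. apply Rmult_le_pos; [left; apply exp_pos|lra]. }
  assert (Ld : 0 < L ^ S d') by (apply pow_lt; auto).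
  assert (hq : IZR (Z.of_nat n / m ^ Z.of_nat (S d')) <= 2 * L).
  { assert (mp : (0 < m ^ Z.of_nat (S d'))%Z) by (apply Z.pow_pos_nonneg; lia).
    pose proof (Z.mul_div_le (Z.of_nat n) _ mp) as h. apply IZR_le in h.
    rewrite mult_IZR, <- pow_IZR, <- INR_IZR_INZ in h.
    set (k := IZR (Z.of_nat n / m ^ Z.of_nat (S d'))) in *.
    assert (n0 : 0 < INR n) by (rewrite INR_IZR_INZ; apply IZR_lt, n_pos).
    assert (hn : INR n <= L * L ^ S d').
    { rewrite <- (exp_ln (INR n)), Hn by auto. unfold L. rewrite exp_pow_nat, <- exp_plus. apply exp_le_mono.
      fold D. replace (A * (U * x) + D * (A * (U * x))) with ((D + 1) * A * (U * x)) by ring.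
      rewrite Rmult_assoc. apply Rmult_le_compat_r; [apply Rmult_le_pos; lra|].
      apply Rle_trans with (delta * U * A); [|apply Rmult_le_compat_r; lra].
      right. unfold A. field. lra. }
    assert (k0 : 0 <= k) by (apply IZR_le, Z.div_pos; lia).
    apply Rmult_le_reg_l with (L ^ S d' / 2); [lra|].
    apply Rle_trans with (IZR m ^ S d' * k); [apply Rmult_le_compat_r; auto|]. lra. }
  fold D. assert (D * IZR m <= D * L) by (apply Rmult_le_compat_l; lra). lra.
Qed.

(** The b coprime to q in the interval required by [b_range]. *)
Let cands (q : Z) : list Z :=
  filter (fun b => Z.eqb (Z.gcd b q) 1)
    (zrange (zceil (IZR q / exp (A * (U * x)) * (1 + 1 / (8 * D))))
            (zfloor (IZR q / exp (A * (U * x)) * (1 + 1 / (4 * D))))).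

Lemma window_ratio w q : exp (IZR w) <= IZR q < exp (IZR w + 1) ->
  exp (lb w) <= IZR q / exp (A * (U * x)) <= 3 * exp (lb w).
Proof.
  intros [h1 h2]. unfold Rdiv. rewrite <- exp_Ropp. unfold lb, Rminus. rewrite exp_plus.
  pose proof (exp_pos (- (A * (U * x)))). split.
  - apply Rmult_le_compat_r; lra.
  - rewrite <- (Rmult_assoc 3). apply Rmult_le_compat_r; [lra|]. rewrite exp_plus in h2.
    pose proof exp_le_3. pose proof (exp_pos (IZR w)).
    assert (exp (IZR w) * exp 1 <= exp (IZR w) * 3) by (apply Rmult_le_compat_l; lra). lra.
Qed.

Lemma scale_lower w : sigma * x - c2 * U <= lb w -> 32 * D * (c1 * U + 1) <= exp (lb w).
Proof.
  intros h. destruct D_bounds as (D1 & D2 & D3). pose proof c_pos.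
  apply Rle_trans with (exp (sigma * x / 2)); [|apply exp_le_mono; lra].
  eapply Rle_trans; [|apply g9'].
  assert (a1 : c1 * U + 1 <= (c1 + 1) * x).
  { assert (c1 * U <= c1 * x) by (apply Rmult_le_compat_l; lra). lra. }
  assert (a2 : D <= (delta + 1) * x).
  { assert ((delta + 1) * U <= (delta + 1) * x) by (apply Rmult_le_compat_l; lra). lra. }
  apply Rle_trans with (32 * ((delta + 1) * x) * ((c1 + 1) * x)).
  - apply Rmult_le_compat; [lra| |lra|auto]. assert (0 <= c1 * U) by (apply Rmult_le_pos; lra). lra.
  - assert (0 <= (delta + 1) * x * ((c1 + 1) * x)) by (repeat apply Rmult_le_pos; lra).
    replace (64 * (delta + 1) * (1 + c1) * x ^ 2) with (64 * ((delta + 1) * x * ((c1 + 1) * x))) by ring. lra.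
Qed.

(** The interval has length about X/(8D). The few primes of q, all at least exp(beta x/2), exclude
    less than half of it. *)
Lemma cands_count w q t : sigma * x - c2 * U <= lb w -> exp (IZR w) <= IZR q < exp (IZR w + 1) ->
  q = zprod t -> INR (length t) <= c1 * U -> (forall p, In p t -> prime p /\ exp (beta * x / 2) <= IZR p) ->
  exp (lb w) / (16 * D) <= INR (length (cands q)).
Proof.
  intros h hq Hq Ht Hp. destruct D_bounds as (D1 & D2 & D3). pose proof c_pos.
  destruct (window_ratio w q hq) as [r1 r2]. pose proof (scale_lower w h) as h32.
  unfold cands. set (X := IZR q / exp (A * (U * x))) in *.
  set (lo := zceil (X * (1 + 1 / (8 * D)))). set (hi := zfloor (X * (1 + 1 / (4 * D)))).
  destruct (zceil_spec (X * (1 + 1 / (8 * D)))) as [a1 a2]. fold lo in a1, a2.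
  destruct (zfloor_spec (X * (1 + 1 / (4 * D)))) as [b1 b2]. fold hi in b1, b2.
  set (s := X / (8 * D)).
  assert (e1 : X * (1 + 1 / (8 * D)) = X + s) by (unfold s; field; lra).
  assert (e2 : X * (1 + 1 / (4 * D)) = X + 2 * s) by (unfold s; field; lra).
  rewrite e1 in a1, a2. rewrite e2 in b1, b2.
  set (K := INR (length t)) in *. assert (K0 : 0 <= K) by apply pos_INR.
  assert (sK : 4 * (K + 1) <= s).
  { unfold s. apply le_div_iff; [lra|].
    assert (32 * D * (K + 1) <= 32 * D * (c1 * U + 1)) by (apply Rmult_le_compat_l; lra). lra. }
  assert (Hlh : (lo <= hi + 1)%Z).
  { apply le_IZR. rewrite plus_IZR. lra. }
  assert (EI : IZR (hi - lo + 1) = IZR hi - IZR lo + 1) by (rewrite plus_IZR, minus_IZR; auto).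
  set (Y := exp (beta * x / 2)) in *.
  assert (HY : 4 * K <= Y).
  { eapply Rle_trans; [|apply g9]. assert (c1 * U <= c1 * x) by (apply Rmult_le_compat_l; lra). lra. }
  assert (Y0 : 0 < Y) by apply exp_pos.
  pose proof (count_coprime t Y lo hi Y0 Hlh Hp) as Hc. rewrite <- Hq in Hc.
  eapply Rle_trans; [|apply Hc]. rewrite EI. fold K.
  set (I := IZR hi - IZR lo + 1) in *.
  assert (hI : s - 1 <= I) by (unfold I; lra).
  assert (hK : K * (I / Y) <= I / 4).
  { unfold Rdiv. rewrite (Rmult_comm I), <- Rmult_assoc, (Rmult_comm I). apply Rmult_le_compat_r; [lra|].
    apply div_le_iff; lra. }
  assert (e3 : exp (lb w) / (16 * D) <= s / 2).
  { unfold s. replace (X / (8 * D) / 2) with (X / (16 * D)) by (field; lra).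
    apply Rmult_le_compat_r; [left; apply Rinv_0_lt_compat; lra|auto]. }
  rewrite Rmult_plus_distr_l, Rmult_1_r. lra.
Qed.

Lemma two_TS w : exp (TS w) * exp (TS w) = exp (kappa * (U * x)) * (exp (lb w) ^ S d') / 8.
Proof.
  rewrite exp_pow_nat, <- !exp_plus. fold D. unfold Rdiv. rewrite <- (exp_ln 8) by lra.
  rewrite <- exp_Ropp, <- exp_plus. f_equal. unfold TS. field.
Qed.

Lemma C_large : 1 <= exp ((kappa - A) * (U * x)) /\ 8 * (D + 2) <= exp ((kappa - A) * (U * x)).
Proof.
  destruct D_bounds as (D1 & D2 & D3).
  assert (h : exp ((kappa - A) * x) <= exp ((kappa - A) * (U * x))).
  { apply exp_le_mono. apply Rmult_le_compat_l; [lra|]. rewrite <- (Rmult_1_l x) at 1. apply Rmult_le_compat_r; lra. }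
  assert ((delta + 1) * U <= (delta + 1) * x) by (apply Rmult_le_compat_l; lra). lra.
Qed.

Lemma L_large : 16 * D <= exp (A * (U * x)).
Proof.
  destruct D_bounds as (D1 & D2 & D3). pose proof A_pos.
  assert (h : exp (A * x) <= exp (A * (U * x))).
  { apply exp_le_mono. apply Rmult_le_compat_l; [lra|]. rewrite <- (Rmult_1_l x) at 1. apply Rmult_le_compat_r; lra. }
  assert ((delta + 1) * U <= (delta + 1) * x) by (apply Rmult_le_compat_l; lra). lra.
Qed.

(** The powers of C, L and exp(lb w) cancel. For one pair (q, b) the proportion of good c is nothing
    but the density loss of s s', and the number of pairs divided by the number of m is about exp(2
    sigma x), again up to density. Hence G enters once per bin of q and twice per bin of S; the last
    bracket collects factors exponential in kQ, kS, D and U. *)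
Lemma ExpX_explicit : exists kQ kS : nat,
  INR kQ <= c1 * U /\ INR kS <= c3 * U /\
  INR kQ <= (A * U + sigma) / ((1 - 2 * eps) * beta) + 1 /\
  2 * INR kS <= (kappa * U + delta * U * sigma + sigma) / ((1 - 5 * eps) * beta) + 2 /\
  exp (2 * (sigma * x) - (INR kQ + 2 * INR kS) * ln G - (c2 * U + 12 * INR kQ + 24 * D + INR kS + 9))
  <= ExpX n (S d') delta kappa sigma beta beta.
Proof.
  destruct good_moduli as (w & zS & kQ & Qs & kQ1 & kQU & kQb & Hlb & gS & HyS & HNS & kSU & kSb & cS & NQs & HQs & HQ).
  exists kQ, (length zS). split; [auto|]. split; [auto|]. split; [auto|]. split; [auto|].
  set (kS := length zS) in *.
  destruct D_bounds as (D1 & D2 & D3). pose proof A_pos as A0. pose proof lnG_nonneg as lG. pose proof c_pos as [cc1 cc3].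
  destruct ln_small_ub as (l8 & l6 & l32 & l3 & l8' & l6' & l3' & l32').
  destruct C_large as [C1 C8]. pose proof L_large as L16.
  set (L := exp (A * (U * x))) in *. set (C := exp ((kappa - A) * (U * x))) in *.
  set (lbw := lb w) in *. set (B := exp lbw) in *.
  assert (B0 : 0 < B) by apply exp_pos.
  assert (L0 : 0 < L) by apply exp_pos.
  (* The logarithm of the bound for one pair: |S|^2, then 2 q <= 6 exp(lb w) L, then floor(C/(4b))
     >= C/(32 exp(lb w)) because b <= 4 exp(lb w) and rounding at most halves, and finally 2^(-kS)
     bounded by exp(-kS). *)
  set (K0 := exp (2 * (TS w - INR kS * ln G) - ln 6 - lbw - A * (U * x) + INR d' * ((kappa - A) * (U * x) - ln 32 - lbw) - INR kS)).
  pose proof (ExpX_lower (bin (Z.of_nat n)) zS n d' delta kappa sigma beta Qs cands ((D + 2) * L) (exp (TS w)) (B / (16 * D)) K0) as HX.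
  cbv zeta in HX. rewrite !HL1, !HL2 in HX. fold A L C in HX.
  pose proof (scale_lower w ltac:(apply Hlb)) as h32. fold lbw B in h32.
  assert (B64 : 32 <= B).
  { eapply Rle_trans; [|apply h32]. assert (0 <= c1 * U) by (apply Rmult_le_pos; lra).
    assert (1 * (0 + 1) <= D * (c1 * U + 1)) by (apply Rmult_le_compat; lra). lra. }
  assert (C32 : 32 * B <= C).
  { unfold B, C. rewrite <- (exp_ln 32) at 1 by lra. rewrite <- exp_plus. apply exp_le_mono.
    assert ((sigma + 5) * x <= (kappa - A) * U * x) by (apply Rmult_le_compat_r; lra).
    destruct Hlb as [_ hl]. assert (5 * 1 <= 5 * x) by (apply Rmult_le_compat_l; lra). lra. }
  assert (LB : forall q b, In q Qs -> In b (cands q) ->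
     Z.gcd b q = 1%Z /\ 0 < IZR q /\ IZR q <= 3 * B * L /\ B <= IZR b /\ IZR b <= 4 * B /\ IZR b * L <= 5 / 4 * IZR q /\
     IZR b * (Rpower 2 (- (1 / INR (S d'))) * L + 1) <= IZR q <= IZR b * (L - 1)).
  { intros q b Hq Hb. destruct (HQ q Hq) as (t & Et & lt & Hp & Hwin & Hq2 & _).
    destruct (window_ratio w q Hwin) as [r1 r2]. fold L lbw B in r1, r2.
    unfold cands in Hb. apply filter_In in Hb. destruct Hb as [Hb Hg]. apply Z.eqb_eq in Hg. apply in_zrange in Hb.
    fold L in Hb.
    assert (q0 : 0 < IZR q) by (pose proof (exp_pos (IZR w)); lra).
    assert (br : IZR q / L * (1 + 1 / (8 * D)) <= IZR b <= IZR q / L * (1 + 1 / (4 * D))).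
    { destruct Hb as [hb1 hb2]. apply IZR_le in hb1, hb2.
      destruct (zceil_spec (IZR q / L * (1 + 1 / (8 * D)))). destruct (zfloor_spec (IZR q / L * (1 + 1 / (4 * D)))). lra. }
    destruct (b_range L D (IZR q) (IZR b) D1 L16 q0 br) as ([e1 e2] & e3 & e4).
    assert (b0 : 0 < IZR b) by lra.
    assert (qL : IZR q <= 3 * B * L).
    { apply Rmult_le_reg_r with (/ L); [apply Rinv_0_lt_compat; auto|]. rewrite (Rmult_assoc (3 * B)), Rinv_r by lra.
      unfold Rdiv in r2. lra. }
    split; [auto|]. split; [auto|]. split; [auto|]. split; [lra|]. split.
    { apply Rmult_le_reg_r with L; auto. lra. }
    split; [auto|]. split; [|auto].
    destruct (root2_bounds (S d') ltac:(lia)) as [_ rt]. fold D in rt.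
    fold D. eapply Rle_trans; [|apply e1]. apply Rmult_le_compat_l; [lra|]. apply Rplus_le_compat_r, Rmult_le_compat_r; lra. }
  (* s s' and fhat each take at most C L b^d / 8. As b L <= (5/4) q, their sum is at most 5/16 of q
     C b^(d-1), below the admissible 1/2. *)
  assert (HB : forall q b, In q Qs -> In b (cands q) ->
     exp (TS w) * exp (TS w) + (D + 2) * L * IZR b ^ S d' <= IZR q * (C / 2 * IZR b ^ d')).
  { intros q b Hq Hb. destruct (LB q b Hq Hb) as (_ & q0 & _ & b1 & _ & b3 & _).
    set (bb := IZR b) in *. assert (bd : 0 < bb ^ d') by (apply pow_lt; lra).
    assert (bd' : 0 < bb ^ S d') by (apply pow_lt; lra).
    rewrite two_TS. fold lbw B.
    replace (exp (kappa * (U * x))) with (C * L) by (unfold C, L; rewrite <- exp_plus; f_equal; ring).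
    assert (p1 : B ^ S d' <= bb ^ S d') by (apply pow_incr; lra).
    assert (CL : 0 < C * L) by (apply Rmult_lt_0_compat; lra).
    assert (t1 : C * L * B ^ S d' <= C * L * bb ^ S d') by (apply Rmult_le_compat_l; lra).
    assert (t2 : 8 * (D + 2) * (L * bb ^ S d') <= C * (L * bb ^ S d')).
    { apply Rmult_le_compat_r; [|auto]. apply Rmult_le_pos; lra. }
    assert (t3 : bb * L * (C * bb ^ d') <= 5 / 4 * IZR q * (C * bb ^ d')).
    { apply Rmult_le_compat_r; [apply Rmult_le_pos; lra|auto]. }
    assert (E : bb * L * (C * bb ^ d') = C * L * bb ^ S d') by (cbn [pow]; ring).
    rewrite E in t3.
    assert (CLb : 0 < C * L * bb ^ S d') by (apply Rmult_lt_0_compat; auto).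
    assert (CQ : 0 < IZR q * (C * bb ^ d')) by (apply Rmult_lt_0_compat; auto; apply Rmult_lt_0_compat; lra).
    replace (IZR q * (C / 2 * bb ^ d')) with (IZR q * (C * bb ^ d') / 2) by field.
    lra. }
  assert (HK : forall q b, In q Qs -> In b (cands q) ->
     K0 <= cprod (bin (Z.of_nat n)) zS ^ 2 / (2 * IZR q) * IZR (zfloor (C / (4 * IZR b))) ^ d' / 2 ^ kS).
  { intros q b Hq Hb. destruct (LB q b Hq Hb) as (_ & q0 & q3 & b1 & b4 & _).
    assert (j1 : C / (32 * B) <= IZR (zfloor (C / (4 * IZR b)))).
    { destruct (zfloor_spec (C / (4 * IZR b))) as [_ f].
      assert (2 * (C / (32 * B)) <= C / (4 * IZR b)).
      { replace (2 * (C / (32 * B))) with (C / (16 * B)) by (field; lra).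
        apply Rmult_le_compat_l; [lra|]. apply Rinv_le_contravar; lra. }
      assert (1 <= C / (32 * B)) by (apply le_div_iff; lra). lra. }
    assert (j2 : exp (INR d' * ((kappa - A) * (U * x) - ln 32 - lbw)) <= IZR (zfloor (C / (4 * IZR b))) ^ d').
    { rewrite <- exp_pow_nat. apply pow_incr. split; [left; apply exp_pos|]. eapply Rle_trans; [|apply j1].
      rewrite !exp_sub, exp_ln by lra. fold C. fold B. right. field. lra. }
    assert (j3 : exp (2 * (TS w - INR kS * ln G)) <= cprod (bin (Z.of_nat n)) zS ^ 2).
    { change 2 with (INR 2) at 1. rewrite <- exp_pow_nat. apply pow_incr. split; [left; apply exp_pos|auto]. }
    assert (j4 : exp (- (ln 6 + lbw + A * (U * x))) <= / (2 * IZR q)).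
    { rewrite exp_Ropp. apply Rinv_le_contravar; [lra|]. rewrite !exp_plus, exp_ln by lra. fold B L. lra. }
    assert (j5 : exp (- INR kS) <= / 2 ^ kS).
    { rewrite exp_Ropp. apply Rinv_le_contravar; [apply pow_lt; lra|].
      replace (exp (INR kS)) with (exp 1 ^ kS) by (rewrite exp_pow_nat; f_equal; ring).
      apply pow_incr. split; [lra|]. pose proof (exp_ineq1 1 ltac:(lra)). lra. }
    unfold K0.
    replace (2 * (TS w - INR kS * ln G) - ln 6 - lbw - A * (U * x) + INR d' * ((kappa - A) * (U * x) - ln 32 - lbw) - INR kS)
      with (2 * (TS w - INR kS * ln G) + - (ln 6 + lbw + A * (U * x)) + INR d' * ((kappa - A) * (U * x) - ln 32 - lbw) + - INR kS) by ring.
    rewrite (exp_plus _ (- INR kS)), (exp_plus _ (INR d' * _)), (exp_plus _ (- (ln 6 + lbw + A * (U * x)))).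
    unfold Rdiv. apply Rmult_le_compat; [|left; apply exp_pos| |auto].
    - left. repeat apply Rmult_lt_0_compat; apply exp_pos.
    - apply Rmult_le_compat; [|left; apply exp_pos| |auto].
      left. repeat apply Rmult_lt_0_compat; apply exp_pos.
      apply Rmult_le_compat; auto; left; apply exp_pos. }
  assert (HXc := HX gS HyS HNS Mset_values NQs).
  clear HX.
  assert (Q1 : forall q, In q Qs -> (0 < q)%Z /\ Z.gcd (Z.of_nat n) q = 1%Z /\ smooth (exp (beta * x)) q /\
     (forall s, In s (pset (bin (Z.of_nat n)) zS) -> Z.gcd s q = 1%Z) /\
     IZR q * coll (pset (bin (Z.of_nat n)) zS) q <= 3 / 2 * cprod (bin (Z.of_nat n)) zS ^ 2).
  { intros q Hq. destruct (HQ q Hq) as (t & Et & lt & Hp & _ & _ & H1 & H2).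
    split; [rewrite Et; apply zprod_pos; intros; apply Hp; auto|].
    split. { rewrite Z.gcd_comm, Et. apply zprod_coprime; intros; apply Hp; auto. }
    split. { rewrite Et. apply smooth_zprod. intros p Hpt. destruct (Hp p Hpt) as (? & ? & _). split; [auto|lra]. }
    auto. }
  assert (Q2 : forall q, In q Qs -> NoDup (cands q) /\ B / (16 * D) <= INR (length (cands q))).
  { intros q Hq. destruct (HQ q Hq) as (t & Et & lt & Hp & Hwin & _). split; [apply NoDup_filter, NoDup_zrange|].
    apply (cands_count w q t); auto; [apply Hlb|rewrite lt; auto|].
    intros p Hpt. destruct (Hp p Hpt) as (? & ? & _). split; [auto|lra]. }
  specialize (HXc Q1 Q2).
  assert (HXd : INR (length Qs) * (B / (16 * D)) * K0 / (INR (length (Mset n (S d') delta)) * INR (length (Icent (2 * C))) ^ S d')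
     <= ExpX n (S d') delta kappa sigma beta beta).
  { apply HXc; [|left; apply exp_pos].
    intros q b Hq Hb. destruct (LB q b Hq Hb) as (g & q0 & q3 & b1 & b4 & b5 & b6).
    split; [apply le_IZR; lra|]. split; [auto|]. split.
    { destruct (HQ q Hq) as (t & _ & _ & _ & _ & Hq2 & _).
      apply Rmult_le_reg_r with L; auto. eapply Rle_trans; [apply b5|].
      unfold lnQ in Hq2. rewrite exp_sub, exp_plus, exp_ln in Hq2 by lra. fold L in Hq2.
      assert (0 < L * exp (sigma * x)) by (apply Rmult_lt_0_compat; [auto|apply exp_pos]). lra. }
    split; [auto|]. split; [apply (HB q b); auto|apply (HK q b); auto]. }
  clear HXc. eapply Rle_trans; [|apply HXd].
  destruct (Mset_length n (S d') delta ltac:(lia) ltac:(rewrite HL2; fold A L D; lra)) as [M0 M1].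
  rewrite HL2 in M1. fold A L in M1. destruct (Icent_length C C1) as [I0 I1].
  assert (kr : 1 <= INR kQ) by (apply (le_INR 1); auto).
  assert (E1 : exp (lnQ - INR kQ * ln G - 12 * INR kQ) <= INR (length Qs)).
  { rewrite exp_sub. apply div_le_iff; [apply exp_pos|].
    eapply Rle_trans; [apply HQs|]. rewrite Rmult_comm. apply Rmult_le_compat_l; [apply pos_INR|].
    pose proof (exp_ineq1 (12 * INR kQ) ltac:(lra)). lra. }
  assert (E2' : exp (lbw - 16 * D) <= B / (16 * D)).
  { rewrite exp_sub. fold B. apply Rmult_le_compat_l; [lra|].
    apply Rinv_le_contravar; [lra|]. pose proof (exp_ineq1 (16 * D) ltac:(lra)). lra. }
  assert (E3 : exp (- (A * (U * x) + D * (2 + (kappa - A) * (U * x)))) <= / (INR (length (Mset n (S d') delta)) * INR (length (Icent (2 * C))) ^ S d')).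
  { rewrite exp_Ropp. apply Rinv_le_contravar.
    - apply Rmult_lt_0_compat; [auto|apply pow_lt; auto].
    - rewrite exp_plus. fold L. apply Rmult_le_compat; [lra|apply pow_le; lra|auto|].
      unfold D. rewrite <- exp_pow_nat. apply pow_incr. split; [lra|]. rewrite exp_plus. fold C.
      eapply Rle_trans; [apply I1|]. apply Rmult_le_compat_r; [lra|].
      pose proof (exp_ineq1 2 ltac:(lra)). lra. }
  apply Rle_trans with (exp (lnQ - INR kQ * ln G - 12 * INR kQ) * exp (lbw - 16 * D) * K0 * exp (- (A * (U * x) + D * (2 + (kappa - A) * (U * x))))).
  - unfold K0. rewrite <- !exp_plus. apply exp_le_mono.
    assert (Ed : INR d' = D - 1) by (unfold D; rewrite S_INR; ring).
    rewrite Ed. unfold TS, lnQ. fold lbw. destruct Hlb as [hl _].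
    assert (Dl : (D - 1) * ln 32 <= (D - 1) * 5) by (apply Rmult_le_compat_l; lra).
    lra.
  - unfold Rdiv at 1. apply Rmult_le_compat; [|left; apply exp_pos| |auto].
    + left. repeat apply Rmult_lt_0_compat; apply exp_pos.
    + apply Rmult_le_compat; [|left; apply exp_pos| |lra].
      left. repeat apply Rmult_lt_0_compat; apply exp_pos.
      apply Rmult_le_compat; auto; left; apply exp_pos.
Qed.

End LargeParameters.


(** * Passage to the limit *)

Lemma mult_of_div a b c : 0 < b -> a / b <= c -> a <= b * c.
Proof.
  intros Hb H. replace a with (b * (a / b)) by (field; lra). apply Rmult_le_compat_l; lra.
Qed.

(** kQ + 2 kS is about Sg U and ln G about V/3, so the density loss is about Sg x/3, the sum of the
    two terms subtracted in tau. The errors due to eps, to the rounding of the numbers of bins and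
    to the factors exponential in U take eta x/4 each. *)
Lemma final_cost (delta kappa sigma beta eps eta U V lnG D kQ kS c1 c2 c3 : R) :
  0 < delta -> 0 < kappa -> 0 < sigma -> 0 < beta -> 0 < eps <= 1 / 12 -> 0 < eta ->
  let A := / delta in
  let Sg := (A + kappa + sigma * delta) / beta in
  24 * eps * Sg <= eta -> 1 <= U -> 1 <= V ->
  4 * (2 * sigma / ((1 - 5 * eps) * beta) + 3) <= eta * U ->
  4 * (c2 + 12 * c1 + 24 * (delta + 1) + c3 + 9) <= eta * V ->
  0 <= lnG <= (1 / 3 + eps) * V ->
  kQ <= c1 * U -> kS <= c3 * U -> D <= (delta + 1) * U ->
  kQ <= (A * U + sigma) / ((1 - 2 * eps) * beta) + 1 ->
  2 * kS <= (kappa * U + delta * U * sigma + sigma) / ((1 - 5 * eps) * beta) + 2 ->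
  (2 * sigma - Sg / 3 - eta) * (U * V) <=
  2 * (sigma * (U * V)) - (kQ + 2 * kS) * lnG - (c2 * U + 12 * kQ + 24 * D + kS + 9).
Proof.
  intros Hd Hk Hs Hb He Heta A Sg hS hU hV h5 h4 hG k1 k2 kD k3 k4.
  assert (A0 : 0 < A) by (apply Rinv_0_lt_compat; auto).
  set (b5 := (1 - 5 * eps) * beta) in *.
  assert (hb5 : 0 < b5) by (apply Rmult_lt_0_compat; lra).
  set (x := U * V) in *.
  assert (Ux : U <= x) by (unfold x; rewrite <- (Rmult_1_r U) at 1; apply Rmult_le_compat_l; lra).
  assert (sd : 0 < sigma * delta) by (apply Rmult_lt_0_compat; lra).
  assert (Sg0 : 0 < Sg) by (apply Rdiv_lt_0_compat; lra).
  set (c5 := 2 * sigma / b5 + 3) in *.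
  assert (kk : kQ + 2 * kS <= Sg * U / (1 - 5 * eps) + c5).
  { assert (q1 : (A * U + sigma) / ((1 - 2 * eps) * beta) <= (A * U + sigma) / b5).
    { assert (0 < A * U) by (apply Rmult_lt_0_compat; lra).
      apply Rmult_le_compat_l; [lra|]. apply Rinv_le_contravar; auto. apply Rmult_le_compat_r; lra. }
    replace (Sg * U / (1 - 5 * eps) + c5) with
      ((A * U + sigma) / b5 + 1 + ((kappa * U + delta * U * sigma + sigma) / b5 + 2)); [lra|].
    unfold c5, Sg, b5. field. lra. }
  assert (e1 : (1 / 3 + eps) / (1 - 5 * eps) <= 1 / 3 + 6 * eps).
  { apply div_le_iff; [lra|]. assert (eps * eps <= eps * (1 / 12)) by (apply Rmult_le_compat_l; lra). lra. }
  assert (m1 : (kQ + 2 * kS) * lnG <= (Sg * U / (1 - 5 * eps) + c5) * ((1 / 3 + eps) * V)).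
  { assert (c50 : 0 < c5) by (unfold c5; assert (0 < 2 * sigma / b5) by (apply Rdiv_lt_0_compat; lra); lra).
    assert (0 < Sg * U / (1 - 5 * eps)) by (apply Rdiv_lt_0_compat; [apply Rmult_lt_0_compat; lra|lra]).
    apply Rle_trans with ((Sg * U / (1 - 5 * eps) + c5) * lnG).
    - apply Rmult_le_compat_r; lra.
    - apply Rmult_le_compat_l; lra. }
  assert (m2 : (Sg * U / (1 - 5 * eps) + c5) * ((1 / 3 + eps) * V) <= (Sg / 3 + eta / 4) * x + eta / 4 * x).
  { replace ((Sg * U / (1 - 5 * eps) + c5) * ((1 / 3 + eps) * V)) with
      (Sg * x * ((1 / 3 + eps) / (1 - 5 * eps)) + c5 * V * (1 / 3 + eps)) by (unfold x; field; lra).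
    assert (Sx : 0 < Sg * x) by (apply Rmult_lt_0_compat; lra).
    assert (p1 : Sg * x * ((1 / 3 + eps) / (1 - 5 * eps)) <= Sg * x * (1 / 3 + 6 * eps)) by (apply Rmult_le_compat_l; lra).
    assert (p2 : 24 * eps * Sg * x <= eta * x) by (apply Rmult_le_compat_r; lra).
    assert (c50 : 0 < c5) by (unfold c5; assert (0 < 2 * sigma / b5) by (apply Rdiv_lt_0_compat; lra); lra).
    assert (p3 : c5 * V * (1 / 3 + eps) <= c5 * V * 1).
    { apply Rmult_le_compat_l; [apply Rmult_le_pos; lra|lra]. }
    assert (p4 : 4 * c5 * V <= eta * U * V) by (apply Rmult_le_compat_r; lra).
    replace (eta * U * V) with (eta * x) in p4 by (unfold x; ring). lra. }
  assert (m3 : c2 * U + 12 * kQ + 24 * D + kS + 9 <= eta / 4 * x).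
  { assert (p : 4 * (c2 + 12 * c1 + 24 * (delta + 1) + c3 + 9) * U <= eta * V * U) by (apply Rmult_le_compat_r; lra).
    replace (eta * V * U) with (eta * x) in p by (unfold x; ring). lra. }
  assert (0 < eta * x) by (apply Rmult_lt_0_compat; lra).
  lra.
Qed.

(** n enters only through the identities for ln n and [Lfun], so all largeness conditions are
    thresholds on U and V and are collected by [ev] before n appears. *)
Lemma main_lower (delta kappa sigma beta eta : R) :
  0 < delta -> 0 < kappa -> 0 < sigma -> 0 < beta -> 0 < eta ->
  / delta < kappa -> / delta < (sigma * delta + kappa) / 2 ->
  ev (fun U V => forall n d', ln (INR n) = U * U * (U * V) ->
    (forall c, Lfun (INR n) (1 / 3) c = exp (c * (U * V))) ->
    (forall c, Lfun (INR n) (2 / 3) c = exp (c * (U * (U * V)))) ->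
    Rabs (INR (S d') - delta * U) <= 1 ->
    exp ((2 * sigma - (/ delta + kappa + sigma * delta) / beta / 3 - eta) * (U * V))
    <= ExpX n (S d') delta kappa sigma beta beta).
Proof.
  intros Hd Hk Hs Hb Heta HA1 HA2.
  set (A := / delta) in *. assert (A0 : 0 < A) by (apply Rinv_0_lt_compat; auto).
  set (Sg := (A + kappa + sigma * delta) / beta).
  assert (sd : 0 < sigma * delta) by (apply Rmult_lt_0_compat; lra).
  assert (Sg0 : 0 < Sg) by (apply Rdiv_lt_0_compat; lra).
  (* 24 eps Sg <= eta, the form in which [final_cost] absorbs the shortfall of the primes below
     exp(beta x). *)
  set (eps := Rmin (1 / 12) (eta / (24 * Sg))).
  assert (Heps : 0 < eps <= 1 / 12).
  { split; [|apply Rmin_l]. apply Rmin_glb_lt; [lra|]. apply Rdiv_lt_0_compat; lra. }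
  assert (HepsS : 24 * eps * Sg <= eta).
  { assert (h : eps <= eta / (24 * Sg)) by apply Rmin_r.
    replace eta with (eta / (24 * Sg) * (24 * Sg)) by (field; lra).
    replace (24 * eps * Sg) with (eps * (24 * Sg)) by ring. apply Rmult_le_compat_r; lra. }
  set (c1 := (A + sigma) / ((1 - 2 * eps) * beta) + 1).
  set (c2 := 4 * c1 + 4).
  set (c3 := (kappa + (delta + 1) * sigma) / (2 * (1 - 5 * eps) * beta) + 1).
  destruct (INR_unbounded (2 * (c1 + c3 + beta) / beta)) as [j0 Hj0].
  set (jP := (2 * j0 + 1)%nat).
  set (e0 := (kappa + sigma * delta - 2 * A) / 2). assert (e00 : 0 < e0) by (unfold e0; lra).
  (* The constant left in the condition on G^(j0 + jP) when G = 16 beta x is expanded; the power of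
     x is then j0 + jP + 2. *)
  set (cG := (16 * beta) ^ (j0 + jP) * (4 + 8 * (1 + 2 * (A + sigma)))).
  assert (c10 : 1 <= c1).
  { unfold c1. assert (0 < (A + sigma) / ((1 - 2 * eps) * beta)); [|lra].
    apply Rdiv_lt_0_compat; [lra|apply Rmult_lt_0_compat; lra]. }
  refine (ev_mono _ _ _ (ev_and _ _ (ev_U 1)
    (ev_and _ _ (ev_V 1)
    (ev_and _ _ ev_lnU
    (ev_and _ _ (ev_lnV (eps / 2) ltac:(lra))
    (ev_and _ _ (ev_V (ln (16 * beta) / (eps / 2)))
    (ev_and _ _ (ev_U (1 / (16 * beta)))
    (ev_and _ _ (ev_U (2 * beta / (eps * A)))
    (ev_and _ _ (ev_U (INR jP * beta / A))
    (ev_and _ _ (ev_U ((3 * sigma + 3 + 2 * (c1 + c3 + beta)) / e0))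
    (ev_and _ _ (ev_U ((sigma + 5) / (kappa - A)))
    (ev_and _ _ (ev_U (4 * (2 * sigma / ((1 - 5 * eps) * beta) + 3) / eta))
    (ev_and _ _ (ev_U (3 / sigma))
    (ev_and _ _ (ev_V (8 * c1 / (eps * beta)))
    (ev_and _ _ (ev_V (8 * c3 / (eps * beta)))
    (ev_and _ _ (ev_V (2 * c2 / sigma))
    (ev_and _ _ (ev_V (delta * c2 / e0))
    (ev_and _ _ (ev_V (8 * c1 / beta))
    (ev_and _ _ (ev_V (4 * (c2 + 12 * c1 + 24 * (delta + 1) + c3 + 9) / eta))
    (ev_and _ _ (ev_exp (beta / 2) (10 ^ 8) 0 ltac:(lra))
    (ev_and _ _ (ev_exp (beta / 2) (32 * beta) 4 ltac:(lra))
    (ev_and _ _ (ev_exp (beta / 4) cG (j0 + jP + 2) ltac:(lra))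
    (ev_and _ _ (ev_exp (beta / 8) (24 * c1) 1 ltac:(lra))
    (ev_and _ _ (ev_exp (beta / 2) (4 * c1) 1 ltac:(lra))
    (ev_and _ _ (ev_exp (sigma / 2) (64 * (delta + 1) * (1 + c1)) 2 ltac:(lra))
    (ev_and _ _ (ev_exp A (16 * (delta + 1)) 1 A0)
    (ev_exp (kappa - A) (8 * (delta + 3)) 1 ltac:(lra)))))))))))))))))))))))))))).
  intros U V (hU & hV & hlU & hlV & hlb & u1 & u2 & u3 & u4 & u5 & u6 & u7 & v1 & v2 & v3 & v4 & v5 & v6
     & x1 & x2 & x3 & x4 & x5 & x6 & x7 & x8) n d' Hn HL1 HL2 HD.
  set (x := U * V) in *.
  assert (eb : 0 < eps * beta) by (apply Rmult_lt_0_compat; lra).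
  apply mult_of_div in hlb; [|lra]. apply mult_of_div in u1; [|lra].
  apply mult_of_div in u2; [|apply Rmult_lt_0_compat; lra]. apply mult_of_div in u3; [|lra].
  apply mult_of_div in u4; [|lra]. apply mult_of_div in u5; [|lra]. apply mult_of_div in u6; [|lra].
  apply mult_of_div in u7; [|lra].
  apply mult_of_div in v1; [|lra]. apply mult_of_div in v2; [|lra]. apply mult_of_div in v3; [|lra].
  apply mult_of_div in v4; [|lra]. apply mult_of_div in v5; [|lra]. apply mult_of_div in v6; [|lra].
  assert (x0 : 1 <= x).
  { unfold x. rewrite <- (Rmult_1_r 1). apply Rmult_le_compat; lra. }
  assert (Ux : U <= x) by (unfold x; rewrite <- (Rmult_1_r U) at 1; apply Rmult_le_compat_l; lra).
  assert (toU : forall a b, a <= b * V -> a * U <= b * x).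
  { intros a b h. replace (b * x) with (b * V * U) by (unfold x; ring). apply Rmult_le_compat_r; lra. }
  set (G := 16 * beta * x).
  assert (G1 : 1 <= G).
  { unfold G. apply Rle_trans with (16 * beta * U); [lra|]. apply Rmult_le_compat_l; lra. }
  assert (EG : ln G = ln (16 * beta) + ln U + ln V).
  { unfold G, x. rewrite <- Rmult_assoc, !ln_mult by (try apply Rmult_lt_0_compat; lra). ring. }
  assert (lG : 0 <= ln G) by (rewrite <- ln_1; apply ln_le_mono; lra).
  (* ln U <= V/3 is the source of the factor 1/3 in tau; ln(16 beta) and ln V take at most eps V/2
     each. *)
  assert (lG' : ln G <= (1 / 3 + eps) * V) by lra.
  assert (lGV : ln G <= V).
  { eapply Rle_trans; [apply lG'|]. rewrite <- (Rmult_1_l V) at 2. apply Rmult_le_compat_r; lra. }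
  destruct (ExpX_explicit delta kappa sigma beta eps c1 c2 c3 U x j0 jP n d') as (kQ & kS & h1 & h2 & h3 & h4 & h5); auto;
    fold A; fold e0; fold G; try lra.
  - unfold c1; lra.
  - unfold c2; lra.
  - unfold c3; lra.
  - rewrite S_INR. assert (h : 2 * (c1 + c3 + beta) / beta * beta <= INR j0 * beta) by (apply Rmult_le_compat_r; lra).
    replace (2 * (c1 + c3 + beta) / beta * beta) with (2 * (c1 + c3 + beta)) in h by (field; lra). lra.
  - assert (sigma * U <= sigma * x) by (apply Rmult_le_compat_l; lra). lra.
  - replace (delta * c2 * (U * U)) with (delta * c2 * U * U) by ring.
    replace (e0 * (U * x)) with (e0 * x * U) by ring. apply Rmult_le_compat_r; [lra|]. apply toU; auto.
  - rewrite pow_O, Rmult_1_r in x1. replace (beta * x / 2) with (beta / 2 * x) by field. auto.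
  - replace (beta * x / 2) with (beta / 2 * x) by field. auto.
  - unfold x. apply Rmult_le_compat_l; lra.
  - replace (beta * x / 4) with (beta / 4 * x) by field. eapply Rle_trans; [|apply x3]. right.
    unfold cG, G. rewrite (Rpow_mult_distr (16 * beta) x), (pow_add x (j0 + jP) 2). clear. generalize ((16 * beta) ^ (j0 + jP)) (x ^ (j0 + jP)). intros. ring.
  - replace (beta * x / 8) with (beta / 8 * x) by field. apply toU. lra.
  - rewrite pow_1 in x4. replace (beta * x / 8) with (beta / 8 * x) by field. auto.
  - rewrite pow_1 in x5. replace (beta * x / 2) with (beta / 2 * x) by field. auto.
  - replace (sigma * x / 2) with (sigma / 2 * x) by field. auto.
  - eapply Rle_trans; [|apply h5]. apply exp_le_mono. fold x. fold G.
    apply (final_cost delta kappa sigma beta eps eta U V (ln G) (INR (S d')) (INR kQ) (INR kS) c1 c2 c3); auto.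
    apply Rabs_le_bounds in HD. lra.
Qed.

(** U^3 V = ln n = e^V. If U stayed below K', then e^V would be at most K'^3 V <= V^2/4, against e^V
    > (V/2)^2; hence the constant 4 in [V0]. *)
Lemma ev_nat (P : R -> R -> Prop) : ev P ->
  exists N, forall n : nat, (N <= n)%nat ->
    let V := ln (ln (INR n)) in let U := Rpower (ln (INR n) / V) (1 / 3) in
    P U V /\ ln (INR n) = U * U * (U * V) /\
    (forall c, Lfun (INR n) (1 / 3) c = exp (c * (U * V))) /\
    (forall c, Lfun (INR n) (2 / 3) c = exp (c * (U * (U * V)))).
Proof.
  intros [K HK]. set (K' := Rmax 1 K).
  assert (K1 : 1 <= K') by apply Rmax_l. assert (K2 : K <= K') by apply Rmax_r.
  set (V0 := 4 * (K' * K' * K')).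
  destruct (INR_unbounded (exp (exp V0))) as [N HN].
  exists N. intros n Hn V U. apply le_INR in Hn.
  assert (e0 : 0 < exp (exp V0)) by apply exp_pos.
  assert (n0 : exp (exp V0) <= INR n) by lra.
  assert (l1 : exp V0 <= ln (INR n)).
  { rewrite <- (ln_exp (exp V0)). apply ln_le_mono; auto. }
  assert (e1 : 0 < exp V0) by apply exp_pos.
  assert (HV : V0 <= V). { rewrite <- (ln_exp V0). apply ln_le_mono; auto. }
  assert (KK : 1 <= K' * K') by (rewrite <- (Rmult_1_r 1); apply Rmult_le_compat; lra).
  assert (KKK : K' <= K' * K' * K') by (rewrite <- (Rmult_1_l K') at 1; apply Rmult_le_compat_r; lra).
  assert (V1 : 1 <= V) by (unfold V0 in HV; lra).
  assert (eV : exp V = ln (INR n)) by (unfold V; apply exp_ln; lra).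
  assert (lV : 0 <= ln V) by (rewrite <- ln_1; apply ln_le_mono; lra).
  assert (EU : U = exp ((V - ln V) / 3)).
  { unfold U, Rpower. f_equal. rewrite <- eV. unfold Rdiv at 2. rewrite ln_mult, ln_Rinv, ln_exp; [field|lra|apply exp_pos|apply Rinv_0_lt_compat; lra]. }
  assert (HVd : ln (ln (INR n)) = V) by reflexivity.
  clearbody U. clearbody V.
  assert (EV : exp (ln V) = V) by (apply exp_ln; lra).
  assert (U0 : 0 < U) by (rewrite EU; apply exp_pos).
  assert (EUUU : U * U * U * V = exp V).
  { transitivity (U * U * U * exp (ln V)); [rewrite EV; reflexivity|].
    rewrite EU, <- !exp_plus. f_equal. field. }
  split; [|split; [|split]].
  - apply HK.
    + apply Rnot_lt_le. intros h.
      assert (UK : U < K') by lra.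
      assert (a1 : U * U <= K' * K') by (apply Rmult_le_compat; lra).
      assert (a2 : U * U * U <= K' * K' * K') by (apply Rmult_le_compat; try lra; apply Rmult_le_pos; lra).
      assert (a3 : U * U * U * V <= V0 / 4 * V) by (apply Rmult_le_compat_r; unfold V0; lra).
      assert (a4 : V0 / 4 * V <= V / 4 * V) by (apply Rmult_le_compat_r; lra).
      assert (a5 : V / 2 * (V / 2) < exp V).
      { replace V with (V / 2 + V / 2) at 3 by field. rewrite exp_plus.
        pose proof (exp_ineq1 (V / 2) ltac:(lra)). apply Rmult_le_0_lt_compat; lra. }
      lra.
    + unfold V0 in HV; lra.
    + rewrite EU, ln_exp. lra.
  - rewrite <- eV, <- EUUU. ring.
  - intros c. unfold Lfun, Rpower. rewrite HVd, Rmult_assoc. do 2 f_equal.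
    transitivity (U * exp (ln V)); [|rewrite EV; reflexivity].
    rewrite EU, <- !exp_plus. f_equal. field.
  - intros c. unfold Lfun, Rpower. rewrite HVd, Rmult_assoc. do 2 f_equal.
    transitivity (U * (U * exp (ln V))); [|rewrite EV; reflexivity].
    rewrite EU, <- !exp_plus. f_equal. field.
Qed.

Theorem theorem5p16 (delta kappa sigma beta beta' : R) :
  0 < delta -> 0 < kappa -> 0 < sigma -> 0 < beta -> 0 < beta' ->
  beta = beta' ->
  kappa > / delta ->
  / delta < (sigma * delta + kappa) / 2 ->
  2 * sigma > Rmax beta beta' + / delta / (3 * beta)
                + (sigma * delta + kappa) / (3 * beta') ->
  exists eps1 eps2 : nat -> R,
    tends_to_zero eps1 /\ tends_to_zero eps2 /\
    exists N : nat, forall n d : nat, (N <= n)%nat -> Nat.Odd d ->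
      Rabs (INR d - delta * Rpower (ln (INR n) / ln (ln (INR n))) (1/3)) <= 1 ->
      ExpX n d delta kappa sigma beta beta' >=
      Lfun (INR n) (1/3)
        (2 * sigma - / delta / (3 * beta) * (1 + eps1 n)
                   - (sigma * delta + kappa) / (3 * beta') * (1 + eps2 n)).
Proof.
  intros Hd Hk Hs Hb _ <- HA1 HA2 _.
  set (T := (/ delta + kappa + sigma * delta) / beta / 3).
  assert (A0 : 0 < / delta) by (apply Rinv_0_lt_compat; auto).
  assert (T0 : 0 < T).
  { assert (0 < sigma * delta) by (apply Rmult_lt_0_compat; lra).
    apply Rdiv_lt_0_compat; [apply Rdiv_lt_0_compat; lra|lra]. }
  destruct (diagonal (fun e n => forall d : nat, Nat.Odd d ->
      Rabs (INR d - delta * Rpower (ln (INR n) / ln (ln (INR n))) (1/3)) <= 1 ->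
      Lfun (INR n) (1/3) (2 * sigma - T - T * e) <= ExpX n d delta kappa sigma beta beta)) as (e & He & N & HN).
  - intros eta Heta.
    (* The loss is taken relative to T, the sum of both subtracted terms, so that one function e can
       serve as either o(1). *)
    destruct (ev_nat _ (main_lower delta kappa sigma beta (T * eta) Hd Hk Hs Hb ltac:(apply Rmult_lt_0_compat; auto) HA1 HA2)) as [N HN].
    exists N. intros n Hn d Hodd HD. destruct (HN n Hn) as (HP & E1 & E2 & E3).
    (* Being odd, d is a successor. *)
    destruct d as [|d']; [destruct Hodd as [k Hk0]; lia|].
    rewrite E2. apply HP; auto.
  - exists e, e. split; [auto|split; [auto|]]. exists N. intros n d Hn Hodd HD.
    apply Rle_ge. replace (2 * sigma - / delta / (3 * beta) * (1 + e n) - (sigma * delta + kappa) / (3 * beta) * (1 + e n))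
      with (2 * sigma - T - T * e n) by (unfold T; field; lra).
    apply HN; auto.
Qed.
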